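(* Let $0 < h_m < h_M$ be arbitrarily given. Let $N_0 \geq 1$ be such that $\lambda_{N_0+1} < -2\sqrt{5}\,|c|$ and consider the matrices $A \in \mathbb{R}^{N_0\times N_0}$ and $B\in\mathbb{R}^{N_0\times 2}$ defined in the context. Let $K \in \mathbb{R}^{2\times N_0}$ be such that $A_{\mathrm{cl}} = A + BK$ is Hurwitz with simple eigenvalues $\mu_1,\ldots,\mu_{N_0}\in\mathbb{C}$ satisfying $\operatorname{Re}\mu_n < -3|c|$ for all $1\leq n\leq N_0$. Then there exist constants $\kappa, C_0, C_1 > 0$ such that, for any initial condition $\Phi\in\mathcal{C}^0([-h_M,0];\mathcal{H})$, any distributed perturbation $p\in L^\infty_{\mathrm{loc}}(\mathbb{R}_+;\mathcal{H})$, and any delay $h\in\mathcal{C}^0(\mathbb{R}_+;\mathbb{R})$ with $h_m\leq h\leq h_M$, the mild solution $X\in\mathcal{C}^0(\mathbb{R}_+;\mathcal{H})$ of the abstract system with $u = KY$ satisfies $$\|X(t)\| \leq C_0 e^{-\kappa t}\sup_{\tau\in[-h_M,0]}\|\Phi(\tau)\| + C_1 \operatorname*{ess\,sup}_{\tau\in[0,t]} e^{-\kappa(t-\tau)}\|p(\tau)\|$$ for all $t\geq 0$, with control input satisfying $$\|u(t)\| \leq C_0\|K\| e^{-\kappa t}\sup_{\tau\in[-h_M,0]}\|\Phi(\tau)\| + C_1\|K\|\operatorname*{ess\,sup}_{\tau\in[0,t]} e^{-\kappa(t-\tau)}\|p(\tau)\|$$ for all $t\geq 0$.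
   Context: Fix $a>0$, $b,c\in\mathbb{R}$ with $c\neq 0$, and $\theta_1,\theta_2\in[0,2\pi)$. Let $\mathcal{H}=L^2(0,1)$ (real-valued) with inner product $\langle f,g\rangle=\int_0^1 f(\xi)g(\xi)\,d\xi$ and norm $\|\cdot\|$. Vectors carry the Euclidean norm and matrices the induced norm, also written $\|\cdot\|$. $\mathrm{AC}_{\mathrm{loc}}(\mathbb{R}_+;\mathbb{R}^n)$ is the set of functions $\mathbb{R}_+\to\mathbb{R}^n$ absolutely continuous on every compact interval of $\mathbb{R}_+$. $L^\infty_{\mathrm{loc}}(\mathbb{R}_+;\mathcal{H})$ is the set of Bochner measurable functions essentially bounded on every compact interval of $\mathbb{R}_+$. The boundary-controlled reaction-diffusion equation is, for $t>0$, $x\in(0,1)$: $y_t(t,x)=a y_{xx}(t,x)+b y(t,x)+c y(t-h(t),x)+d(t,x)$, $\cos(\theta_1)y(t,0)-\sin(\theta_1)y_x(t,0)=u_1(t)$, $\cos(\theta_2)y(t,1)+\sin(\theta_2)y_x(t,1)=u_2(t)$, $y(\tau,x)=\phi(\tau,x)$ for $\tau\in[-h_M,0]$. With $X(t)=y(t,\cdot)$, $p(t)=d(t,\cdot)$, $\Phi(t)=\phi(t,\cdot)$, $u=(u_1,u_2)$ it is written as the abstract system $$\frac{dX}{dt}(t)=\mathcal{A}X(t)+cX(t-h(t))+p(t),\quad \mathcal{B}X(t)=u(t)\quad(t>0),\qquad X(\tau)=\Phi(\tau)\ (\tau\in[-h_M,0]),$$ where $\mathcal{A}f=af''+bf$ and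 $\mathcal{B}f=(\cos(\theta_1)f(0)-\sin(\theta_1)f'(0),\ \cos(\theta_2)f(1)+\sin(\theta_2)f'(1))$, both with domain $H^2(0,1)$. Let $\mathcal{A}_0$ be the restriction of $\mathcal{A}$ to $D(\mathcal{A}_0)=H^2(0,1)\cap\ker\mathcal{B}$; it generates a $C_0$-semigroup $S(t)$ on $\mathcal{H}$. Fix an integer $k\geq 2$ with $\cos(\theta_m)+k\sin(\theta_m)\neq0$ for $m\in\{1,2\}$, and define the lifting operator $L_k:\mathbb{R}^2\to\mathcal{H}$ by $[L_k u](x)=\frac{u_1(1-x)^k}{\cos(\theta_1)+k\sin(\theta_1)}+\frac{u_2x^k}{\cos(\theta_2)+k\sin(\theta_2)}$. Mild solution: for $u\in\mathrm{AC}_{\mathrm{loc}}(\mathbb{R}_+;\mathbb{R}^2)$, $p\in L^\infty_{\mathrm{loc}}(\mathbb{R}_+;\mathcal{H})$, $h$ continuous with $h_m\le h\le h_M$, $\Phi\in\mathcal{C}^0([-h_M,0];\mathcal{H})$, the mild solution $X\in\mathcal{C}^0(\mathbb{R}_+;\mathcal{H})$ is the unique function with $X(\tau)=\Phi(\tau)$ for $\tau\in[-h_M,0]$ and, for all $t\ge0$, $$X(t)=S(t)\{\Phi(0)-L_ku(0)\}+L_ku(t)+\int_0^tS(t-s)\{\mathcal{A}L_ku(s)-L_k\dot u(s)+cX(s-h(s))+p(s)\}\,ds.$$ Let $\mathcal{A}_c=\mathcal{A}+cI$ on $H^2(0,1)$ and $\mathcal{A}_{c,0}=\mathcal{A}_0+cI$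 on $D(\mathcal{A}_0)$. The operator $\mathcal{A}_{c,0}$ is self-adjoint; its eigenvalues $(\lambda_n)_{n\ge1}$ are real and sorted in a strictly decreasing sequence with $\lambda_n\to-\infty$; $e_n$ is a unit eigenvector associated with $\lambda_n$, and $(e_n)_{n\ge1}$ is a Hilbert basis of $\mathcal{H}$. With $\{f_1,f_2\}$ the canonical basis of $\mathbb{R}^2$, put $b_{n,m}=-\lambda_n\langle L_kf_m,e_n\rangle+\langle\mathcal{A}_cL_kf_m,e_n\rangle$ for $n\ge1$, $m\in\{1,2\}$ (this is independent of the choice of $k$). Given $N_0\ge1$, set $A=\mathrm{diag}(\lambda_1,\dots,\lambda_{N_0})$, $B=(b_{n,m})_{1\le n\le N_0,1\le m\le2}$, and $Y(t)=(\langle X(t),e_1\rangle,\dots,\langle X(t),e_{N_0}\rangle)^\top\in\mathbb{R}^{N_0}$. ''The mild solution with $u=KY$'' means the function $X\in\mathcal{C}^0(\mathbb{R}_+;\mathcal{H})$ such that $u=KY\in\mathrm{AC}_{\mathrm{loc}}(\mathbb{R}_+;\mathbb{R}^2)$ and $X$ is the mild solution for this $u$ (closed-loop system). *)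

(* Defs.v *)
From HB Require Import structures.
From mathcomp Require Import all_boot all_order all_algebra.
From mathcomp Require Import complex.
From mathcomp Require Import all_classical all_reals all_analysis.
From mathcomp Require Import measurable_realfun.

Set Implicit Arguments.
Unset Strict Implicit.
Unset Printing Implicit Defensive.

Import Order.TTheory GRing.Theory Num.Theory.
Import numFieldNormedType.Exports.

Local Open Scope classical_set_scope.
Local Open Scope ring_scope.

Section L2_space.
Variable R : realType.

Definition mu01 : {measure set (measurableTypeR R) -> \bar R} :=
  mrestr (@lebesgue_measure R) (measurable_itv `[(0 : R), 1]).

(* L2 below is the real Hilbert space L^2(0,1): the quotient of the library's
   square-integrable functions by almost everywhere equality, normed by the
   L^2 norm. Functions live on the whole line but only their values on [0, 1]
   matter, mu01 being carried by [0, 1]. *)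
Definition Lfun2 := LfunType mu01 (lee1n 2).

Definition null2 : {pred Lfun2} := fun f => `[< {ae mu01, forall x, f x = 0} >].

Lemma null2_zmod_closed : zmod_closed null2.
Proof.
split; first by apply/asboolP/nearW.
move=> f g /asboolP f0 /asboolP g0; apply/asboolP.
apply: filterS2 f0 g0 => x fx gx.
by have -> : (f - g) x = f x - g x by []; rewrite fx gx subr0.
Qed.
HB.instance Definition _ := GRing.isZmodClosed.Build Lfun2 null2 null2_zmod_closed.

Definition L2 : Type := Quotient.quot null2.
HB.instance Definition _ := GRing.Zmodule.on L2.
HB.instance Definition _ := EqQuotient.on L2.

Local Open Scope quotient_scope.

Definition toL2 (f : Lfun2) : L2 := \pi_L2 f.
Definition ofL2 (f : L2) : Lfun2 := repr f.

Lemma toL2_eq (f g : Lfun2) :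
  toL2 f = toL2 g <-> {ae mu01, forall x, f x = g x}.
Proof.
rewrite /toL2; split.
  move=> /eqP; rewrite (@eqquotE _ _ L2) => /asboolP; apply: filterS => x fgx.
  by apply/eqP; rewrite -subr_eq0 -[_ - _]/((f - g) x) fgx.
move=> fg; apply/eqP; rewrite (@eqquotE _ _ L2); apply/asboolP.
by apply: filterS fg => x fgx; rewrite -[LHS]/(f x - g x) fgx subrr.
Qed.

Lemma ofL2K (f : L2) : toL2 (ofL2 f) = f. Proof. exact: reprK. Qed.

Lemma toL2K (f : Lfun2) : {ae mu01, forall x, ofL2 (toL2 f) x = f x}.
Proof. by apply/toL2_eq; rewrite ofL2K. Qed.

Lemma toL2D (f g : Lfun2) : toL2 (f + g) = toL2 f + toL2 g.
Proof. by rewrite /toL2 piE. Qed.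

Definition scaleL2 (r : R) (f : L2) : L2 := toL2 (r *: ofL2 f).

Lemma toL2Z r (f : Lfun2) : toL2 (r *: f) = scaleL2 r (toL2 f).
Proof.
apply/toL2_eq; apply: filterS (toL2K f) => x fx.
by rewrite -[RHS]/(r * ofL2 (toL2 f) x) fx.
Qed.

Let scaleL2A a b v : scaleL2 a (scaleL2 b v) = scaleL2 (a * b) v.
Proof. by rewrite -[v]ofL2K -!toL2Z scalerA. Qed.
Let scaleL20 v : scaleL2 1 v = v.
Proof. by rewrite -[v]ofL2K -!toL2Z scale1r. Qed.
Let scaleL2Dr : right_distributive scaleL2 +%R.
Proof. by move=> a u v; rewrite -[u]ofL2K -[v]ofL2K -toL2D -!toL2Z -toL2D scalerDr. Qed.
Let scaleL2Dl v : {morph scaleL2^~ v : a b / a + b}.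
Proof. by move=> a b; rewrite -[v]ofL2K -!toL2Z -toL2D scalerDl. Qed.

HB.instance Definition _ := GRing.Zmodule_isLmodule.Build R L2
  scaleL2A scaleL20 scaleL2Dr scaleL2Dl.

Definition normL2 (f : L2) : R := fine ('N[mu01]_2%:E [EFin \o ofL2 f])%E.

Lemma normL2E (f : Lfun2) :
  normL2 (toL2 f) = fine ('N[mu01]_2%:E [EFin \o f])%E.
Proof.
rewrite /normL2 unlock; congr (fine (_ `^ _)).
apply: ae_eq_integral => //.
- apply: (measurableT_comp (measurable_poweR 2)) => //.
  by apply: measurableT_comp => //; exact/measurable_EFinP.
- apply: (measurableT_comp (measurable_poweR 2)) => //.
  by apply: measurableT_comp => //; exact/measurable_EFinP.
- by apply: filterS (toL2K f) => x /= ->.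
Qed.

Let normL2D u v : normL2 (u + v) <= normL2 u + normL2 v.
Proof. by rewrite -[u]ofL2K -[v]ofL2K -toL2D !normL2E; exact: ler_LnormD. Qed.

Let normL2Z r v : normL2 (r *: v) = `|r| * normL2 v.
Proof.
rewrite -[v]ofL2K -[_ *: _]/(scaleL2 _ _) -toL2Z !normL2E.
apply/EFin_inj; rewrite EFinM !finite_norm_fine.
exact: LnormZ.
Qed.

Let normL2_eq0 v : normL2 v = 0 -> v = 0.
Proof.
rewrite -{2}[v]ofL2K /normL2 => /fine_Lnormr_eq0 v0.
have -> : 0 = toL2 0 by rewrite /toL2 piE.
by apply/toL2_eq; apply: filterS v0 => x /(_ I).
Qed.

HB.instance Definition _ := Lmodule_isNormed.Build R L2 normL2D normL2Z normL2_eq0.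

End L2_space.

Section functional_analysis.
Variable R : realType.

Definition inner (f g : L2 R) : R := \int[@mu01 R]_x (ofL2 f x * ofL2 g x).

Definition hilbert_basis (e : nat -> L2 R) :=
  (forall m n, inner (e m) (e n) = (m == n)%:R) /\
  closure [set g | exists n (x : 'I_n -> R), g = \sum_(i < n) x i *: e i] = setT.

(* Absolute continuity on [a, b], in epsilon-delta form over finite families of
   non-overlapping subintervals. *)
Definition abs_cont_on (V : normedModType R) (a b : R) (F : R -> V) :=
  forall eps : R, 0 < eps -> exists2 delta : R, 0 < delta &
    forall (n : nat) (s t : 'I_n -> R),
      (forall i, a <= s i /\ s i <= t i /\ t i <= b) ->
      (forall i j, i != j -> t i <= s j \/ t j <= s i) ->
      \sum_(i < n) (t i - s i) < delta ->
      \sum_(i < n) `|F (t i) - F (s i)| < eps.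

Definition ACloc (V : normedModType R) (F : R -> V) :=
  forall a b, 0 <= a -> a <= b -> abs_cont_on a b F.

Definition simple_map (V : normedModType R) (s : R -> V) :=
  finite_set (range s) /\ forall v, measurable (s @^-1` [set v]).

(* Only used when D has finite measure, so that fine loses nothing. *)
Definition simple_integral (V : normedModType R) (D : set R) (s : R -> V) : V :=
  \sum_(v \in range s)
    fine (lebesgue_measure (D `&` s @^-1` [set v])) *: v.

Definition bochner_measurable (V : normedModType R) (D : set R) (f : R -> V) :=
  exists2 s : nat -> R -> V, forall n, simple_map (s n) &
    {ae (@lebesgue_measure R), forall t, D t -> s n t @[n --> \oo] --> f t}.

(* f is Bochner integrable on D with integral v. *)
Definition bochner_integral (V : normedModType R) (D : set R) (f : R -> V)
    (v : V) :=
  exists s : nat -> R -> V,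
    [/\ forall n, simple_map (s n),
        {ae (@lebesgue_measure R), forall t, D t -> s n t @[n --> \oo] --> f t},
        (\int[lebesgue_measure]_(t in D) (`|f t - s n t|)%:E)%E
          @[n --> \oo] --> 0%E &
        simple_integral D (s n) @[n --> \oo] --> v].

Definition Linfty_loc (V : normedModType R) (p : R -> V) :=
  bochner_measurable `[0, +oo[ p /\
  forall t, 0 <= t -> exists M : R,
    {ae (@lebesgue_measure R), forall tau, tau \in `[0, t] -> `|p tau| <= M}.

(* Essential supremum of |g| over [0, t]. The L^oo seminorm is 0 on a null set,
   so that the value at t = 0 is 0, whereas ess_sup would be -oo there. *)
Definition ess_sup_on (t : R) (g : R -> R) : \bar R :=
  ('N[mrestr (@lebesgue_measure R) (measurable_itv `[0%R, t])]_+oo [EFin \o g])%E.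

Definition C0_semigroup (V : normedModType R) (S : R -> V -> V) :=
  [/\ forall t, 0 <= t -> forall (r : R) f g,
        S t (r *: f + g) = r *: S t f + S t g,
      forall t, 0 <= t -> continuous (S t),
      forall f, S 0 f = f,
      forall s t, 0 <= s -> 0 <= t -> forall f, S (s + t) f = S s (S t f) &
      forall f, S t f @[t --> 0^'+] --> f].

(* Equality of A, with domain dom, and of the infinitesimal generator of S: for
   f outside dom the difference quotient has no limit. *)
Definition generates (V : normedModType R) (S : R -> V -> V)
    (dom : set V) (A : V -> V) :=
  forall f g, (dom f /\ g = A f) <-> t^-1 *: (S t f - f) @[t --> 0^'+] --> g.

Definition enorm (n : nat) (x : 'cV[R]_n) : R := Num.sqrt (\sum_i x i 0 ^+ 2).

Definition mxnorm2 (m n : nat) (M : 'M[R]_(m, n)) : R :=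
  sup [set enorm (M *m x) | x in [set x : 'cV[R]_n | enorm x <= 1]].

Definition mxC (n : nat) (M : 'M[R]_n) : 'M[R[i]]_n := map_mx (real_complex R) M.

Definition hurwitz (n : nat) (M : 'M[R]_n) :=
  forall z : R[i], eigenvalue (mxC M) z -> complex.Re z < 0.

(* The n eigenvalues counted with algebraic multiplicity are the mu i, and each
   of them is simple. *)
Definition simple_eigenvalues (n : nat) (M : 'M[R]_n) (mu : 'I_n -> R[i]) :=
  injective mu /\ char_poly (mxC M) = \prod_i ('X - (mu i)%:P).

End functional_analysis.

Section reaction_diffusion.
Variable R : realType.
Implicit Types (a b c : R) (th : R) (k : nat) (f g w : L2 R).

(* f is in H^2(0,1): v is its C^1 representative on [0, 1], v1 = v' is absolutely
   continuous up to the boundary (so that v1 0 and v1 1 are the traces of f') and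
   w = v'' is in L^2(0,1). All three are determined by f on [0, 1]. *)
Definition H2_rep f (v v1 : R -> R) w :=
  [/\ {ae (@mu01 R), forall x, ofL2 f x = v x},
      abs_cont_on 0 1 v, abs_cont_on 0 1 v1,
      forall x : R, x \in `]0, 1[ -> is_derive x 1 v (v1 x) &
      {ae (@mu01 R), forall x : R, is_derive x 1 v1 (ofL2 w x)}].

Definition H2 : set (L2 R) := [set f | exists v v1 w, H2_rep f v v1 w].

(* A f = a f'' + b f and B f on H^2(0,1), as total functions: the sets are
   singletons for f in H^2(0,1); the value elsewhere is irrelevant. *)
Definition opA a b f : L2 R :=
  xget 0 [set g | exists v v1 w, H2_rep f v v1 w /\ g = a *: w + b *: f].

Definition opB (th1 th2 : R) f : 'cV[R]_2 :=
  xget 0 [set y | exists v v1 w, H2_rep f v v1 w /\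
    y = \col_(m < 2)
      if m == 0 then cos th1 * v 0 - sin th1 * v1 0
                else cos th2 * v 1 + sin th2 * v1 1].

Definition domA0 (th1 th2 : R) : set (L2 R) :=
  [set f | H2 f /\ opB th1 th2 f = 0].

Definition opAc a b c f : L2 R := opA a b f + c *: f.

(* lam n and e n are the (n+1)-st eigenvalue and unit eigenvector of A_{c,0},
   numbered from 0. *)
Definition spectral_data a b c (th1 th2 : R) (lam : nat -> R)
    (e : nat -> L2 R) :=
  [/\ forall m n, (m < n)%N -> lam n < lam m,
      lam n @[n --> \oo] --> -oo,
      forall l : R, (exists2 f, f != 0 & domA0 th1 th2 f /\ opAc a b c f = l *: f)
        <-> exists n, l = lam n,
      forall n, [/\ `|e n| = 1, domA0 th1 th2 (e n) &
        opAc a b c (e n) = lam n *: e n] &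
      hilbert_basis e].

Definition lift_fun (th1 th2 : R) k (u : 'cV[R]_2) (x : R) : R :=
  u 0 0 * (1 - x) ^+ k / (cos th1 + k%:R * sin th1) +
  u 1 0 * x ^+ k / (cos th2 + k%:R * sin th2).

Lemma lift_fun_Lfun th1 th2 k u : lift_fun th1 th2 k u \in Lfun (@mu01 R) 2%:E.
Proof.
have cf : continuous (lift_fun th1 th2 k u).
  have cX (g : R -> R) : continuous g -> continuous (fun x => g x ^+ k).
    move=> cg x; exact: (continuous_comp (cg x) (@exprn_continuous _ k _)).
  have cM (al be : R) (g : R -> R) :
      continuous g -> continuous (fun x => al * g x / be).
    move=> cg x; apply: cvgM; last exact: cvg_cst.
    by apply: cvgM; [exact: cvg_cst|exact: cg].
  have c1 : continuous (fun x : R => (1 - x) ^+ k).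
    by apply: cX => y; apply: cvgB; [exact: cvg_cst|exact: cvg_id].
  move=> x; apply: cvgD; first exact: (cM _ _ _ c1).
  by apply: (cM _ _ (fun x => x ^+ k)); exact: exprn_continuous.
have mf : measurable_fun setT (lift_fun th1 th2 k u).
  exact: continuous_measurable_fun.
have [M [Mreal fM]] : bounded_set (lift_fun th1 th2 k u @` `[0, 1]).
  apply/compact_bounded/continuous_compact; last exact: segment_compact.
  exact: continuous_subspaceT.
have fM1 x : x \in `[0, 1] -> `|lift_fun th1 th2 k u x| <= M + 1.
  by move=> x01; apply: fM; [rewrite ltrDl|exists x].
rewrite inE; apply/andP; split; rewrite inE//=.
have aef : {ae @mu01 R, forall x, `|lift_fun th1 th2 k u x| <= M + 1}.
  exists (~` `[0, 1]); split.
  - by apply: measurableC; exact: measurable_itv.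
  - by rewrite /= /mrestr setICl measure0.
  - by move=> x /= nfx x01; apply: nfx; exact: fM1.
rewrite /finite_norm unlock; apply: poweR_lty.
apply: (@le_lt_trans _ _ (\int[@mu01 R]_x (cst ((M + 1) `^ 2)%:E x))%E).
  apply: ae_ge0_le_integral => //.
  - by move=> x _; exact: poweR_ge0.
  - apply: (measurableT_comp (measurable_poweR 2)) => //.
    by apply: measurableT_comp => //; exact/measurable_EFinP.
  - by move=> x _; rewrite lee_fin powR_ge0.
  - case: aef => [N [mN N0 sN]]; exists N; split=> // x nx; apply: sN => fx.
    apply: nx => _ /=; rewrite lee_fin; apply: ge0_ler_powR => //; rewrite nnegrE//.
    exact: le_trans fx.
rewrite integral_cst//= /mrestr setTI.
by rewrite lebesgue_measure_itv/= lte01 -EFinB -EFinM ltry.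
Qed.

Definition lifting (th1 th2 : R) k (u : 'cV[R]_2) : L2 R :=
  toL2 (Lfun_Sub (lee1n 2) (lift_fun_Lfun th1 th2 k u)).

(* The derivative, defined almost everywhere, of an absolutely continuous u. *)
Definition deriv_cV (n : nat) (u : R -> 'cV[R]_n) (t : R) : 'cV[R]_n :=
  \col_i derive1 (fun s : R => u s i 0) t.

Definition mild_solution a b c (th1 th2 : R) k (S : R -> L2 R -> L2 R) (hM : R)
    (h : R -> R) (Phi p : R -> L2 R) (u : R -> 'cV[R]_2) (X : R -> L2 R) :=
  let L := lifting th1 th2 k in
  [/\ forall tau, tau \in `[- hM, 0] -> X tau = Phi tau,
      {within `[0, +oo[, continuous X} &
      forall t, 0 <= t -> exists2 v,
        bochner_integral `[0, t] (fun s => S (t - s)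
          (opA a b (L (u s)) - L (deriv_cV u s) + c *: X (s - h s) + p s)) v &
        X t = S t (Phi 0 - L (u 0)) + L (u t) + v].

Definition matA (lam : nat -> R) (N0 : nat) : 'M[R]_N0 :=
  diag_mx (\row_(n < N0) lam n).

Definition matB a b c (th1 th2 : R) k (lam : nat -> R) (e : nat -> L2 R)
    (N0 : nat) : 'M[R]_(N0, 2) :=
  \matrix_(n < N0, m < 2)
    let Lf := lifting th1 th2 k (delta_mx m 0) in
    - lam n * inner Lf (e n) + inner (opAc a b c Lf) (e n).

Definition modes (e : nat -> L2 R) (N0 : nat) (X : R -> L2 R) (t : R)
    : 'cV[R]_N0 := \col_(n < N0) inner (X t) (e n).

Definition closed_loop_mild_solution a b c (th1 th2 : R) k
    (S : R -> L2 R -> L2 R) (e : nat -> L2 R) (N0 : nat) (K : 'M[R]_(2, N0))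
    (hM : R) (h : R -> R) (Phi p : R -> L2 R) (X : R -> L2 R) :=
  let u := fun t => K *m modes e N0 X t in
  ACloc u /\ mild_solution a b c th1 th2 k S hM h Phi p u X.

End reaction_diffusion.

(* Main.v *)
From HB Require Import structures.
Require Import Defs.
From mathcomp Require Import all_boot all_order all_algebra.
From mathcomp Require Import complex.
From mathcomp Require Import all_classical all_reals all_analysis.
From mathcomp Require Import measurable_realfun ess_sup_inf.
From mathcomp Require Import ring lra.

Set Implicit Arguments.
Unset Strict Implicit.
Unset Printing Implicit Defensive.

Import Order.TTheory GRing.Theory Num.Theory.
Import numFieldNormedType.Exports.

Local Open Scope classical_set_scope.
Local Open Scope ring_scope.

(** Let z_n = <X, e_n>, and let nu_n = lam n - c be the eigenvalues of A_0.
    Tested against e_n, the mild solution solves the scalar delay equation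
      z_n' (s) = nu_n z_n (s) + b_n u (s) + c z_n (s - h (s)) + <p (s), e_n>
    in the weak sense (mode_weak). The proof sees the delayed term and the
    disturbance as inputs of a stable undelayed system, and compares their size
    in the norm weighted by exp (kappa s) with the decay rate of that system.

    Under u = K Y the first N0 equations form a closed system with the matrix
    Acl - c I. Its eigenvalues are simple, so that their left eigenvectors give
    coordinates in which the system decouples (real_eigen_coordinates), and
    their real parts are at most - 3 |c| - c <= - 2 |c|. Variation of constants (modal_duhamel) then gives for each
    coordinate an inequality in which the delayed term has the gain
    |c| exp (kappa hM) / (2 |c| - kappa). For small kappa this is less than 1, and
    a small-gain argument closes the estimate (small_gain, delay_gain). It does
    not matter how fast the delay varies.

    This bounds Y, hence u, which is now a given input of the other modes. Their
    rates nu_n are at most - 2 |c| as well, so the same argument applies to the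
    norm of the tail of X (tail_duhamel, tail_decay), provided that the control
    term is square summable after it has passed through the dynamics. That holds
    because b_n = - lam_n <L f, e_n> + <A_c L f, e_n>, while the n-th mode divides
    it by its decay rate, which is comparable to |lam_n| (input_coef_damped).

    The weak formulation rests on three facts. The e_n are eigenvectors of
    the semigroup, S t e_n = exp (nu_n t) e_n (C0_semigroup_eigenvector), and
    <S t f, e_n> = exp (nu_n t) <f, e_n> by density of their span
    (inner_semigroup). A Bochner integral commutes with <., e_n>
    (bochner_has_int). And the term L u' of the mild solution can be integrated
    by parts (has_int_mul_C1) because an absolutely continuous function is the
    integral of its derivative (abs_cont_ftc). *)

(** * Integrals known up to a null set *)

#[global] Instance ae_lebesgue_filter (R : realType) :
  Filter (almost_everywhere (@lebesgue_measure R)).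
Proof. exact: ae_filter_ringOfSetsType. Qed.

Section has_int.
Variable R : realType.
Local Notation mu := (@lebesgue_measure R).
Implicit Types (D : set (measurableTypeR R)) (f g : R -> R) (v w : R).

(** The integrands below (derivatives that exist almost everywhere, inner
    products with Bochner measurable maps) are only known to coincide almost
    everywhere with an integrable function. Carrying that function in the
    definition makes the integral additive and insensitive to null sets without
    any measurability condition on g. *)
Definition has_int D g v := exists2 f : R -> R, mu.-integrable D (EFin \o f) &
  {ae mu, forall x, D x -> g x = f x} /\ \int[mu]_(x in D) f x = v.

Lemma integrable_has_int D f : mu.-integrable D (EFin \o f) ->
  has_int D f (\int[mu]_(x in D) f x).
Proof. by move=> fi; exists f => //; split => //; apply: nearW. Qed.

Lemma ae_eq_has_int D g h v : {ae mu, forall x, D x -> h x = g x} ->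
  has_int D g v -> has_int D h v.
Proof.
move=> hg [f fi [gf fv]]; exists f => //; split => //.
by apply: filterS2 hg gf => x hgx gfx Dx; rewrite hgx// gfx.
Qed.

Lemma eq_has_int D g h v : (forall x, D x -> h x = g x) ->
  has_int D g v -> has_int D h v.
Proof. by move=> hg; apply: ae_eq_has_int; apply: nearW. Qed.

Lemma has_intD D g1 g2 v1 v2 : measurable D -> has_int D g1 v1 ->
  has_int D g2 v2 -> has_int D (fun x => g1 x + g2 x) (v1 + v2).
Proof.
move=> mD [f1 f1i [gf1 fv1]] [f2 f2i [gf2 fv2]].
exists (fun x => f1 x + f2 x); first exact: (integrableD mD f1i f2i).
split; last by rewrite RintegralD// fv1 fv2.
by apply: filterS2 gf1 gf2 => x h1 h2 Dx; rewrite h1// h2.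
Qed.

Lemma has_intZ D r g v : measurable D -> has_int D g v ->
  has_int D (fun x => r * g x) (r * v).
Proof.
move=> mD [f fi [gf fv]].
exists (fun x => r * f x); first exact: (integrableZl mD r fi).
split; last by rewrite RintegralZl// fv.
by apply: filterS gf => x h Dx; rewrite h.
Qed.

Lemma has_intB D g1 g2 v1 v2 : measurable D -> has_int D g1 v1 ->
  has_int D g2 v2 -> has_int D (fun x => g1 x - g2 x) (v1 - v2).
Proof.
move=> mD h1 h2; have := has_intD mD h1 (has_intZ (-1) mD h2).
by rewrite mulN1r; apply: eq_has_int => x _; rewrite mulN1r.
Qed.

Lemma has_int0 D : has_int D (fun=> 0) 0.
Proof.
exists (fun=> 0); first exact: integrable0.
by split; [exact: nearW|rewrite /Rintegral integral0].
Qed.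

Lemma has_int_sum D (I : Type) (s : seq I) (g : I -> R -> R) (v : I -> R) :
  measurable D -> (forall i, has_int D (g i) (v i)) ->
  has_int D (fun x => \sum_(i <- s) g i x) (\sum_(i <- s) v i).
Proof.
move=> mD gv; elim: s => [|i s ih].
  by rewrite big_nil; apply: eq_has_int (has_int0 D) => x _; rewrite big_nil.
rewrite big_cons; apply: eq_has_int (has_intD mD (gv i) ih) => x _.
by rewrite big_cons.
Qed.

Lemma le_has_int D g1 g2 v1 v2 : measurable D ->
  {ae mu, forall x, D x -> g1 x <= g2 x} ->
  has_int D g1 v1 -> has_int D g2 v2 -> v1 <= v2.
Proof.
move=> mD g12 h1 h2.
have [f fi [gf fv]] := has_intB mD h2 h1.
rewrite -subr_ge0 -fv /Rintegral.
have mf : measurable_fun D (EFin \o f) by exact: measurable_int fi.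
have fE : ae_eq mu D (EFin \o f) (fun x => `|f x|%:E).
  apply: filterS2 g12 gf => x h3 h4 Dx /=.
  by rewrite -h4// ger0_norm// subr_ge0 h3.
have mfa : measurable_fun D (fun x => `|f x|%:E).
  by apply/measurable_EFinP/measurableT_comp => //; exact/measurable_EFinP.
rewrite (ae_eq_integral _ _ mD mf mfa fE).
by apply: fine_ge0; apply: integral_ge0 => x _; rewrite lee_fin.
Qed.

Lemma has_int_uniq D g v1 v2 : measurable D ->
  has_int D g v1 -> has_int D g v2 -> v1 = v2.
Proof.
move=> mD h1 h2; apply/eqP; rewrite eq_le.
by rewrite (le_has_int mD _ h1 h2) ?(le_has_int mD _ h2 h1)//; apply: nearW.
Qed.

Lemma continuous_has_int (a b : R) g : {within `[a, b], continuous g} ->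
  has_int `[a, b] g (\int[mu]_(x in `[a, b]) g x).
Proof.
move=> cg; apply: integrable_has_int.
by apply: continuous_compact_integrable => //; exact: segment_compact.
Qed.

End has_int.

(** * Absolutely continuous functions are integrals of their derivative *)

Section absolutely_continuous.
Variable R : realType.
Implicit Types (F G : R -> R) (a b : R).

Lemma abs_cont_finType a b F : abs_cont_on a b F -> forall eps : R, 0 < eps ->
  exists2 delta : R, 0 < delta &
    forall (I : finType) (s t : I -> R),
      (forall i, a <= s i /\ s i <= t i /\ t i <= b) ->
      (forall i j, i != j -> t i <= s j \/ t j <= s i) ->
      \sum_i (t i - s i) < delta -> \sum_i `|F (t i) - F (s i)| < eps.
Proof.
move=> acF eps /acF[d d0 dF]; exists d => // I s t st dis sumd.
rewrite (reindex _ (onW_bij _ (@enum_val_bij I))) /=.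
apply: (dF _ (s \o enum_val) (t \o enum_val)) => [i|i j ij|] /=.
- exact: st.
- by apply: dis; rewrite (inj_eq enum_val_inj).
- by rewrite (reindex _ (onW_bij _ (@enum_val_bij I))) /= in sumd.
Qed.

Lemma itv_partition_nth_mono a b p : itv_partition a b p ->
  forall k l, (k <= l)%N -> (l <= size p)%N ->
  nth b (a :: p) k <= nth b (a :: p) l.
Proof.
move=> [ap _] k l kl lp.
have srt : sorted <=%R (a :: p) by apply: sub_path ap => x y /ltW.
by apply: (sorted_leq_nth le_trans lexx) => //=; rewrite inE /= ?ltnS// (leq_trans kl).
Qed.

Lemma itv_partition_telescope a b p : itv_partition a b p ->
  \sum_(k < size p) (nth b (a :: p) k.+1 - nth b (a :: p) k) = b - a.
Proof.
move=> abp; rewrite -(big_mkord xpredT (fun k => nth b (a :: p) k.+1 - nth b (a :: p) k)).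
rewrite telescope_sumr// /= [nth b (a :: p) (size p)](_ : _ = b)//.
by rewrite nth_last /=; case: abp => _ /eqP.
Qed.

(** Partitions of all intervals of a non-overlapping family form one
    larger such family of the same total length, indexed by a dependent sum. *)
Lemma variation_family a b F : abs_cont_on a b F -> forall eps : R, 0 < eps ->
  exists2 delta : R, 0 < delta &
    forall (I : finType) (s t : I -> R) (p : I -> seq R),
      (forall i, a <= s i /\ s i <= t i /\ t i <= b) ->
      (forall i j, i != j -> t i <= s j \/ t j <= s i) ->
      (forall i, itv_partition (s i) (t i) (p i)) ->
      \sum_i (t i - s i) < delta ->
      \sum_i variation (s i) (t i) F (p i) < eps.
Proof.
move=> /abs_cont_finType acF eps /acF[d d0 dF]; exists d => // I s t p st dis stp sumd.
pose J := {i : I & 'I_(size (p i))}.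
pose x (u : J) k := nth (t (tag u)) (s (tag u) :: p (tag u)) k.
have sumJ (f : forall i, 'I_(size (p i)) -> R) :
    \sum_(u : J) f (tag u) (tagged u) = \sum_i \sum_k f i k.
  by rewrite sig_big_dep; apply: eq_bigl.
have -> : \sum_i variation (s i) (t i) F (p i) =
    \sum_(u : J) `|F (x u (tagged u).+1) - F (x u (tagged u))|.
  rewrite (sumJ (fun i k => `|F (nth (t i) (s i :: p i) k.+1) -
     F (nth (t i) (s i :: p i) k)|)).
  by apply: eq_bigr => i _; rewrite /variation big_mkord.
have xlo (u : J) k : (k <= size (p (tag u)))%N -> s (tag u) <= x u k.
  by move=> ku; exact: itv_partition_nth_ge (stp _).
have xhi (u : J) k : (k <= size (p (tag u)))%N -> x u k <= t (tag u).
  by move=> ku; exact: itv_partition_nth_le (stp _).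
apply: (dF J (fun u => x u (tagged u)) (fun u => x u (tagged u).+1)).
- move=> u; have [as_ [_ tb]] := st (tag u); split.
    by apply: le_trans as_ _; apply: xlo; exact: ltnW.
  split; first exact: (itv_partition_nth_mono (stp _)).
  by apply: le_trans tb; exact: xhi.
- move=> [i k] [j l]; rewrite /x/=.
  have [ij|ij] := eqVneq i j.
    subst j; rewrite eq_Tagged /= => kl.
    have [kl'|lk|kl'] := ltngtP k l.
    + by left; exact: (itv_partition_nth_mono (stp i) kl' (ltnW (ltn_ord l))).
    + by right; exact: (itv_partition_nth_mono (stp i) lk (ltnW (ltn_ord k))).
    + by move: kl; rewrite (ord_inj kl') eqxx.
  move=> _; have [h|h] := dis _ _ ij; [left|right].
  + have kt : (k.+1 < (size (p i)).+1)%N := ltn_ord k.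
    have ls : (l < (size (p j)).+1)%N := ltnW (ltn_ord l).
    have := le_trans (itv_partition_nth_le kt (stp i)) h.
    by move=> /le_trans; apply; exact: itv_partition_nth_ge ls (stp j).
  + have lt : (l.+1 < (size (p j)).+1)%N := ltn_ord l.
    have ks : (k < (size (p i)).+1)%N := ltnW (ltn_ord k).
    have := le_trans (itv_partition_nth_le lt (stp j)) h.
    by move=> /le_trans; apply; exact: itv_partition_nth_ge ks (stp i).
- rewrite (sumJ (fun i k => nth (t i) (s i :: p i) k.+1 - nth (t i) (s i :: p i) k)).
  rewrite (eq_bigr (fun i => t i - s i))// => i _.
  exact: itv_partition_telescope.
Qed.

Local Notation TV := total_variation.

Lemma abs_cont_bounded_variation a b F : a <= b -> abs_cont_on a b F ->
  bounded_variation a b F.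
Proof.
move=> ab acF; have [d d0 dF] := variation_family acF ltr01.
have small u v : a <= u -> u <= v -> v <= b -> v - u < d -> TV u v F \is a fin_num.
  move=> au uv vb uvd; apply/bounded_variationP => //.
  exists 1 => _ [p uvp <-]; apply/ltW.
  have := dF unit (fun=> u) (fun=> v) (fun=> p).
  rewrite big_const card_unit /= addr0 big_const card_unit /= addr0; apply=> //.
have step (n : nat) x : a <= x -> x <= b -> x <= a + n%:R * (d / 2) ->
    TV a x F \is a fin_num.
  elim: n x => [|n ih] x ax xb xn.
    have -> : x = a by apply/eqP; rewrite eq_le ax andbT; move: xn; rewrite mul0r addr0.
    by rewrite total_variationxx.
  have [/ih|/ltW nx] := leP x (a + n%:R * (d / 2)); first exact.
  have an : a <= a + n%:R * (d / 2) by rewrite lerDl mulr_ge0// ltW// divr_gt0.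
  rewrite (total_variationD F an nx) fin_numD ih//=; last exact: le_trans nx xb.
  by apply: small => //; rewrite -natr1 in xn; lra.
apply/(bounded_variationP F ab); apply: (step (Num.bound ((b - a) / (d / 2)))) => //.
have : 0 <= (b - a) / (d / 2) by rewrite divr_ge0 ?subr_ge0// ltW// divr_gt0.
by move/archi_boundP; rewrite ltr_pdivrMr ?divr_gt0// -lerBlDl => /ltW.
Qed.

(** The near-optimal partitions of the intervals of a short family form a short
    family, so that the variation inherits absolute continuity. *)
Lemma abs_cont_total_variation a b F : a <= b -> abs_cont_on a b F ->
  abs_cont_on a b (fun x => fine (TV a x F)).
Proof.
move=> ab acF; have BVF := abs_cont_bounded_variation ab acF.
have fin u v : a <= u -> u <= v -> v <= b -> TV u v F \is a fin_num.
  move=> au uv vb; apply/bounded_variationP => //.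
  by apply: (bounded_variationl uv vb); apply: (bounded_variationr au _ BVF); exact: le_trans uv vb.
move=> eps eps0; have e20 : 0 < eps / 2 by rewrite divr_gt0.
have [d d0 dF] := variation_family acF e20; exists d => // n s t st dis sumd.
pose e := eps / 2 / n.+1%:R; have e0 : 0 < e by rewrite divr_gt0.
have /choice[p pP] (i : 'I_n) : exists p, itv_partition (s i) (t i) p /\
    fine (TV (s i) (t i) F) < variation (s i) (t i) F p + e.
  have [as_ [st_ tb]] := st i.
  have := fin _ _ as_ st_ tb => /(ub_ereal_sup_adherent e0)[_ [_ [p stp <-] <-]] h.
  exists p; split => //; rewrite -ltrBlDr -lte_fin EFinB fineK//; exact: fin.
have -> : \sum_(i < n) `|fine (TV a (t i) F) - fine (TV a (s i) F)| =
    \sum_(i < n) fine (TV (s i) (t i) F).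
  apply: eq_bigr => i _; have [as_ [st_ tb]] := st i.
  rewrite (total_variationD F as_ st_) fineD ?fin//; last exact: le_trans tb.
  by rewrite addrAC subrr add0r ger0_norm// fine_ge0// total_variation_ge0.
apply: (@le_lt_trans _ _ (\sum_(i < n) variation (s i) (t i) F (p i) + \sum_(i < n) e)).
  by rewrite -big_split; apply: ler_sum => i _; apply/ltW; have [] := pP i.
have h1 : \sum_(i < n) variation (s i) (t i) F (p i) < eps / 2.
  by apply: dF => // i; have [] := pP i.
have h2 : \sum_(i < n) e <= eps / 2.
  rewrite sumr_const card_ord -[leLHS]mulr_natr /e mulrAC -mulrA ger_pMr//.
  by rewrite ler_pdivrMr// mul1r ler_nat.
by rewrite [ltRHS]splitr; exact: ltr_leD.
Qed.

End absolutely_continuous.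

Section density.
Variable R : realType.
Implicit Types (F G : R -> R) (a b : R).
Local Notation lambda := (@lebesgue_measure R).

Lemma abs_cont_dist a b F : abs_cont_on a b F -> forall eps : R, 0 < eps ->
  exists2 delta : R, 0 < delta & forall x y, a <= x <= b -> a <= y <= b ->
    `|x - y| < delta -> `|F x - F y| < eps.
Proof.
move=> acF eps eps0.
have [d d0 dF] := abs_cont_finType acF eps0.
exists d => // x y.
wlog yx : x y / y <= x => [h xab yab xyd|/andP[ax xb] /andP[ay yb] xyd].
  have [yx|/ltW xy] := leP y x; first exact: h.
  by rewrite distrC; apply: h => //; rewrite distrC.
have := dF unit (fun=> y) (fun=> x).
rewrite big_const card_unit /= addr0 big_const card_unit /= addr0; apply=> //.
by rewrite -[ltLHS]ger0_norm// subr_ge0.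
Qed.

Definition clamp a b (x : R) := Num.max a (Num.min x b).

Lemma clamp_id a b x : a <= x <= b -> clamp a b x = x.
Proof. by move=> /andP[ax xb]; rewrite /clamp min_l// max_r. Qed.

Lemma clamp_itv a b x : a <= b -> a <= clamp a b x <= b.
Proof. by move=> ab; rewrite /clamp le_max lexx/= ge_max ab ge_min lexx orbT. Qed.

Lemma clamp_mono a b x y : x <= y -> clamp a b x <= clamp a b y.
Proof.
move=> xy; rewrite /clamp ge_max !le_max lexx/=; apply/orP; right.
by rewrite le_min !ge_min xy lexx orbT.
Qed.

Lemma clamp_dist a b x y : `|clamp a b x - clamp a b y| <= `|x - y|.
Proof.
wlog yx : x y / y <= x => [h|].
  have [yx|/ltW xy] := leP y x; first exact: h.
  by rewrite distrC [leRHS]distrC; exact: h.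
rewrite !ger0_norm ?subr_ge0 ?clamp_mono// /clamp /Num.max /Num.min.
by do ![case: ifPn; rewrite -?leNgt]; lra.
Qed.

(** The union of the dyadic cells of level n that an open set U contains is a
    non-overlapping family, so absolute continuity bounds its mass; these unions
    exhaust U, so it bounds the mass of U. *)
Lemma stieltjes_open_le a b G (m : {measure set (measurableTypeR R) -> \bar R}) :
  a < b -> (forall x y, a <= x -> x <= y -> y <= b -> m `]x, y]%classic = (G y - G x)%:E) ->
  abs_cont_on a b G -> forall eps : R, 0 < eps ->
  exists2 delta : R, 0 < delta & forall U : set R, open U ->
    (lambda U < delta%:E)%E -> (m (U `&` `]a, b]) <= eps%:E)%E.
Proof.
move=> ab mG acG eps eps0; have [d d0 dG] := acG _ eps0.
exists d => // U oU Ud.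
have ba0 : 0 < b - a by rewrite subr_gt0.
pose pt n (j : nat) := a + (b - a) * (j%:R / 2 ^+ n).
have p2 n : 0 < 2 ^+ n :> R by rewrite exprn_gt0.
have pt_mono n i j : (i <= j)%N -> pt n i <= pt n j.
  by move=> ij; rewrite lerD2l ler_pM2l// ler_pM2r ?invr_gt0// ler_nat.
have pt0 n : pt n 0%N = a by rewrite /pt mul0r mulr0 addr0.
have ptb n : pt n (2 ^ n)%N = b.
  by rewrite /pt natrX divff ?mulr1 ?gt_eqF//; lra.
pose cell n j : set R := `]pt n j, pt n j.+1]%classic.
pose s n (j : 'I_(2 ^ n)) := pt n j.
pose t n (j : 'I_(2 ^ n)) := if `[< cell n j `<=` U >] then pt n j.+1 else pt n j.
have st n (j : 'I_(2 ^ n)) : a <= s n j /\ s n j <= t n j /\ t n j <= b.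
  split; first by rewrite -(pt0 n); exact: pt_mono.
  rewrite /s /t; case: asboolP => _; rewrite ?lexx; split => //.
  - exact: pt_mono.
  - by rewrite -(ptb n); apply: pt_mono.
  - by rewrite -(ptb n); apply/pt_mono/ltnW.
have dis n (i j : 'I_(2 ^ n)) : (i < j)%N -> t n i <= s n j.
  by move=> ij; rewrite /s /t; case: asboolP => _; apply: pt_mono => //; exact: ltnW.
pose C n (j : 'I_(2 ^ n)) : set R := `]s n j, t n j]%classic.
have CU n j : C n j `<=` U.
  rewrite /C /s /t; case: asboolP => [h|_]; first exact: h.
  move=> x /=.
  by rewrite in_itv/= => /andP[h1 h2]; have := lt_le_trans h1 h2; rewrite ltxx.
pose W n : set (measurableTypeR R) := \big[setU/set0]_(j < 2 ^ n) C n j.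
have mW n : measurable (W n) by apply: bigsetU_measurable => j _; exact: measurable_itv.
have trC n : trivIset setT (C n).
  apply/trivIsetP => i j _ _ ij; apply/seteqP; split => // x [] /=.
  rewrite /C /= !in_itv/= => /andP[h1 h2] /andP[h3 h4].
  have [lij|lij|] := ltngtP i j; last by move=> /ord_inj ij'; rewrite ij' eqxx in ij.
  - by have := le_lt_trans (le_trans h2 (dis _ _ _ lij)) h3; rewrite ltxx.
  - by have := le_lt_trans (le_trans h4 (dis _ _ _ lij)) h1; rewrite ltxx.
have WU n : W n `<=` U.
  apply: (big_ind (fun A : set R => A `<=` U)) => [//|A B AU BU|j _].
    by rewrite subUset.
  exact: CU.
have lC n j : lambda (C n j) = (t n j - s n j)%:E.
  rewrite /C lebesgue_measure_itv/= lte_fin.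
  have [_ [+ _]] := st n j; rewrite le_eqVlt => /predU1P[->|->//].
  by rewrite ltxx subrr.
have lW n : lambda (W n) = (\sum_(j < 2 ^ n) (t n j - s n j))%:E.
  rewrite /W measure_semi_additive_ord//; last exact: mW.
    by rewrite -sumEFin; apply: eq_bigr => j _; exact: lC.
  by move=> j; exact: measurable_itv.
have mWn n : (m (W n) <= eps%:E)%E.
  rewrite /W measure_semi_additive_ord//; last exact: mW.
    rewrite (eq_bigr (fun j => (G (t n j) - G (s n j))%:E)); last first.
      by move=> j _; have [? [? ?]] := st n j; exact: mG.
    rewrite sumEFin lee_fin; apply/ltW.
    apply: le_lt_trans (dG _ (s n) (t n) _ _ _).
    - by apply: ler_sum => j _; exact: ler_norm.
    - exact: st.
    - move=> i j ij; have [lij|lij|] := ltngtP i j; last by move=> /ord_inj ij'; rewrite ij' eqxx in ij.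
      + by left; exact: dis.
      + by right; exact: dis.
    - rewrite -lte_fin -lW; apply: le_lt_trans Ud; apply: le_measure => //; rewrite inE.
      + exact: mW.
      + exact: open_measurable.
  by move=> j; exact: measurable_itv.
pose V n : set (measurableTypeR R) := \bigcap_(k >= n) W k.
have mV n : measurable (V n) by apply: bigcap_measurable => //; exists n => /=.
have VW n : V n `<=` W n by move=> x /(_ n); apply => /=.
have mVU : measurable (\bigcup_n V n) by exact: bigcup_measurable.
have ndV : nondecreasing_seq V.
  move=> i j ij; apply/subsetPset => x Vx k /= jk; apply: Vx => /=; exact: leq_trans jk.
have cV := nondecreasing_cvg_mu (mu := m) mV mVU ndV.
have VU : U `&` `]a, b] `<=` \bigcup_n V n.
  move=> x [Ux /=]; rewrite in_itv/= => /andP[ax xb].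
  have /nbhs_ballP[r /= r0 rU] := open_nbhs_nbhs (conj oU Ux).
  have [n bar] : exists n : nat, (b - a) / 2 ^+ n < r.
    exists (Num.bound ((b - a) / r)).
    rewrite ltr_pdivrMr// mulrC -ltr_pdivrMr//.
    exact: upper_nthrootP.
  exists n => // k /= nk.
  have kr : (b - a) / 2 ^+ k < r.
    apply: le_lt_trans bar; rewrite ler_pM2l// lef_pV2 ?posrE//.
    by rewrite ler_weXn2l// ler1n.
  have [j [j2 xj1 xj2]] : exists j : nat, [/\ (j < 2 ^ k)%N, pt k j < x & x <= pt k j.+1].
    have ex : exists j : nat, x <= pt k j by exists (2 ^ k)%N; rewrite ptb.
    case: (ex_minnP ex) => -[|j]; first by rewrite pt0 leNgt ax.
    move=> xj jmin; exists j; split => //.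
      by apply: (jmin (2 ^ k)%N); rewrite ptb.
    by rewrite ltNge; apply/negP => /jmin; rewrite ltnn.
  rewrite /W (bigD1 (Ordinal j2))//=; left.
  suff cU : cell k j `<=` U.
    by rewrite /C /s /t /=; case: asboolP => // _; rewrite /= in_itv/= xj1.
  move=> y; rewrite /cell /= in_itv/= => /andP[yj1 yj2]; apply: rU.
  rewrite /ball/=; apply: le_lt_trans kr.
  have : pt k j.+1 - pt k j = (b - a) / 2 ^+ k by rewrite /pt -natr1; ring.
  by rewrite ler_norml; lra.
apply: (@le_trans _ _ (m (\bigcup_n V n))).
  apply: le_measure => //; rewrite inE//.
  by apply: measurableI; [exact: open_measurable|exact: measurable_itv].
rewrite -(cvg_lim _ cV)//; apply: lime_le; first by apply/cvg_ex; eexists; exact: cV.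
apply: nearW => n /=; apply: le_trans (mWn n).
by apply: le_measure => //; rewrite inE//.
Qed.

End density.

Section ftc.
Variable R : realType.
Implicit Types (F G : R -> R) (a b : R).
Local Notation lambda := (@lebesgue_measure R).

(** The Stieltjes measure of G vanishes on Lebesgue null sets: these have open
    neighbourhoods of small measure, on which stieltjes_open_le applies. The
    density is then a Radon-Nikodym derivative. *)
Lemma nondecreasing_abs_cont_density a b G : a < b ->
  {in `[a, b] &, nondecreasing_fun G} -> abs_cont_on a b G ->
  exists f : R -> R, lambda.-integrable `[a, b] (EFin \o f) /\
    forall t, a <= t <= b -> \int[lambda]_(x in `[a, t]) f x = G t - G a.
Proof.
move=> ab ndG acG; have ab' := ltW ab.
pose Gc : R -> R := G \o clamp a b.
have ndGc : nondecreasing Gc.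
  move=> x y xy; apply: ndG; rewrite ?in_itv/= ?clamp_itv//; exact: clamp_mono.
have rcGc : right_continuous Gc.
  apply: right_continuousW => x; apply/(@cvgrPdist_lt _ R^o) => eps eps0.
  have [d d0 dG] := abs_cont_dist acG eps0.
  exists d => //= y yx; apply: dG; rewrite ?clamp_itv//.
  exact: le_lt_trans (clamp_dist _ _ _ _) yx.
pose isC := isCumulative.Build R _ R Gc ndGc rcGc.
pose Gcum : cumulative R R := HB.pack Gc isC.
pose m := lebesgue_stieltjes_measure Gcum.
have mE x y : a <= x -> x <= y -> y <= b -> m `]x, y]%classic = (G y - G x)%:E.
  move=> ax xy yb; rewrite /m /lebesgue_stieltjes_measure /measure_extension.
  rewrite measurable_mu_extE/=; last exact: is_ocitv.
  rewrite wlength_itv_bnd// /Gcum /= /Gc /= !clamp_id//.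
  - by rewrite ax (le_trans xy).
  - by rewrite yb (le_trans ax).
have mab : measurable (`]a, b]%classic : set (measurableTypeR R)) by exact: measurable_itv.
have finm : (m `]a, b]%classic < +oo)%E by rewrite mE// ltry.
pose nu := mfrestr mab finm.
have numu : nu `<< lambda.
  apply/null_content_dominatesP => A mA A0.
  apply/eqP; rewrite eq_le measure_ge0 andbT.
  apply/lee_addgt0Pr => eps eps0; rewrite add0e.
  have [d d0 dm] := stieltjes_open_le ab mE acG eps0.
  have [|U [oU AU Ud]] := @lebesgue_regularity_outer R A d mA _ d0.
    by rewrite [X in (X < _)%E]A0 ltry.
  apply: le_trans (dm U oU _).
    rewrite /nu /mfrestr /= /mrestr; apply: le_measure; rewrite ?inE.
    - exact: measurableI.
    - by apply: measurableI => //; exact: open_measurable.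
    - exact: setSI.
  rewrite -(setDUK AU); apply: le_lt_trans (measureU2 _ _ _) _ => //.
    by apply: measurableD => //; exact: open_measurable.
  by rewrite A0 add0e.
pose f := Radon_Nikodym_SigmaFinite.f nu lambda.
have fi : lambda.-integrable setT f by exact: Radon_Nikodym_SigmaFinite.f_integrable.
have fE : EFin \o (fine \o f) = f.
  by apply/funext => x /=; rewrite fineK// Radon_Nikodym_SigmaFinite.f_fin_num.
exists (fine \o f); rewrite fE; split.
  by apply: integrableS fi => //; exact: measurable_itv.
move=> t /andP[at_ tb].
have mat_ (i : interval R) : measurable ([set` i] : set (measurableTypeR R)) by exact: measurable_itv.
rewrite -Rintegral_itv_obnd_cbnd; last by rewrite fE; exact: integrableS fi.
have nuE : nu `]a, t]%classic = (\int[lambda]_(x in `]a, t]) f x)%E.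
  exact: Radon_Nikodym_SigmaFinite.f_integral.
rewrite /Rintegral (eq_integral f); last by move=> x _; rewrite -[in RHS]fE.
rewrite -nuE.
rewrite /nu /mfrestr /= /mrestr setIidl ?mE//.
by move=> x /=; rewrite !in_itv/= => /andP[-> /= /le_trans]; apply.
Qed.

Lemma abs_contB a b F G : abs_cont_on a b F -> abs_cont_on a b G ->
  abs_cont_on a b (fun x => F x - G x).
Proof.
move=> acF acG eps eps0; have e20 : 0 < eps / 2 by rewrite divr_gt0.
have [d d0 dF] := acF _ e20; have [d' d'0 dG] := acG _ e20.
exists (Num.min d d'); first by rewrite lt_min d0.
move=> n s t st dis; rewrite lt_min => /andP[sd sd'].
apply: (@le_lt_trans _ _ (\sum_(i < n) `|F (t i) - F (s i)| + \sum_(i < n) `|G (t i) - G (s i)|)).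
  rewrite -big_split; apply: ler_sum => i _ /=.
  apply: le_trans (ler_normB _ _); rewrite le_eqVlt; apply/orP; left.
  by apply/eqP; congr (`|_|); ring.
by rewrite [ltRHS]splitr ltrD// ?dF// dG.
Qed.

(** F is the difference of two nondecreasing absolutely continuous functions, its
    variation V and V - F. *)
Lemma abs_cont_density a b F : a < b -> abs_cont_on a b F ->
  exists f : R -> R, lambda.-integrable `[a, b] (EFin \o f) /\
    forall t, a <= t <= b -> \int[lambda]_(x in `[a, t]) f x = F t - F a.
Proof.
move=> ab acF; have ab' := ltW ab.
pose V x := fine (total_variation a x F).
have acV : abs_cont_on a b V by exact: abs_cont_total_variation.
have BVF := abs_cont_bounded_variation ab' acF.
have fin u v : a <= u -> u <= v -> v <= b -> total_variation u v F \is a fin_num.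
  move=> au uv vb; apply/bounded_variationP => //.
  by apply: (bounded_variationl uv vb); apply: (bounded_variationr au _ BVF); exact: le_trans uv vb.
have VF x y : a <= x -> x <= y -> y <= b -> `|F y - F x| <= V y - V x.
  move=> ax xy yb; rewrite /V (total_variationD F ax xy) fineD ?fin//; last exact: le_trans yb.
  by rewrite addrAC subrr add0r -lee_fin fineK ?fin// total_variation_ge.
have [|f1 [f1i f1E]] := nondecreasing_abs_cont_density ab _ acV.
  move=> x y; rewrite !in_itv/= => /andP[ax _] /andP[_ yb] xy.
  by rewrite -subr_ge0; apply: le_trans (VF _ _ ax xy yb).
have [|f2 [f2i f2E]] := nondecreasing_abs_cont_density ab _ (abs_contB acV acF).
  move=> x y; rewrite !in_itv/= => /andP[ax _] /andP[_ yb] xy.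
  by have := VF _ _ ax xy yb; rewrite ler_norml => /andP[_]; lra.
have mi (i : interval R) : measurable ([set` i] : set (measurableTypeR R)) by exact: measurable_itv.
exists (fun x => f1 x - f2 x); split; first exact: (integrableB (mi _) f1i f2i).
move=> t /andP[at_ tb]; have sub : `[a, t] `<=` `[a, b].
  by move=> x /=; rewrite !in_itv/= => /andP[-> /= /le_trans]; apply.
have f1t : lambda.-integrable `[a, t] (EFin \o f1).
  by apply: integrableS f1i => //; exact: mi.
have f2t : lambda.-integrable `[a, t] (EFin \o f2).
  by apply: integrableS f2i => //; exact: mi.
by rewrite (RintegralB _ f1t f2t)// f1E ?f2E ?at_//; ring.
Qed.

(** The derivative of the primitive of the density is that density almost
    everywhere, by the Lebesgue differentiation theorem. *)
Lemma abs_cont_ftc a b F : a < b -> abs_cont_on a b F ->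
  forall t, a <= t <= b -> has_int `[a, t] (derive1 F) (F t - F a).
Proof.
move=> ab acF t /andP[at_ tb].
have [f [fi fE]] := abs_cont_density ab acF.
have mi (i : interval R) : measurable ([set` i] : set (measurableTypeR R)) by exact: measurable_itv.
have sub : `[a, t] `<=` `[a, b].
  by move=> x /=; rewrite !in_itv/= => /andP[-> /= /le_trans]; apply.
exists f; first by apply: integrableS fi => //; exact: measurable_itv.
split; last by rewrite fE// at_.
pose g := f \_ `[a, b].
have gi : lambda.-integrable setT (EFin \o g).
  by rewrite /g -restrict_EFin -integrable_mkcond.
have locg : locally_integrable setT g.
  by apply: open_integrable_locally => //; exact: openT.
have := lebesgue_differentiation locg.
have aea : {ae lambda, forall x, x != a}.
  exists [set a]; split; [exact: measurable_set1|exact: lebesgue_measure_set1|].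
  by move=> x /= /negP/negPn/eqP.
have aeb : {ae lambda, forall x, x != b}.
  exists [set b]; split; [exact: measurable_set1|exact: lebesgue_measure_set1|].
  by move=> x /= /negP/negPn/eqP.
apply: filterS3 aea aeb => x xa xb gx /=; rewrite in_itv/= => /andP[ax xt].
have {xa ax}ax : a < x by rewrite lt_neqAle eq_sym xa.
have {xb xt tb}xb : x < b by rewrite lt_neqAle xb (le_trans xt).
have gib : lambda.-integrable `[a, b] (EFin \o g).
  by apply: integrableS gi => //; exact: measurable_itv.
have [|dG GE] := @FTC1_lebesgue_pt R g (BLeft a) x b xb gib _ gx; first by rewrite lte_fin.
rewrite -[RHS](_ : g x = _); last first.
  by rewrite /g patchE mem_set//= in_itv/= !ltW.
rewrite -GE; set H := (fun y : R => _).
have HE y : a <= y <= b -> H y = F y - F a.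
  move=> /andP[ay yb]; rewrite /H -fE ?ay// /Rintegral; congr fine.
  apply: eq_integral => z; rewrite inE/= in_itv/= => /andP[az zy].
  by rewrite /g patchE mem_set//= in_itv/= az (le_trans zy).
have nHF : \forall y \near x, F y = H y + F a.
  have : x \in `]a, b[ by rewrite in_itv/= ax.
  move/near_in_itvoo; apply: filterS => y; rewrite in_itv/= => /andP[ay yb].
  by rewrite HE ?ltW// subrK.
rewrite !derive1E (near_eq_derive (1 : R) nHF) deriveD//; first by rewrite derive_cst addr0.
Qed.

End ftc.

Section primitive.
Variable R : realType.
Implicit Types (F f g psi : R -> R) (a b : R).
Local Notation lambda := (@lebesgue_measure R).

Lemma mset_itv (i : interval R) : measurable ([set` i] : set (measurableTypeR R)).
Proof. exact: measurable_itv. Qed.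

Lemma has_int_itvxx a g : has_int `[a, a] g 0.
Proof.
apply: (@ae_eq_has_int _ _ (fun=> 0)); last exact: has_int0.
exists [set a]; split; [exact: measurable_set1|exact: lebesgue_measure_set1|].
move=> x /=; apply: contra_notP => /eqP xa; rewrite in_itv/= -eq_le => /eqP ax.
by rewrite ax eqxx in xa.
Qed.

Lemma has_intS a b c d g v : a <= c -> d <= b -> has_int `[a, b] g v ->
  exists w, has_int `[c, d] g w.
Proof.
move=> ac db [f fi [gf _]]; exists (\int[lambda]_(x in `[c, d]) f x), f => //.
  apply: integrableS fi; [exact: mset_itv|exact: mset_itv|].
  by apply: subset_itv; rewrite bnd_simp.
split => //; apply: filterS gf => x h /=; rewrite in_itv/= => /andP[cx xd]; apply: h.
by rewrite /= in_itv/= (le_trans ac)// (le_trans xd).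
Qed.

Lemma has_int_derive a b F f : a <= b -> {within `[a, b], continuous f} ->
  (forall x : R, a <= x <= b -> is_derive x 1 F (f x)) ->
  has_int `[a, b] f (F b - F a).
Proof.
rewrite le_eqVlt => /predU1P[<-{b} _ _|ab cf dF].
  by rewrite subrr; exact: has_int_itvxx.
have -> : F b - F a = \int[lambda]_(x in `[a, b]) f x.
  rewrite /Rintegral (@continuous_FTC2 _ f F)//.
    have cF x : a <= x <= b -> F @ x --> F x.
      by move=> /dF dFx; apply/differentiable_continuous/derivable1_diffP; exact: ex_derive.
    split.
    - by move=> x; rewrite in_itv/= => /andP[ax xb]; have [] := dF x _; rewrite ?ltW.
    - by apply: cvg_at_right_filter; apply: cF; rewrite lexx ltW.
    - by apply: cvg_at_left_filter; apply: cF; rewrite lexx ltW.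
  by move=> x; rewrite in_itv/= derive1E => /andP[ax xb]; have [] := dF x _; rewrite ?ltW.
exact: continuous_has_int.
Qed.

Lemma has_int_cst a b r : a <= b -> has_int `[a, b] (fun=> r) (r * (b - a)).
Proof.
move=> ab; rewrite mulrBr; apply: (@has_int_derive _ _ (fun x => r * x)) => //.
  by apply: continuous_subspaceT => x; exact: cvg_cst.
move=> x _; have := @is_deriveZ R R R id r x 1 1 (is_derive_id x 1).
by rewrite [X in is_derive _ _ _ X]mulr1.
Qed.

Lemma norm_has_int_le (D : set (measurableTypeR R)) g k v w : measurable D ->
  {ae lambda, forall x, D x -> `|g x| <= k x} ->
  has_int D g v -> has_int D k w -> `|v| <= w.
Proof.
move=> mD gk gv kw; rewrite ler_norml; apply/andP; split; last first.
  by apply: le_has_int gv kw => //; apply: filterS gk => x h /h; rewrite ler_norml => /andP[].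
rewrite -mulN1r; apply: (le_has_int mD _ (has_intZ (-1) mD kw) gv).
by apply: filterS gk => x h /h; rewrite ler_norml mulN1r => /andP[].
Qed.

(** Continuous functions are dense in L^1, and for a continuous density this is
    the usual integration by parts. *)
Lemma has_int_mul_C1 (T : R) F g psi psi' : 0 <= T ->
  {within `[0, T], continuous F} ->
  (forall t, 0 <= t <= T -> has_int `[0, t] g (F t - F 0)) ->
  (forall x : R, is_derive x 1 psi (psi' x)) -> continuous psi' ->
  has_int `[0, T] (fun s => psi' s * F s + psi s * g s) (psi T * F T - psi 0 * F 0).
Proof.
rewrite le_eqVlt => /predU1P[<-|T0] cF gF dpsi cpsi'.
  by rewrite subrr; exact: has_int_itvxx.
have cpsi : continuous psi.
  by move=> x; apply/differentiable_continuous/derivable1_diffP; have [] := dpsi x.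
have [f fi [gf fE]] : has_int `[0, T] g (F T - F 0) by apply: gF; rewrite ltW/=.
have mT := mset_itv `[0, T].
have [M M0 [psiM psi'M]] : exists2 M, 0 < M & (forall x, 0 <= x <= T -> `|psi x| <= M) /\
    (forall x, 0 <= x <= T -> `|psi' x| <= M).
  have bnd (h : R -> R) : continuous h -> exists2 M, 0 < M & forall x, 0 <= x <= T -> `|h x| <= M.
    move=> ch; have [|M [_ HM]] := @compact_bounded _ _ (h @` `[0, T]).
      by apply: continuous_compact; [exact: continuous_subspaceT|exact: segment_compact].
    exists (`|M| + 1) => [|x x0T]; first by rewrite ltr_wpDl.
    by apply: HM; [rewrite ltr_pwDr// ler_norm|exists x].
  have [M1 M10 h1] := bnd _ cpsi; have [M2 M20 h2] := bnd _ cpsi'.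
  exists (M1 + M2); first exact: addr_gt0.
  by split=> x xT; [apply: le_trans (h1 _ xT) _|apply: le_trans (h2 _ xT) _]; lra.
have int_psif : lambda.-integrable `[0, T] (EFin \o (fun x => psi x * f x)).
  apply: (@integrableMr _ _ _ lambda _ mT psi _ _ _ fi).
    by apply: measurable_funTS; exact: continuous_measurable_fun.
  exists M; split; first exact: num_real.
  move=> N MN x /=; rewrite in_itv/= => xT; apply: le_trans (psiM _ xT) _; exact: ltW.
have [I1 hI1] : exists I1, has_int `[0, T] (fun s => psi' s * F s) I1.
  eexists; apply: continuous_has_int => x.
  by apply: cvgM; [exact: continuous_subspaceT|exact: cF].
have [I2 hI2] : exists I2, has_int `[0, T] (fun s => psi s * g s) I2.
  eexists; apply: ae_eq_has_int (integrable_has_int int_psif).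
  by apply: filterS gf => x h xT; rewrite h.
suff -> : psi T * F T - psi 0 * F 0 = I1 + I2 by exact: has_intD.
apply/eqP; rewrite -subr_eq0 -normr_le0; apply/ler_addgt0Pr => eps eps0.
rewrite add0r.
pose e := eps / (M * (T + 2)).
have e0 : 0 < e by rewrite divr_gt0// mulr_gt0// ltr_wpDl// ltW.
have [fn [cfn fni ffn]] : exists fn, [/\ continuous fn, lambda.-integrable `[0, T] (EFin \o fn) &
    \int[lambda]_(x in `[0, T]) `|f x - fn x| < e].
  have muT : (lambda `[0%R, T]%classic < +oo)%E.
    by rewrite lebesgue_measure_itv/= lte_fin T0 -EFinB ltry.
  have [fk [cfk fki]] := approximation_continuous_integrable mT muT fi.
  move=> /fine_cvgP[_ /cvgrPdist_lt /(_ _ e0)][n _ /(_ n (leqnn n))] /=.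
  rewrite sub0r normrN => h; exists (fk n); split => //.
  by apply: le_lt_trans h; exact: ler_norm.
pose Fn (s : R) := F 0 + (\int[lambda]_(x in `[-1, s]) fn x - \int[lambda]_(x in `[-1, 0]) fn x).
have dFn (x : R) : -1 < x -> is_derive x 1 Fn (fn x).
  move=> x1; have xx1 : x < x + 1 by rewrite ltrDl.
  have [|dx dE] := @continuous_FTC1_closed R fn (-1) x _ xx1 _ x1 (cfn x).
    apply: continuous_compact_integrable; first exact: segment_compact.
    exact: continuous_subspaceT.
  rewrite derive1E in dE.
  have -> : Fn = (fun y => (\int[lambda]_(t in `[-1, y]) fn t) +
      (F 0 - \int[lambda]_(x in `[-1, 0]) fn x)).
    by apply/funext => y; rewrite /Fn; ring.
  set G := (fun y : R => \int[lambda]_(t in `[-1, y]) fn t) in dx dE *.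
  have dG : is_derive x 1 G (fn x) by split.
  have := is_deriveD dG (is_derive_cst (F 0 - \int[lambda]_(x in `[-1, 0]) fn x) x 1).
  by rewrite addr0.
have Fn0 : Fn 0 = F 0 by rewrite /Fn subrr addr0.
have Fnint s : 0 <= s -> has_int `[0, s] fn (Fn s - F 0).
  move=> s0; rewrite -Fn0; apply: has_int_derive => //; first exact: continuous_subspaceT.
  by move=> x /andP[x0 _]; apply: dFn; rewrite (lt_le_trans _ x0)// ltrN10.
have absint : has_int `[0, T] (fun x => `|f x - fn x|) (\int[lambda]_(x in `[0, T]) `|f x - fn x|).
  apply: integrable_has_int.
  have := integrableB mT fi fni; move=> /integrable_abse.
  exact.
have FFn s : 0 <= s <= T -> `|F s - Fn s| <= e.
  move=> /andP[s0 sT]; have ms := mset_itv `[0, s].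
  have [w wint] := has_intS (lexx 0) sT absint.
  have -> : F s - Fn s = (F s - F 0) - (Fn s - F 0) by ring.
  have hgs : has_int `[0, s] g (F s - F 0) by apply: gF; rewrite s0.
  apply: (@le_trans _ _ w).
    apply: (norm_has_int_le ms _ (has_intB ms hgs (Fnint _ s0)) wint).
    apply: filterS gf => x h /=; rewrite in_itv/= => /andP[x0 xs].
    by rewrite h//= in_itv/= x0 (le_trans xs).
  apply: ltW; apply: le_lt_trans ffn.
  have absi : lambda.-integrable `[0, T] (EFin \o (fun x => `|f x - fn x|)).
    have := integrable_abse (integrableB mT fi fni); exact.
  have absis : lambda.-integrable `[0, s] (EFin \o (fun x => `|f x - fn x|)).
    by apply: integrableS absi => //; apply: subset_itv; rewrite bnd_simp.
  rewrite (has_int_uniq ms wint (integrable_has_int absis)).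
  rewrite /Rintegral fine_le ?integrable_fin_num//.
  apply: ge0_subset_integral => //; last by apply: subset_itv; rewrite bnd_simp.
  exact: measurable_int absi.
have cFn : {within `[0, T], continuous Fn}.
  apply: derivable_within_continuous => x; rewrite in_itv/= => /andP[x0 _].
  by have [] := dFn x (lt_le_trans (ltrN10 _) x0).
have hpf : has_int `[0, T] (fun s => psi' s * Fn s + psi s * fn s) (psi T * Fn T - psi 0 * Fn 0).
  apply: (@has_int_derive _ _ (fun s => psi s * Fn s)); first exact: ltW.
    move=> x; apply: cvgD; apply: cvgM; [|exact: cFn| |];
    by apply: continuous_subspaceT.
  move=> x /andP[x0 _]; have dFx := dFn x (lt_le_trans (ltrN10 _) x0).
  apply: is_derive_eq; rewrite addrC /GRing.scale/= mulrC; congr (_ + _).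
have hD := has_intB mT (has_intD mT hI1 hI2) hpf.
have hB := has_intD mT (has_int_cst (M * e) (ltW T0)) (has_intZ M mT absint).
have := norm_has_int_le mT _ hD hB; rewrite Fn0 subr0 => hle.
have FT : `|F T - Fn T| <= e by apply: FFn; rewrite lexx ltW.
have psiT : `|psi T| <= M by apply: psiM; rewrite lexx ltW.
rewrite distrC.
have -> : I1 + I2 - (psi T * F T - psi 0 * F 0) =
   (I1 + I2 - (psi T * Fn T - psi 0 * F 0)) - psi T * (F T - Fn T) by ring.
apply: le_trans (ler_normB _ _) _; rewrite normrM.
apply: (@le_trans _ _ (M * e * T + M * e + M * e)); last first.
  have -> : eps = e * (M * (T + 2)).
    by rewrite /e divfK// gt_eqF// mulr_gt0// addr_gt0.
  lra.
apply: lerD; last by apply: ler_pM.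
apply: le_trans (hle _) _; last by rewrite lerD2l ler_pM2l// ltW.
apply: filterS gf => x h xT; rewrite (h xT).
move: xT => /=; rewrite in_itv/= => xT.
have -> : psi' x * F x + psi x * f x - (psi' x * Fn x + psi x * fn x) =
  psi' x * (F x - Fn x) + psi x * (f x - fn x) by ring.
apply: le_trans (ler_normD _ _) _; rewrite !normrM; apply: lerD.
  by apply: ler_pM => //; [exact: psi'M|exact: FFn].
by rewrite ler_wpM2r// psiM.
Qed.

End primitive.

(** * The Hilbert space L^2(0,1) *)

Section inner_product.
Variable R : realType.
Implicit Types (f g k : L2 R) (r : R).
Local Notation mu := (@mu01 R).

Lemma Lfun2_Lfun (u : Lfun2 R) : (u : R -> R) \in Lfun mu 2%:E.
Proof.
by rewrite inE; apply/andP; split; rewrite inE//=; exact: Lfunction_finite.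
Qed.

Lemma ofL2_mul_integrable f g : mu.-integrable setT (EFin \o (fun x => ofL2 f x * ofL2 g x)).
Proof. by apply/Lfun1_integrable; apply: Lfun2_mul_Lfun1; exact: Lfun2_Lfun. Qed.

Lemma eq_inner (u : Lfun2 R) g (w : R -> R) : mu.-integrable setT (EFin \o w) ->
  {ae mu, forall x, ofL2 (toL2 u) x * ofL2 g x = w x} ->
  inner (toL2 u) g = \int[mu]_x w x.
Proof.
move=> wi h; rewrite /inner /Rintegral; congr fine; apply: ae_eq_integral => //.
- exact: measurable_int (ofL2_mul_integrable _ _).
- exact: measurable_int wi.
- by apply: filterS h => x /= -> _.
Qed.

Lemma innerC f g : inner f g = inner g f.
Proof. by rewrite /inner; apply: eq_Rintegral => x _; rewrite mulrC. Qed.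

Lemma innerDl f g k : inner (f + g) k = inner f k + inner g k.
Proof.
rewrite -[f in LHS]ofL2K -[g in LHS]ofL2K -toL2D.
rewrite (@eq_inner _ _ (fun x => ofL2 f x * ofL2 k x + ofL2 g x * ofL2 k x)).
- by rewrite RintegralD//; exact: ofL2_mul_integrable.
- exact: (integrableD measurableT (ofL2_mul_integrable f k) (ofL2_mul_integrable g k)).
- by apply: filterS (toL2K (ofL2 f + ofL2 g)) => x ->; rewrite -mulrDl.
Qed.

Lemma innerZl r f g : inner (r *: f) g = r * inner f g.
Proof.
rewrite -[f in LHS]ofL2K -[_ *: _]/(scaleL2 r _) -toL2Z.
rewrite (@eq_inner _ _ (fun x => r * (ofL2 f x * ofL2 g x))).
- by rewrite RintegralZl//; exact: ofL2_mul_integrable.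
- exact: (integrableZl measurableT r (ofL2_mul_integrable f g)).
- by apply: filterS (toL2K (r *: ofL2 f)) => x ->; rewrite mulrA.
Qed.

Lemma inner0l g : inner 0 g = 0.
Proof. by rewrite -(scale0r (0 : L2 R)) innerZl mul0r. Qed.

Lemma innerNl f g : inner (- f) g = - inner f g.
Proof. by rewrite -scaleN1r innerZl mulN1r. Qed.

Lemma innerBl f g k : inner (f - g) k = inner f k - inner g k.
Proof. by rewrite innerDl innerNl. Qed.

Lemma inner_suml (I : Type) (s : seq I) (F : I -> L2 R) g :
  inner (\sum_(i <- s) F i) g = \sum_(i <- s) inner (F i) g.
Proof.
elim: s => [|i s ih]; first by rewrite !big_nil inner0l.
by rewrite !big_cons innerDl ih.
Qed.

Lemma innerDr f g k : inner k (f + g) = inner k f + inner k g.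
Proof. by rewrite innerC innerDl !(innerC k). Qed.

Lemma innerZr r f g : inner g (r *: f) = r * inner g f.
Proof. by rewrite innerC innerZl innerC. Qed.

Lemma inner_sumr (I : Type) (s : seq I) (F : I -> L2 R) g :
  inner g (\sum_(i <- s) F i) = \sum_(i <- s) inner g (F i).
Proof. by rewrite innerC inner_suml; apply: eq_bigr => i _; rewrite innerC. Qed.

Lemma inner_norm f : inner f f = `|f| ^+ 2.
Proof.
rewrite -[`|f|]/(normL2 f) /normL2.
have fin : ('N[mu]_2%:E [EFin \o ofL2 f])%E \is a fin_num.
  rewrite ge0_fin_numE ?Lnorm_ge0//.
  by have /andP[_] := Lfun2_Lfun (ofL2 f); rewrite inE.
have h := @powR_Lnorm _ _ _ mu (EFin \o ofL2 f) 2.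
rewrite -powR_mulrn ?fine_ge0 ?Lnorm_ge0//.
apply: EFin_inj; rewrite -poweR_EFin /inner /Rintegral !fineK//; last first.
  by apply: integrable_fin_num => //; exact: ofL2_mul_integrable.
rewrite h//; apply: eq_integral => x _.
rewrite -[RHS]/((`|ofL2 f x| `^ 2%:R)%:E) powR_mulrn//.
by rewrite real_normK// num_real.
Qed.

Lemma inner_le_norm f g : inner f g <= `|f| * `|g|.
Proof.
have [->|g0] := eqVneq g 0; first by rewrite innerC inner0l mulr_ge0.
have g1 : 0 < `|g| by rewrite normr_gt0.
have : 0 <= inner (`|g| *: f - `|f| *: g) (`|g| *: f - `|f| *: g).
  by rewrite inner_norm exprn_ge0.
rewrite !(innerBl, innerDr, innerZl, innerZr) -!scaleNr !innerZr.
rewrite (innerC g f) !inner_norm.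
have [->|f0] := eqVneq f 0; first by rewrite inner0l mulr_ge0.
have f1 : 0 < `|f| by rewrite normr_gt0.
have fg : 0 < `|f| * `|g| by rewrite mulr_gt0.
move=> h.
have : 0 <= (`|f| * `|g|) * (`|f| * `|g| - inner f g) by lra.
by rewrite pmulr_rge0// subr_ge0.
Qed.

Lemma norm_inner_le f g : `|inner f g| <= `|f| * `|g|.
Proof.
rewrite ler_norml inner_le_norm andbT lerNl -innerNl.
by rewrite -(normrN f) inner_le_norm.
Qed.

Lemma inner_cvg (T : Type) (F : set_system T) {FF : Filter F} (u : T -> L2 R) f g :
  u @ F --> f -> inner (u x) g @[x --> F] --> inner f g.
Proof.
move=> uf; apply/cvgrPdist_lt => eps eps0.
have e0 : 0 < eps / (`|g| + 1) by rewrite divr_gt0// ltr_wpDl.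
move/cvgrPdist_lt : uf => /(_ _ e0); apply: filterS => x ux.
rewrite -innerBl; apply: le_lt_trans (norm_inner_le _ _) _.
rewrite ltr_pdivlMr ?ltr_wpDl// in ux.
by apply: le_lt_trans ux; rewrite ler_wpM2l// lerDl.
Qed.

End inner_product.

Section hilbert_basis.
Variables (R : realType) (e : nat -> L2 R).
Hypothesis be : hilbert_basis e.

Lemma inner_basis m n : inner (e m) (e n) = (m == n)%:R.
Proof. by case: be. Qed.

Lemma inner_comb n (x : 'I_n -> R) (m : 'I_n) :
  inner (\sum_(i < n) x i *: e i) (e m) = x m.
Proof.
rewrite inner_suml (bigD1 m)//= innerZl inner_basis eqxx mulr1 big1 ?addr0// => i im.
by rewrite innerZl inner_basis (inj_eq val_inj) (negbTE im) mulr0.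
Qed.

Lemma norm_comb n (x : 'I_n -> R) :
  `|\sum_(i < n) x i *: e i| = Num.sqrt (\sum_(i < n) x i ^+ 2).
Proof.
rewrite -[LHS]normr_id -sqrtr_sqr -inner_norm inner_sumr.
congr Num.sqrt; apply: eq_bigr => i _.
by rewrite innerZr inner_comb expr2.
Qed.

(** The span of the basis is dense, hence the norm of f is the norm of the
    linear form that f induces on this span. *)
Lemma dual_norm_le f (B : R) : 0 <= B ->
  (forall n (x : 'I_n -> R), \sum_(i < n) x i * inner f (e i) <=
     B * Num.sqrt (\sum_(i < n) x i ^+ 2)) ->
  `|f| <= B.
Proof.
move=> B0 h; rewrite leNgt; apply/negP => Bf.
have f0 : 0 < `|f| by exact: le_lt_trans Bf.
have fB : 0 < B + `|f| by rewrite ltr_wpDl.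
pose eps := `|f| * (`|f| - B) / (2 * (B + `|f|)).
have eps0 : 0 < eps by rewrite divr_gt0 ?mulr_gt0// subr_gt0.
have : closure [set g | exists n (x : 'I_n -> R), g = \sum_(i < n) x i *: e i] f.
  by case: be => _ ->.
move=> /(_ _ (nbhsx_ballx f eps eps0))[_ [[n [x ->]]]].
rewrite -ball_normE /=; set g := (\sum_(i < n) _) => fg.
have h1 : inner f g <= B * `|g|.
  by rewrite norm_comb inner_sumr; under eq_bigr do rewrite innerZr; exact: h.
have h2 : `|g| <= `|f| + eps.
  rewrite -(subrK f g) addrC; apply: le_trans (ler_normD _ _) _.
  by rewrite lerD2l distrC ltW.
have h3 : inner f (f - g) <= `|f| * eps.
  by apply: le_trans (inner_le_norm _ _) _; rewrite ler_wpM2l// ltW.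
have h4 : `|f| ^+ 2 = inner f g + inner f (f - g).
  by rewrite -innerDr addrC subrK inner_norm.
have h5 : eps * (2 * (B + `|f|)) = `|f| * (`|f| - B).
  by rewrite /eps divfK// gt_eqF// mulr_gt0.
have h6 : B * `|g| <= B * (`|f| + eps) by rewrite ler_wpM2l.
have h7 : 0 < eps * (B + `|f|) by rewrite mulr_gt0.
lra.
Qed.

End hilbert_basis.

Section semigroup.
Variables (R : realType) (V : normedModType R).
Implicit Types (S : R -> V -> V) (f : V).

(** Right-continuity yields intervals, nested and shrinking, on which the
    oscillation tends to zero; they share a point. *)
Lemma right_continuous_continuity_point (G : R -> V) (a b : R) : a < b ->
  (forall t, a < t < b -> G x @[x --> t^'+] --> G t) ->
  exists2 t, a < t < b & {for t, continuous G}.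
Proof.
move=> ab rG.
have next (q : nat * (R * R)) : exists p : R * R,
    a <= q.2.1 -> q.2.1 < q.2.2 -> q.2.2 <= b ->
    [/\ q.2.1 < p.1, p.1 < p.2, p.2 < q.2.2 &
     forall u, p.1 <= u <= p.2 -> `|G p.1 - G u| <= q.1.+1%:R^-1].
  case: q => n [x y] /=.
  have [ax|ax] := leP a x; last by exists (x, y).
  have [xy|xy] := ltP x y; last by exists (x, y).
  have [yb|yb] := leP y b; last by exists (x, y).
  pose m := (x + y) / 2.
  have xm : x < m by rewrite /m; lra.
  have my : m < y by rewrite /m; lra.
  have /rG : a < m < b by rewrite (le_lt_trans ax)//= (lt_le_trans my).
  have n0 : 0 < n.+1%:R^-1 :> R by rewrite invr_gt0.
  move=> /cvgrPdist_le/(_ _ n0)[d /= d0 dG].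
  exists (m, Num.min (m + d / 2) ((m + y) / 2)) => _ _ _; split => //=.
  - by rewrite lt_min; apply/andP; split; lra.
  - by rewrite gt_min; apply/orP; right; lra.
  move=> u /andP[mu]; rewrite le_min => /andP[ud _].
  have [<-|um] := eqVneq m u; first by rewrite subrr normr0 ltW.
  have {um}mu : m < u by rewrite lt_neqAle um.
  apply: dG => //=.
  by rewrite ltr0_norm ?subr_lt0//; lra.
have [nx nxP] := choice next.
pose p := fix p n := if n is k.+1 then nx (k, p k) else (a, b).
have pP n : [/\ a <= (p n).1, (p n).1 < (p n).2 & (p n).2 <= b].
  elim: n => [|n [h1 h2 h3]]; first by rewrite /= !lexx.
  have [h4 h5 h6 _] := nxP (n, p n) h1 h2 h3.
  split => //=; first exact: le_trans h1 (ltW h4).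
  exact: le_trans (ltW h6) h3.
have pS n : [/\ (p n).1 < (p n.+1).1, (p n.+1).2 < (p n).2 &
    forall u, (p n.+1).1 <= u <= (p n.+1).2 -> `|G (p n.+1).1 - G u| <= n.+1%:R^-1].
  by have [h1 h2 h3] := pP n; have [h4 h5 h6 h7] := nxP (n, p n) h1 h2 h3.
have inc m n : (m <= n)%N -> (p m).1 <= (p n).1.
  move=> /subnK <-; elim: (n - m)%N => // k ih.
  by rewrite addSn; apply: (le_trans ih); have [/ltW] := pS (k + m)%N.
have dec m n : (m <= n)%N -> (p n).2 <= (p m).2.
  move=> /subnK <-; elim: (n - m)%N => // k ih.
  by rewrite addSn; apply: le_trans ih; have [_ /ltW] := pS (k + m)%N.
pose t := sup (range (fun n => (p n).1)).
have ub m n : (p n).1 <= (p m).2.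
  have [mn|/ltnW nm] := leqP m n.
    by apply: le_trans (dec _ _ mn); have [_ /ltW] := pP n.
  by apply: (le_trans (inc _ _ nm)); have [_ /ltW] := pP m.
have hs : has_sup (range (fun n => (p n).1)).
  split; first by exists (p 0%N).1, 0%N.
  by exists (p 0%N).2 => _ [n _ <-]; exact: ub.
have tlo n : (p n).1 < t.
  have [h _ _] := pS n; apply: lt_le_trans h _.
  by apply: sup_upper_bound => //; exists n.+1.
have thi n : t < (p n).2.
  have [_ h _] := pS n; apply: le_lt_trans h.
  by apply: ge_sup => [|_ [k _ <-]]; [exists (p 0%N).1, 0%N|exact: ub].
exists t; first by rewrite (tlo 0%N) (thi 0%N).
apply/cvgrPdist_le => eps eps0.
have [n neps] : exists n : nat, n.+1%:R^-1 + n.+1%:R^-1 <= eps.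
  exists (Num.bound (2 / eps)).
  have := archi_boundP (ltW (divr_gt0 (ltr0Sn R 1) eps0)).
  set N := Num.bound _ => h; rewrite -mulr2n -(mulr_natl _ 2) ler_pdivrMr//.
  by rewrite mulrC -ler_pdivrMr//; apply: (le_trans (ltW h)); rewrite ler_nat.
have : t \in `](p n.+1).1, (p n.+1).2[ by rewrite in_itv; apply/andP; split; [exact: (tlo n.+1)|exact: (thi n.+1)].
move/near_in_itvoo; apply: filterS => u; rewrite in_itv/= => /andP[u1 u2].
have [_ _ osc] := pS n.
apply: le_trans neps.
have -> : G t - G u = (G (p n.+1).1 - G u) - (G (p n.+1).1 - G t).
  by rewrite opprB [RHS]addrC addrA subrK.
apply: le_trans (ler_normB _ _) _; apply: lerD; apply: osc; first by rewrite !ltW.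
by apply/andP; split; apply/ltW; [exact: (tlo n.+1)|exact: (thi n.+1)].
Qed.

(** At a continuity point t0 the orbit is continuous from the left; the bounded
    operators S (t - t0) carry this property to all later times. *)
Lemma C0_semigroup_continuous S f : C0_semigroup S ->
  forall t, 0 < t -> {for t, continuous (fun s => S s f)}.
Proof.
move=> [Slin Scont S0 SD Sright] t t0.
have [|t1 /andP[t10 t1t] ct1] := @right_continuous_continuity_point (fun s => S s f) 0 t t0.
  move=> u /andP[u0 _].
  have : S u (S h f) @[h --> 0^'+] --> S u f.
    by apply: cvg_comp (Sright f) _; apply: Scont; exact: ltW.
  move=> H; apply/cvgrPdist_le => eps eps0.
  move/cvgrPdist_le : H => /(_ _ eps0)[d /= d0 dS].
  exists d => //= y yu uy; have yu0 : 0 < y - u by rewrite subr_gt0.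
  have := dS (y - u) _ yu0; rewrite -SD ?(ltW u0) ?(ltW yu0)// [u + _]addrC subrK; apply.
  by rewrite /= sub0r opprB.
have t1t' : 0 <= t - t1 by rewrite subr_ge0 ltW.
have : S (t - t1) (S (s - (t - t1)) f) @[s --> t] --> S (t - t1) (S t1 f).
  apply: (@cvg_comp _ _ _ (fun s => S (s - (t - t1)) f) (S (t - t1)) _ (nbhs (S t1 f))).
    have ct : s - (t - t1) @[s --> t] --> t1.
      have E : t - (t - t1) = t1 by ring.
      by rewrite -[X in _ --> X]E; apply: cvgB; [exact: cvg_id|exact: cvg_cst].
    exact: (cvg_comp _ _ ct ct1).
  by apply: Scont.
rewrite -SD ?(ltW t10)// subrK.
apply: cvg_trans; apply: near_eq_cvg.
have : \forall s \near t, t - t1 < s by apply: lt_nbhsr; lra.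
by apply: filterS => s ts; rewrite -SD// ?subr_ge0 ?ltW// addrC subrK.
Qed.

(** A continuous function with right derivative zero is constant: the last time
    up to which its increment is at most linear with slope eps cannot be
    followed by any other. *)
Lemma C0_semigroup_fixed S f : C0_semigroup S ->
  t^-1 *: (S t f - f) @[t --> 0^'+] --> 0 -> forall t, 0 <= t -> S t f = f.
Proof.
move=> CS df t; have Sc := C0_semigroup_continuous (f := f) CS.
move: CS => [Slin Scont S0 SD Sright].
have rd u : 0 <= u -> forall eps, 0 < eps -> exists2 d, 0 < d &
    forall h, 0 < h -> h < d -> `|S (u + h) f - S u f| <= eps * h.
  move=> u0 eps eps0.
  have : S u (h^-1 *: (S h f - f)) @[h --> 0^'+] --> S u 0.
    by apply: cvg_comp df _; apply: Scont.
  have -> : S u 0 = 0.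
    by have := Slin u u0 (-1) 0 0; rewrite scaleN1r oppr0 addr0 scaleN1r addNr.
  move/cvgrPdist_le => /(_ _ eps0)[d /= d0 dS]; exists d => // h h0 hd.
  have := dS h _ h0; rewrite /= !sub0r !normrN gtr0_norm// => /(_ hd).
  have -> : S u (h^-1 *: (S h f - f)) = h^-1 *: (S (u + h) f - S u f).
    rewrite SD ?(ltW h0)//.
    have SZ r g : S u (r *: g) = r *: S u g.
      have := Slin u u0 r g 0; rewrite addr0.
      have := Slin u u0 (-1) 0 0; rewrite scaleN1r oppr0 addr0 scaleN1r addNr => ->.
      by rewrite addr0.
    rewrite SZ; congr (_ *: _).
    by have := Slin u u0 (-1) f (S h f); rewrite !scaleN1r ![- _ + _]addrC.
  by rewrite normrZ gtr0_norm ?invr_gt0// ler_pdivrMl// mulrC.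
rewrite le_eqVlt => /predU1P[<-|t0]; first exact: S0.
apply/eqP; rewrite -subr_eq0 -normr_le0; apply/ler_addgt0Pr => eps' eps'0.
rewrite add0r; pose eps := eps' / t.
have eps0 : 0 < eps by rewrite divr_gt0.
have -> : eps' = eps * t by rewrite /eps divfK// gt_eqF.
pose A := [set s | 0 <= s <= t /\ `|S s f - f| <= eps * s].
have A0 : A 0 by split; [rewrite lexx ltW|rewrite S0 subrr normr0 mulr0].
have hsA : has_sup A by split; [exists 0|exists t => s [/andP[]]].
pose m := sup A.
have m0 : 0 <= m by apply: sup_upper_bound.
have mt : m <= t by apply: ge_sup; [exists 0|move=> s [/andP[]]].
have Am : `|S m f - f| <= eps * m.
  move: m0; rewrite le_eqVlt => /predU1P[<-|m0]; first by rewrite S0 subrr normr0 mulr0.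
  apply/ler_addgt0Pr => r r0.
  have r20 : 0 < r / 2 by rewrite divr_gt0.
  have /cvgrPdist_le/(_ _ r20)[d /= d0 dS] := Sc m m0.
  have [s [/andP[s0 st] As] ms] := sup_adherent d0 hsA.
  have sm : s <= m by apply: sup_upper_bound => //; split => //; rewrite s0.
  have h : `|S m f - S s f| <= r / 2.
    by apply: dS; rewrite /= ger0_norm ?subr_ge0// /m; lra.
  have -> : S m f - f = (S m f - S s f) + (S s f - f) by rewrite addrA subrK.
  apply: le_trans (ler_normD _ _) _.
  have : eps * s <= eps * m by rewrite ler_pM2l.
  lra.
move: mt; rewrite le_eqVlt => /predU1P[<-//|mt].
have [d d0 dS] := rd m m0 _ eps0.
pose h := Num.min (d / 2) (t - m).
have h0 : 0 < h by rewrite lt_min divr_gt0// subr_gt0.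
have hd : h < d by rewrite gt_min; apply/orP; left; lra.
have hm : m + h <= t.
  have : h <= t - m by rewrite ge_min lexx orbT.
  lra.
suff : A (m + h) by move=> /(sup_upper_bound hsA); rewrite -/m; lra.
split; first by rewrite hm addr_ge0// ltW.
have -> : S (m + h) f - f = (S (m + h) f - S m f) + (S m f - f) by rewrite addrA subrK.
by apply: le_trans (ler_normD _ _) _; have := dS _ h0 hd; lra.
Qed.

Lemma is_derive_expRZ (nu x : R) : is_derive x 1 (fun t => expR (nu * t)) (nu * expR (nu * x)).
Proof.
have dl : is_derive x 1 (fun t => nu * t) nu.
  have := @is_deriveZ R R R id nu x 1 1 (is_derive_id x 1).
  by rewrite [X in is_derive _ _ _ X]mulr1.
by rewrite mulrC; exact: (is_derive1_comp (is_derive_expR (nu * x)) dl).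
Qed.

Lemma expR_cvg1 (nu : R) : expR (- nu * t) @[t --> 0^'+] --> (1 : R).
Proof.
apply: cvg_at_right_filter.
have := is_derive_expRZ (- nu) 0; rewrite mulr0 expR0 mulr1 => -[/derivable1_diffP].
move=> /differentiable_continuous h _.
have E : expR (- nu * 0) = 1 by rewrite mulr0 expR0.
by rewrite -[X in _ --> X]E; exact: h.
Qed.

Lemma C0_semigroup_rescale S nu : C0_semigroup S ->
  C0_semigroup (fun t f => expR (- nu * t) *: S t f).
Proof.
move=> [Slin Scont S0 SD Sright]; split.
- by move=> t t0 r f g; rewrite Slin// scalerDr !scalerA mulrC.
- by move=> t t0 f; apply: cvgZr; exact: Scont.
- by move=> f; rewrite mulr0 expR0 scale1r S0.
- move=> s t s0 t0 f; rewrite SD// mulrDr expRD.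
  have := Slin s s0 (expR (- nu * t)) (S t f) 0; rewrite !addr0.
  have := Slin s s0 (-1) 0 0; rewrite scaleN1r oppr0 addr0 scaleN1r addNr => ->.
  by rewrite addr0 => ->; rewrite scalerA.
- move=> f; rewrite -[X in _ --> X]scale1r.
  by apply: cvgZ; [exact: expR_cvg1|exact: Sright].
Qed.

(** The rescaled semigroup exp (- nu t) S t has derivative zero at f, so that its orbit is
    constant (C0_semigroup_fixed). *)
Lemma C0_semigroup_eigenvector S f nu : C0_semigroup S ->
  t^-1 *: (S t f - f) @[t --> 0^'+] --> nu *: f ->
  forall t, 0 <= t -> S t f = expR (nu * t) *: f.
Proof.
move=> CS df t t0; have CT := C0_semigroup_rescale nu CS.
suff /(C0_semigroup_fixed CT)/(_ _ t0) : h^-1 *: (expR (- nu * h) *: S h f - f) @[h --> 0^'+] --> 0.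
  move=> h; rewrite -[f in RHS]h scalerA -expRD mulNr subrr expR0 scale1r //.
have -> : (0 : V) = 1 *: (nu *: f) - nu *: f by rewrite scale1r subrr.
have eE : (fun h => h^-1 *: (expR (- nu * h) *: S h f - f)) =
    (fun h => expR (- nu * h) *: (h^-1 *: (S h f - f)) + (h^-1 * (expR (- nu * h) - 1)) *: f).
  apply/funext => h; rewrite scalerA (mulrC (expR _)) -!scalerA -scalerDr; congr (_ *: _).
  by rewrite scalerBr scalerBl scale1r addrA subrK.
rewrite eE -scaleNr; apply: cvgD; first exact: (cvgZ (expR_cvg1 nu) df).
apply: cvgZ; last exact: cvg_cst.
have [dE vE] := is_derive_expRZ (- nu) 0.
have : h^-1 *: (((fun t => expR (- nu * t)) \o shift 0) (h *: 1) - expR (- nu * 0)) @[h --> 0^'] --> - nu.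
  by move: dE => /cvg_toP; apply; rewrite -[LHS]/('D_1 (fun t => expR (- nu * t)) 0) vE mulr0 expR0 mulr1.
have -> : (fun h => h^-1 *: (((fun t => expR (- nu * t)) \o shift 0) (h *: 1) - expR (- nu * 0))) =
    (fun h => h^-1 * (expR (- nu * h) - 1)).
  by apply/funext => h; rewrite /= addr0 mulr0 expR0 -[h *: 1]/(h * 1) mulr1.
exact: cvg_dnbhs_at_right.
Qed.

End semigroup.

(** Both sides are continuous in f and agree on the basis, whose span is dense. *)
Lemma inner_semigroup (R : realType) (S : R -> L2 R -> L2 R) (e : nat -> L2 R) (nu : nat -> R) :
  hilbert_basis e -> C0_semigroup S ->
  (forall n t, 0 <= t -> S t (e n) = expR (nu n * t) *: e n) ->
  forall n t f, 0 <= t -> inner (S t f) (e n) = expR (nu n * t) * inner f (e n).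
Proof.
move=> be [Slin Scont S0 SD Sright] Se n t f t0.
have : closure [set g | exists n (x : 'I_n -> R), g = \sum_(i < n) x i *: e i] f.
  by case: be => _ ->.
have c1 (g : L2 R) : inner (S t x) (e n) @[x --> g] --> inner (S t g) (e n).
  exact: (inner_cvg (g := e n) (Scont t t0 g)).
have c2 (g : L2 R) : inner x (e n) @[x --> g] --> inner g (e n).
  by apply: (@inner_cvg R _ (nbhs g) _ id); exact: cvg_id.
have cD (g : L2 R) : inner (S t x) (e n) - expR (nu n * t) * inner x (e n) @[x --> g] -->
    inner (S t g) (e n) - expR (nu n * t) * inner g (e n).
  exact: (cvgB (c1 g) (cvgM (cvg_cst _) (c2 g))).
move=> clf; apply/eqP; rewrite -subr_eq0; apply/negP => /negP D0; move: clf.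
have : \forall g \near (f : L2 R), inner (S t g) (e n) - expR (nu n * t) * inner g (e n) != 0.
  exact: (cD f _ (open_nbhs_nbhs (conj (@open_neq R 0) D0))).
move=> /[swap] clf /clf[_ [[m [x ->]] /eqP]]; apply.
have SZ r g : S t (r *: g) = r *: S t g.
  have := Slin t t0 r g 0; rewrite addr0.
  have := Slin t t0 (-1) 0 0; rewrite scaleN1r oppr0 addr0 scaleN1r addNr => ->.
  by rewrite addr0.
have SDD g h : S t (g + h) = S t g + S t h by have := Slin t t0 1 g h; rewrite !scale1r.
have S00 : S t 0 = 0 by have := SZ 0 0; rewrite !scale0r.
rewrite (big_morph _ SDD S00) !inner_suml mulr_sumr -sumrB big1// => i _.
rewrite SZ Se// !innerZl (inner_basis be) mulrCA.
by have [->|_] := eqVneq (i : nat) n; rewrite ?subrr// !mulr0 subrr.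
Qed.

(** * Bochner integrals tested against a vector *)

(** The integral of a nonnegative function is a supremum over simple functions
    below it, so that monotonicity needs no measurability; the norm of a Bochner
    measurable function need not be Borel measurable. *)
Lemma ge0_le_lower_integral d (T : measurableType d) (R : realType)
    (mu : {measure set T -> \bar R}) (D1 D2 : set T) (f1 f2 : T -> \bar R) :
  D1 `<=` D2 -> (forall x, D1 x -> (0 <= f1 x <= f2 x)%E) -> (forall x, D2 x -> (0 <= f2 x)%E) ->
  (\int[mu]_(x in D1) f1 x <= \int[mu]_(x in D2) f2 x)%E.
Proof.
move=> D12 f12 f20; rewrite (integral_mkcond D1) (integral_mkcond D2).
have h1 x : (0 <= (f1 \_ D1) x)%E by rewrite patchE; case: ifPn; rewrite ?inE // => /f12/andP[].
have h2 x : (0 <= (f2 \_ D2) x)%E by rewrite patchE; case: ifPn; rewrite ?inE // => /f20.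
rewrite !ge0_integralTE//; apply: le_ereal_sup => _ [h hf1 <-]; exists h => // x.
apply: le_trans (hf1 x) _; rewrite [leLHS]patchE; case: ifPn; rewrite ?inE // => D1x.
by rewrite patchE mem_set; [have /andP[] := f12 _ D1x|exact: D12].
Qed.

Section bochner.
Variable R : realType.
Local Notation lambda := (@lebesgue_measure R).
Implicit Types (D : set (measurableTypeR R)) (f s : R -> L2 R) (g v : L2 R).

Lemma has_int_integrable D (h : R -> R) w : measurable D -> measurable_fun D h ->
  has_int D h w -> lambda.-integrable D (EFin \o h) /\ \int[lambda]_(t in D) h t = w.
Proof.
move=> mD mh [h' hi [hh' <-]].
have mh' := measurable_int _ hi.
have mEh : measurable_fun D (EFin \o h) by exact/measurable_EFinP.
have ae_ : ae_eq lambda D (EFin \o h) (EFin \o h').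
  by apply: filterS hh' => x /= e Dx; rewrite e.
split; last by rewrite /Rintegral (ae_eq_integral _ _ mD mEh mh' ae_).
move/integrableP : hi => [_ hoo]; apply/integrableP; split => //.
apply: le_lt_trans hoo; rewrite le_eqVlt; apply/orP; left; apply/eqP.
apply: ae_eq_integral => //; [exact: measurableT_comp|exact: measurableT_comp|].
by apply: filterS ae_ => x e Dx /=; have /= [->] := e Dx.
Qed.

Lemma simple_map_inner s g D : measurable D -> (lambda D < +oo)%E -> simple_map s ->
  exists q : R -> R, [/\ forall x, q x = inner (s x) g,
    measurable_fun (setT : set (measurableTypeR R)) q &
    has_int D q (inner (simple_integral D s) g)].
Proof.
move=> mD Dfin [fs ms].
pose A : seq (L2 R) := finmap.enum_fset (fset_set (range s)).
pose q x := \sum_(v <- A) inner v g * \1_(s @^-1` [set v]) x.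
exists q; split.
- move=> x; have xA : s x \in A by rewrite in_fset_set// inE; exists x.
  have E v : \1_(s @^-1` [set v]) x = (s x == v)%:R :> R.
    by rewrite indicE; congr (nat_of_bool _)%:R; apply/idP/eqP; rewrite inE.
  rewrite /q (bigD1_seq (s x))//=; last exact: finmap.fset_uniq.
  rewrite E eqxx mulr1 big1 ?addr0// => v vx.
  by rewrite E eq_sym (negbTE vx) mulr0.
- apply: measurable_sum => v; apply: measurable_funM => //.
  by apply: measurable_indic; exact: ms.
rewrite /simple_integral (fsbig_finite _ _ fs) inner_suml.
apply: has_int_sum => // v; rewrite innerZl mulrC; apply: has_intZ => //.
have mv : measurable (s @^-1` [set v] : set (measurableTypeR R)) := ms v.
have -> : fine (lambda (D `&` s @^-1` [set v])) = \int[lambda]_(x in D) \1_(s @^-1` [set v]) x.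
  by rewrite /Rintegral integral_indic// setIC.
apply: integrable_has_int; apply: measurable_bounded_integrable => //.
exists 1; split; first exact: num_real.
move=> M M1 x _ /=; apply: le_trans (ltW M1).
by rewrite indicE ger0_norm//; case: (_ \in _).
Qed.

(** The inner products of the approximating simple maps with g are real simple
    functions that converge to <f, g> in L^1. *)
Lemma bochner_has_int D f v g : measurable D -> (lambda D < +oo)%E ->
  bochner_integral D f v -> has_int D (fun t => inner (f t) g) (inner v g).
Proof.
move=> mD Dfin [s [ss [N [mN N0 sN]] fs0 sv]].
have /choice[q qP] n := simple_map_inner g mD Dfin (ss n).
pose E := D `\` N; have mE : measurable E by exact: measurableD.
have ED : E `<=` D by move=> x [].
pose k t := inner (f t) g.
have qk t : E t -> q n t @[n --> \oo] --> k t.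
  move=> [Dt Nt]; have : s n t @[n --> \oo] --> f t.
    by move: Dt; apply: contrapT => h; apply: Nt; apply: sN => h'; apply: h.
  move=> /(inner_cvg (g := g)); apply: cvg_trans; apply: near_eq_cvg; apply: nearW => n.
  by have [-> _ _] := qP n.
have mk : measurable_fun E k.
  apply: (measurable_fun_cvg (h := q)) => // n.
  by apply: measurable_funTS; have [] := qP n.
have mq n : measurable_fun E (q n) by apply: measurable_funTS; have [] := qP n.
pose B := `|g| + 1.
have B0 : 0 < B by rewrite ltr_wpDl.
pose d n := (\int[lambda]_(t in E) `|(k t - q n t)%:E|)%E.
have dle n : (d n <= B%:E * \int[lambda]_(t in D) (`|f t - s n t|)%:E)%E.
  rewrite -lee_pdivrMl// -ge0_integralZl//; last 2 first.
  - by apply/measurableT_comp => //; apply/measurable_EFinP/measurable_funB.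
  - by rewrite lee_fin invr_ge0 ltW.
  apply: ge0_le_lower_integral => // x Ex; rewrite -EFinM lee_fin mulr_ge0 ?invr_ge0 ?(ltW B0)//=.
  rewrite lee_fin ler_pdivrMl// mulrC; have [-> _ _] := qP n; rewrite /k -innerBl.
  apply: le_trans (norm_inner_le _ _) _; by rewrite ler_wpM2l// lerDl.
have d0 : d n @[n --> \oo] --> 0%E.
  have h : (B%:E * \int[lambda]_(t in D) (`|f t - s n t|)%:E)%E @[n --> \oo] --> 0%E.
    by rewrite -[X in _ --> X](mule0 B%:E); apply: cvgeZl.
  apply: (squeeze_cvge _ (cvg_cst _) h).
  by apply: nearW => n; rewrite dle andbT integral_ge0.
have qi n : lambda.-integrable E (EFin \o q n).
  have [_ mqn qint] := qP n.
  by apply: integrableS (has_int_integrable mD (measurable_funTS mqn) qint).1.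
have ki : lambda.-integrable E (EFin \o k).
  have /fine_cvgP[[n _ /(_ n (leqnn n)) dn] _] := d0.
  have kqi : lambda.-integrable E (EFin \o (fun t => k t - q n t)).
    apply/integrableP; split; first by apply/measurable_EFinP/measurable_funB.
    by rewrite -ge0_fin_numE// integral_ge0.
  have := integrableD mE kqi (qi n); apply: eq_integrable => // t _ /=.
  by rewrite -EFinD subrK.
have hE h w : lambda.-integrable E (EFin \o h) -> \int[lambda]_(t in E) h t = w -> has_int D h w.
  move=> hi hw; exists (h \_ E).
    rewrite -restrict_EFin; apply/integrable_restrict => //.
    by rewrite setIC setIidl.
  split.
    exists N; split => // t /= /not_implyP[Dt hnE]; apply: contrapT => Nt; apply: hnE.
    by rewrite patchE mem_set.
  rewrite -hw Rintegral_mkcond [RHS]Rintegral_mkcond; apply: eq_Rintegral => t _.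
  rewrite [LHS]patchE; case: ifPn => // /negP tD; rewrite patchE memNset// => /ED tD'.
  by apply: tD; rewrite inE.
pose w := \int[lambda]_(t in E) k t.
suff -> : inner v g = w by apply: hE.
have wq n : `|w - inner (simple_integral D (s n)) g| <= fine (d n).
  have [_ mqn qint] := qP n.
  rewrite -(has_int_uniq mD (hE _ _ (qi n) erefl) qint).
  rewrite /w -RintegralB//; apply: le_trans (le_normr_Rintegral _ _) _ => //.
  exact: (integrableB mE ki (qi n)).
have c1 : inner (simple_integral D (s n)) g @[n --> \oo] --> inner v g.
  exact: (inner_cvg (g := g) sv).
have c2 : inner (simple_integral D (s n)) g @[n --> \oo] --> w.
  apply/cvgrPdist_le => eps eps0.
  have /fine_cvgP[_ /cvgrPdist_le/(_ _ eps0)] := d0.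
  apply: filterS => n; rewrite sub0r normrN => h.
  by apply: le_trans (wq n) _; apply: le_trans (ler_norm _) h.
exact: (cvg_unique _ c1 c2).
Qed.

End bochner.

(** * The operator A on the range of the lifting *)

#[global] Instance ae_mu01_filter (R : realType) : Filter (almost_everywhere (@mu01 R)).
Proof. exact: ae_filter_ringOfSetsType. Qed.

Section lifting.
Variable R : realType.
Local Notation lambda := (@lebesgue_measure R).
Implicit Types (th : R) (u : 'cV[R]_2).

Lemma ae_mu01_itv : {ae (@mu01 R), forall x : R, 0 < x < 1}.
Proof.
exists (~` `]0, 1[%classic); split.
- by apply: measurableC; exact: measurable_itv.
- rewrite /= /mrestr; apply: countable_lebesgue_measure0.
  apply: (@sub_countable _ _ _ ([set 0; 1] : set R)); last first.
    by apply: finite_set_countable; apply: finite_set2.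
  apply: subset_card_le => x [/=]; rewrite !in_itv/= => h /andP[x0 x1].
  have [->|x0'] := eqVneq x 0; first by left.
  right; apply/eqP; rewrite eq_le x1/= leNgt; apply/negP => x1'; apply: h.
  by rewrite lt_neqAle eq_sym x0' x0.
- by move=> x /= h; rewrite in_itv.
Qed.

Lemma ae_mu01_dense (P : R -> Prop) : {ae (@mu01 R), forall x, P x} ->
  forall x d, 0 < x < 1 -> 0 < d -> exists2 y, `|x - y| < d & P y.
Proof.
move=> [N [mN N0 sN]] x d /andP[x0 x1] d0; apply: contrapT => h.
pose r := Num.min d (Num.min x (1 - x)).
have r0 : 0 < r by rewrite !lt_min d0 x0 subr_gt0.
have rd : r <= d by rewrite ge_min lexx.
have rx : r <= x by rewrite !ge_min lexx !orbT.
have r1 : r <= 1 - x by rewrite !ge_min lexx !orbT.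
pose I : set R := `]x - r, x + r[%classic.
have sub : I `<=` N `&` `[0, 1].
  move=> y; rewrite /I /=; rewrite !in_itv/= => /andP[y1 y2]; split; last by apply/andP; split; lra.
  apply: sN => /= Py; apply: h; exists y => //.
  by rewrite ltr_norml; apply/andP; split; lra.
have : (lambda I <= 0)%E.
  rewrite -N0 /mu01 /= /mrestr; apply: le_measure => //; rewrite inE.
    exact: measurable_itv.
  by apply: measurableI => //; exact: measurable_itv.
rewrite /I lebesgue_measure_itv/= lte_fin; case: ifP => [_|/negbT].
  by rewrite -EFinB lee_fin => h'; clear N0; lra.
by rewrite -leNgt => h' _; clear N0; lra.
Qed.

(** Two differentiable representatives agree on a dense set, hence on the open
    interval, and so do their derivatives. The operator, defined by a choice of
    representatives, is therefore determined. *)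
Lemma H2_rep_uniq f v v1 w v' v1' w' : @H2_rep R f v v1 w -> H2_rep f v' v1' w' -> w = w'.
Proof.
move=> [fv _ _ dv dv1] [fv' _ _ dv' dv1'].
have vv (x : R) : 0 < x < 1 -> v x = v' x.
  move=> x01; apply/eqP; rewrite -subr_eq0; apply/negP => /negP h.
  have x01' : x \in `]0, 1[ by rewrite in_itv.
  have c : {for x, continuous (fun y => v y - v' y)}.
    by apply: cvgB; apply/differentiable_continuous/derivable1_diffP;
      [have [] := dv x x01'|have [] := dv' x x01'].
  have : \forall y \near x, v y - v' y != 0.
    exact: (c _ (open_nbhs_nbhs (conj (@open_neq R 0) h))).
  move=> /nbhs_ballP[d /= d0 dP].
  have aee : {ae (@mu01 R), forall x, v x - v' x = 0}.
    by apply: filterS2 fv fv' => y -> ->; rewrite subrr.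
  have [y xy yE] := ae_mu01_dense aee x01 d0.
  by have := dP y xy; rewrite /= yE eqxx.
have near01 (x : R) : 0 < x < 1 -> \forall y \near x, 0 < y < 1.
  move=> x01; have : x \in `]0, 1[ by rewrite in_itv.
  by move/near_in_itvoo; apply: filterS => y; rewrite in_itv.
have vv1 (x : R) : 0 < x < 1 -> v1 x = v1' x.
  move=> x01; have x01' : x \in `]0, 1[ by rewrite in_itv.
  have [_ <-] := dv x x01'; have [_ <-] := dv' x x01'.
  by apply: near_eq_derive; apply: filterS (near01 x x01) => y /vv.
rewrite -[w]ofL2K -[w']ofL2K; apply/toL2_eq.
apply: filterS3 ae_mu01_itv dv1 dv1' => x x01 [_ <-] [_ <-].
by apply: near_eq_derive; apply: filterS (near01 x x01) => y /vv1.
Qed.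

Lemma abs_cont_C1 (F f : R -> R) : (forall x : R, is_derive x 1 F (f x)) -> continuous f ->
  abs_cont_on 0 1 F.
Proof.
move=> dF cf eps eps0.
have [|M [_ HM]] := @compact_bounded _ _ (f @` `[0, 1]).
  by apply: continuous_compact; [exact: continuous_subspaceT|exact: segment_compact].
pose B := `|M| + 1; have B0 : 0 < B by rewrite ltr_wpDl.
have fB x : 0 <= x <= 1 -> `|f x| <= B.
  by move=> x01; apply: HM; [rewrite ltr_pwDr// ler_norm|exists x].
exists (eps / B) => [|n s t st dis sd]; first by rewrite divr_gt0.
have le i : `|F (t i) - F (s i)| <= B * (t i - s i).
  have [s0 [le_st t1]] := st i.
  have [c cst ->] := @MVT_segment _ F f (s i) (t i) le_st (fun x _ => dF x)
    (derivable_within_continuous (fun x _ => @ex_derive _ _ _ _ _ _ _ (dF x))).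
  rewrite normrM (ger0_norm (_ : 0 <= t i - s i)) ?subr_ge0//.
  rewrite ler_wpM2r ?subr_ge0// fB//.
  by move: cst; rewrite in_itv/= => /andP[sc ct]; rewrite (le_trans s0)// (le_trans ct).
apply: le_lt_trans (_ : \sum_(i < n) B * (t i - s i) < _); first exact: ler_sum.
by rewrite -mulr_sumr mulrC -ltr_pdivlMr.
Qed.

(** The derivative of a lifting is again a lifting, of degree one less and with
    the angles 0, for which the denominators of lift_fun are 1. *)
Definition lift_deriv th1 th2 (k : nat) u : 'cV[R]_2 := \col_(m < 2)
  if m == 0 then - k%:R * u 0 0 / (cos th1 + k%:R * sin th1)
  else k%:R * u 1 0 / (cos th2 + k%:R * sin th2).

Lemma is_derive_lift_fun th1 th2 k u (x : R) :
  is_derive x 1 (lift_fun th1 th2 k.+1 u) (lift_fun 0 0 k (lift_deriv th1 th2 k.+1 u) x).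
Proof.
rewrite /lift_fun !mxE/= cos0 sin0 mulr0 addr0 !divr1.
set d1 := cos th1 + _; set d2 := cos th2 + _.
have h1 : is_derive x 1 (fun y : R => 1 - y) (-1).
  by have := is_deriveB (is_derive_cst (1 : R) x 1) (is_derive_id x 1); rewrite sub0r.
have h2 : is_derive x 1 (fun y : R => (1 - y) ^+ k.+1) (k.+1%:R * (1 - x) ^+ k * (-1)).
  have h3 : is_derive (1 - x) 1 (fun y : R => y ^+ k.+1) (k.+1%:R * (1 - x) ^+ k).
    by split; [exact: exprn_derivable|rewrite exp_derive /= [LHS]mulr1].
  exact: (@is_derive1_comp R (fun y => y ^+ k.+1) (fun y => 1 - y) x _ _ h3 h1).
have h4 : is_derive x 1 (fun y : R => y ^+ k.+1) (k.+1%:R * x ^+ k).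
  by split; [exact: exprn_derivable|rewrite exp_derive /= [LHS]mulr1].
have := is_deriveD (is_deriveZ (u 0 0 / d1) h2) (is_deriveZ (u 1 0 / d2) h4).
set E := (X in is_derive x 1 X _ -> _).
rewrite [X in is_derive _ _ X _](_ : E = (fun y => u 0 0 * (1 - y) ^+ k.+1 / d1 + u 1 0 * y ^+ k.+1 / d2)).
  move=> h; apply: (is_derive_eq h).
  by rewrite /GRing.scale/=; ring.
apply/funext => y; rewrite /E.
rewrite -[LHS]/(u 0 0 / d1 * (1 - y) ^+ k.+1 + u 1 0 / d2 * y ^+ k.+1).
ring.
Qed.

Lemma continuous_lift_fun th1 th2 k u : continuous (lift_fun th1 th2 k u).
Proof.
case: k => [|k].
  have -> : lift_fun th1 th2 0 u = cst (lift_fun th1 th2 0 u 0).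
    by apply/funext => x; rewrite /lift_fun !expr0.
  by move=> x; exact: cvg_cst.
move=> x; apply/differentiable_continuous/derivable1_diffP.
by have [] := is_derive_lift_fun th1 th2 k u x.
Qed.

Lemma H2_rep_lifting th1 th2 k u : H2_rep (lifting th1 th2 k.+2 u) (lift_fun th1 th2 k.+2 u)
  (lift_fun 0 0 k.+1 (lift_deriv th1 th2 k.+2 u))
  (lifting 0 0 k (lift_deriv 0 0 k.+1 (lift_deriv th1 th2 k.+2 u))).
Proof.
split.
- exact: toL2K.
- by apply: abs_cont_C1 => x; [exact: is_derive_lift_fun|exact: continuous_lift_fun].
- by apply: abs_cont_C1 => x; [exact: is_derive_lift_fun|exact: continuous_lift_fun].
- by move=> x _; exact: is_derive_lift_fun.
- have := toL2K (Lfun_Sub (lee1n 2) (lift_fun_Lfun 0 0 k (lift_deriv 0 0 k.+1 (lift_deriv th1 th2 k.+2 u)))).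
  by apply: filterS => x; rewrite /lifting => ->; exact: is_derive_lift_fun.
Qed.

Lemma liftingE th1 th2 k u : lifting th1 th2 k u =
  u 0 0 *: lifting th1 th2 k (delta_mx 0 0) + u 1 0 *: lifting th1 th2 k (delta_mx 1 0).
Proof.
rewrite /lifting -![_ *: toL2 _]/(scaleL2 _ _) -!toL2Z -toL2D.
apply/toL2_eq; apply: nearW => x.
rewrite -[RHS]/(u 0 0 * lift_fun th1 th2 k (delta_mx 0 0) x + u 1 0 * lift_fun th1 th2 k (delta_mx 1 0) x).
by rewrite -[LHS]/(lift_fun th1 th2 k u x) /lift_fun !mxE/=; ring.
Qed.

Lemma opA_liftingE a b th1 th2 k u : opA a b (lifting th1 th2 k.+2 u) =
  a *: lifting 0 0 k (lift_deriv 0 0 k.+1 (lift_deriv th1 th2 k.+2 u)) + b *: lifting th1 th2 k.+2 u.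
Proof.
rewrite /opA; case: xgetP => [g _ [v [v1 [w [fw ->]]]]|].
  by rewrite (H2_rep_uniq fw (H2_rep_lifting th1 th2 k u)).
by move=> /(_ (a *: lifting 0 0 k (lift_deriv 0 0 k.+1 (lift_deriv th1 th2 k.+2 u)) +
   b *: lifting th1 th2 k.+2 u)) []; do 3!eexists; split => //; exact: H2_rep_lifting.
Qed.

Lemma opA_lifting a b th1 th2 k u : (2 <= k)%N -> opA a b (lifting th1 th2 k u) =
  u 0 0 *: opA a b (lifting th1 th2 k (delta_mx 0 0)) +
  u 1 0 *: opA a b (lifting th1 th2 k (delta_mx 1 0)).
Proof.
case: k => [|[|k]]// _; rewrite !opA_liftingE.
set D2 := fun u => lift_deriv 0 0 k.+1 (lift_deriv th1 th2 k.+2 u).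
have D20 w : D2 w 0 0 = D2 (delta_mx 0 0) 0 0 * w 0 0.
  by rewrite /D2 !mxE/=; ring.
have D21 w : D2 w 1 0 = D2 (delta_mx 1 0) 1 0 * w 1 0.
  by rewrite /D2 !mxE/=; ring.
rewrite (liftingE th1 th2 k.+2 u) -!/(D2 _) !(liftingE 0 0 k (D2 _)).
rewrite (D20 u) (D21 u) (D20 (delta_mx 1 0)) (D21 (delta_mx 0 0)) !mxE/=.
rewrite !mulr0 !scale0r addr0 add0r !scalerDr !scalerA.
rewrite [LHS]addrACA; congr (_ *: _ + _ *: _ + (_ *: _ + _ *: _)); ring.
Qed.

End lifting.

(** * The modes of a mild solution *)

Section modes.
Variable R : realType.
Local Notation lambda := (@lebesgue_measure R).

Lemma within_continuous_inner (A : set R) (X : R -> L2 R) g :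
  {within A, continuous X} -> {within A, continuous (fun s => inner (X s) g)}.
Proof.
move=> /subspace_continuousP cX; apply/subspace_continuousP => x Ax.
exact: (inner_cvg (g := g) (cX x Ax)).
Qed.

Lemma ACloc_entry (u : R -> 'cV[R]_2) i T : 0 <= T -> ACloc u -> abs_cont_on 0 T (fun s => u s i 0).
Proof.
move=> T0 acu eps eps0; have [d d0 du] := acu 0 T (lexx 0) T0 eps eps0.
exists d => // n s t st dis sd; apply: le_lt_trans (du n s t st dis sd).
apply: ler_sum => j _; rewrite -[X in `|X|](_ : (u (t j) - u (s j)) i 0 = _); last by rewrite !mxE.
by rewrite [leRHS]/Num.norm /= mx_normrE; apply: le_bigmax (i, 0).
Qed.

Lemma abs_cont_continuous a b (F : R -> R) : abs_cont_on a b F -> {within `[a, b], continuous F}.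
Proof.
move=> acF; apply/subspace_continuousP => x; rewrite /= in_itv/= => xab.
apply/cvgrPdist_lt => eps eps0; have [d d0 dF] := abs_cont_dist acF eps0.
exists d => //= y xy; rewrite in_itv/= => yab; exact: dF.
Qed.

Lemma ACloc_derive1 (u : R -> 'cV[R]_2) i t : ACloc u -> 0 <= t ->
  has_int `[0, t] (derive1 (fun s => u s i 0)) (u t i 0 - u 0 i 0).
Proof.
move=> acu; rewrite le_eqVlt => /predU1P[<-|t0].
  by rewrite subrr; exact: has_int_itvxx.
by apply: (abs_cont_ftc t0 (ACloc_entry i (ltW t0) acu)); rewrite lexx ltW.
Qed.

Variables (a b c th1 th2 : R) (k : nat) (S : R -> L2 R -> L2 R) (e : L2 R) (nu hM : R).
Variables (h : R -> R) (Phi p X : R -> L2 R) (u : R -> 'cV[R]_2).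
Hypothesis k2 : (2 <= k)%N.
Hypothesis hM0 : 0 <= hM.
Hypothesis Se : forall t f, 0 <= t -> inner (S t f) e = expR (nu * t) * inner f e.
Hypothesis acu : ACloc u.
Hypothesis mildX : mild_solution a b c th1 th2 k S hM h Phi p u X.

Local Notation Lf m := (lifting th1 th2 k (delta_mx m 0)).

(** The lifting disappears: integrating by parts the term in u' turns the mild
    solution into a weak solution of the scalar equation
    z' = nu z + beta u + c z(s - h) + d, with beta the coefficient of the
    control. This needs that u is the integral of its derivative. *)
Lemma mode_weak (psi psi' : R -> R) (T : R) : 0 <= T ->
  (forall x : R, is_derive x 1 psi (psi' x)) -> continuous psi' ->
  let z s := inner (X s) e in
  let beta m := - nu * inner (Lf m) e + inner (opA a b (Lf m)) e in
  has_int `[0, T] (fun s => psi' s * z s + psi s * (nu * z s +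
      (beta 0 * u s 0 0 + beta 1 * u s 1 0) + c * z (s - h s) + inner (p s) e))
    (psi T * z T - psi 0 * z 0).
Proof.
move=> T0 dpsi cpsi' z beta.
have [X0 cX Xt] := mildX.
have {}X0 : X 0 = Phi 0 by apply: X0; rewrite in_itv/= lexx oppr_le0 hM0.
pose l s := inner (lifting th1 th2 k (u s)) e.
have lE s : l s = inner (Lf 0) e * u s 0 0 + inner (Lf 1) e * u s 1 0.
  by rewrite /l liftingE innerDl !innerZl !(mulrC (u s _ _)).
pose al s := inner (opA a b (lifting th1 th2 k (u s))) e.
have alE s : al s = inner (opA a b (Lf 0)) e * u s 0 0 + inner (opA a b (Lf 1)) e * u s 1 0.
  by rewrite /al opA_lifting// innerDl !innerZl !(mulrC (u s _ _)).
pose du i : R -> R := derive1 (fun s : R => u s i 0).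
pose g s := al s - (inner (Lf 0) e * du 0 s + inner (Lf 1) e * du 1 s) + c * z (s - h s) + inner (p s) e.
have mitv t := @mset_itv R `[0, t].
pose zeta t := expR (- nu * t) * (z t - l t).
have zeta_int t : 0 <= t <= T -> has_int `[0, t] (fun s => expR (- nu * s) * g s) (zeta t - zeta 0).
  move=> /andP[t0 tT]; have [v vint Xv] := Xt t t0.
  have tfin : (lambda `[0%R, t]%classic < +oo)%E.
    by rewrite lebesgue_measure_itv/= lte_fin; case: ifP => _; rewrite ?ltry// -EFinB ltry.
  have := has_intZ (expR (- nu * t)) (mitv t) (bochner_has_int e (mitv t) tfin vint).
  have -> : expR (- nu * t) * inner v e = zeta t - zeta 0.
    have zt : z t = expR (nu * t) * (z 0 - l 0) + l t + inner v e.
      by rewrite /z Xv X0 !innerDl Se// innerBl.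
    rewrite /zeta mulr0 expR0 mul1r zt.
    have E : expR (- nu * t) * expR (nu * t) = 1 by rewrite -expRD mulNr addNr expR0.
    have -> : inner v e = (z t - l t) - expR (nu * t) * (z 0 - l 0) by rewrite zt; ring.
    by rewrite zt mulrBr mulrA E; ring.
  apply: eq_has_int => s /=; rewrite in_itv/= => /andP[s0 st].
  rewrite Se ?subr_ge0// mulrA -expRD.
  have -> : - nu * t + nu * (t - s) = - nu * s by ring.
  congr (_ * _); rewrite !innerDl innerNl innerZl /g -/(al s); congr (_ - _ + _ + _).
  by rewrite (liftingE _ _ _ (deriv_cV u s)) innerDl !innerZl !mxE /du [LHS]addrC addrC; congr (_ + _); exact: mulrC.
have cz : {within `[0, T], continuous z}.
  apply: within_continuous_inner; apply: continuous_subspaceW cX.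
  by move=> x /=; rewrite !in_itv/= => /andP[->].
have cu i : {within `[0, T], continuous (fun s => u s i 0)}.
  by apply: abs_cont_continuous; exact: ACloc_entry.
have dexp (m x : R) : is_derive x 1 (fun t : R => expR (m * t)) (m * expR (m * x)) := is_derive_expRZ m x.
have cexp (m : R) : continuous (fun t : R => expR (m * t)).
  by move=> x; apply/differentiable_continuous/derivable1_diffP; have [] := dexp m x.
have cpsi : continuous psi.
  by move=> x; apply/differentiable_continuous/derivable1_diffP; have [] := dpsi x.
have cl : {within `[0, T], continuous l}.
  have -> : l = fun s => inner (Lf 0) e * u s 0 0 + inner (Lf 1) e * u s 1 0 by apply/funext.
  move=> x; apply: cvgD.
    by apply: cvgM; [exact: cvg_cst|exact: (cu 0 x)].
  by apply: cvgM; [exact: cvg_cst|exact: (cu 1 x)].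
have czeta : {within `[0, T], continuous zeta}.
  move=> x; apply: cvgM; first exact: continuous_subspaceT.
  by apply: cvgB; [exact: cz|exact: cl].
have dexppsi (x : R) : is_derive x 1 (fun s => expR (nu * s) * psi s)
    (nu * expR (nu * x) * psi x + expR (nu * x) * psi' x).
  by apply: (is_derive_eq (is_deriveM (dexp nu x) (dpsi x))); rewrite /GRing.scale/=; ring.
have cexppsi : continuous (fun s => nu * expR (nu * s) * psi s + expR (nu * s) * psi' s).
  move=> x; apply: cvgD; apply: cvgM; [|exact: cpsi|exact: cexp|exact: cpsi'].
  by apply: cvgM; [exact: cvg_cst|exact: cexp].
have I1 := has_int_mul_C1 T0 czeta zeta_int dexppsi cexppsi.
have acu' i t : 0 <= t <= T -> has_int `[0, t] (du i) (u t i 0 - u 0 i 0).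
  by move=> /andP[t0 _]; exact: ACloc_derive1.
have I2 i := has_int_mul_C1 T0 (cu i) (acu' i) dpsi cpsi'.
have I3 := has_intD (mitv T) (has_intZ (inner (Lf 0) e) (mitv T) (I2 0)) (has_intZ (inner (Lf 1) e) (mitv T) (I2 1)).
have I4 := has_intD (mitv T) I1 I3.
have EE s : expR (nu * s) * expR (- nu * s) = 1 by rewrite -expRD mulNr addrN expR0.
have zetaE s : expR (nu * s) * zeta s = z s - l s by rewrite /zeta mulrA EE mul1r.
move: I4; set V := (X in has_int _ _ X).
have -> : V = psi T * z T - psi 0 * z 0.
  rewrite /V; have := zetaE T; have := zetaE 0; rewrite !lE mulr0 expR0 !mul1r => -> zT.
  have -> : expR (nu * T) * psi T * zeta T = psi T * (expR (nu * T) * zeta T) by ring.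
  by rewrite zT; ring.
apply: eq_has_int => s _.
have -> : expR (nu * s) * psi s * (expR (- nu * s) * g s) = (expR (nu * s) * expR (- nu * s)) * (psi s * g s) by ring.
have -> : (nu * expR (nu * s) * psi s + expR (nu * s) * psi' s) * zeta s =
   (nu * psi s + psi' s) * (expR (nu * s) * zeta s) by ring.
by rewrite EE zetaE /g alE lE /beta; ring.
Qed.

End modes.

(** * A small-gain argument for delayed inequalities *)

Section small_gain.
Variable R : realType.

(** Since the delayed terms only enter through the supremum M of the weighted
    norm over the past, a gain q < 1 allows M to be absorbed; the supremum over
    [0, T] is attained by continuity, hence finite. *)
Lemma small_gain (T hM kappa q A0 F : R) (N : R -> R) :
  0 <= T -> 0 <= kappa -> 0 <= q < 1 -> 0 <= A0 -> 0 <= F ->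
  (forall s, 0 <= N s) -> {within `[0, T], continuous N} ->
  (forall s, - hM <= s <= 0 -> N s <= F) ->
  (forall M, 0 <= M -> (forall s, - hM <= s <= T -> expR (kappa * s) * N s <= M) ->
     forall t, 0 <= t <= T -> expR (kappa * t) * N t <= A0 + q * M) ->
  forall t, 0 <= t <= T -> expR (kappa * t) * N t <= (A0 + F) / (1 - q).
Proof.
move=> T0 k0 /andP[q0 q1] A00 F0 N0 cN NF step t tT.
have cexp : continuous (fun s : R => expR (kappa * s)).
  move=> x; apply/differentiable_continuous/derivable1_diffP.
  by have [] := is_derive_expRZ kappa x.
have [m mT mmax] : exists2 m, m \in `[0, T] & forall s, s \in `[0, T] ->
    expR (kappa * s) * N s <= expR (kappa * m) * N m.
  apply: (@EVT_max R (fun s => expR (kappa * s) * N s) 0 T T0).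
  by move=> x; apply: cvgM; [exact: continuous_subspaceT|exact: cN].
set Mm := expR (kappa * m) * N m in mmax.
have Mm0 : 0 <= Mm by rewrite mulr_ge0// expR_ge0.
have step' : Mm <= A0 + q * Num.max Mm F.
  apply: step; [by rewrite le_max Mm0| |by rewrite in_itv/= in mT].
  move=> s /andP[s1 s2]; have [s0|/ltW s0] := leP 0 s.
    by rewrite le_max mmax// in_itv/= s0.
  rewrite le_max; apply/orP; right; apply: le_trans (NF s _); last by rewrite s1.
  by rewrite ler_piMl// expR_le1 mulr_ge0_le0.
apply: (@le_trans _ _ Mm); first by apply: mmax; rewrite in_itv.
rewrite ler_pdivlMr ?subr_gt0//.
have : q * Num.max Mm F <= q * Mm + F.
  rewrite /Num.max; case: ifP => _; last by rewrite lerDl.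
  apply: (@le_trans _ _ F); first by rewrite ler_piMl// ltW.
  by rewrite lerDr mulr_ge0.
lra.
Qed.

Lemma has_int_exp_conv (rho kappa t : R) : 0 <= t -> kappa < rho ->
  has_int `[0, t] (fun s => expR (- rho * (t - s)) * expR (- kappa * s))
    ((expR (- kappa * t) - expR (- rho * t)) / (rho - kappa)).
Proof.
move=> t0 kr; have rk : rho - kappa != 0 by rewrite subr_eq0 gt_eqF.
pose E (s : R) := expR (- rho * t) / (rho - kappa) * expR ((rho - kappa) * s).
have -> : (expR (- kappa * t) - expR (- rho * t)) / (rho - kappa) = E t - E 0.
  rewrite /E mulr0 expR0 mulr1 mulrAC -expRD mulrBl; congr (expR _ / _ - _); ring.
have dE (x : R) : is_derive x 1 E (expR (- rho * (t - x)) * expR (- kappa * x)).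
  apply: (is_derive_eq (is_deriveZ (expR (- rho * t) / (rho - kappa)) (is_derive_expRZ (rho - kappa) x))).
  rewrite /GRing.scale/= mulrA divfK// -!expRD; congr expR; ring.
apply: (has_int_derive (F := E)) => //.
apply: derivable_within_continuous => x _.
have d1 : is_derive x 1 (fun s : R => expR (- rho * (t - s)) * expR (- kappa * s))
   (expR (- rho * t) * ((rho - kappa) * expR ((rho - kappa) * x))).
  have -> : (fun s : R => expR (- rho * (t - s)) * expR (- kappa * s)) =
      (fun s => expR (- rho * t) * expR ((rho - kappa) * s)).
    by apply/funext => s; rewrite -!expRD; congr expR; ring.
  exact: (is_deriveZ (expR (- rho * t)) (is_derive_expRZ (rho - kappa) x)).
by have [] := d1.
Qed.

Lemma exp_conv_le (rho kappa t : R) : kappa < rho ->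
  expR (kappa * t) * ((expR (- kappa * t) - expR (- rho * t)) / (rho - kappa)) <= (rho - kappa)^-1.
Proof.
move=> kr; have rk : 0 < rho - kappa by rewrite subr_gt0.
rewrite mulrA ler_pdivrMr// mulVf ?gt_eqF// mulrBr -expRD mulNr addrN expR0.
by rewrite gerBl mulr_ge0// expR_ge0.
Qed.

(** A delay of at most hM costs the factor exp (kappa hM), and a nonnegative one
    keeps s - h s in the range of the hypothesis. *)
Lemma delayed_le (N h : R -> R) (hm hM kappa M T : R) : 0 < hm -> 0 <= kappa -> 0 <= M ->
  (forall t, 0 <= t -> hm <= h t <= hM) ->
  (forall s, - hM <= s <= T -> expR (kappa * s) * N s <= M) ->
  forall s, 0 <= s <= T -> N (s - h s) <= M * expR (kappa * hM) * expR (- kappa * s).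
Proof.
move=> hm0 k0 M0 hh NM s /andP[s0 sT]; have /andP[h1 h2] := hh s s0.
have /NM : - hM <= s - h s <= T by apply/andP; split; lra.
rewrite mulrC -ler_pdivlMr ?expR_gt0// => /le_trans; apply.
rewrite -mulrA ler_wpM2l// -expRN -expRD ler_expR.
have : kappa * h s <= kappa * hM by rewrite ler_wpM2l.
lra.
Qed.

End small_gain.

(** * The controlled modes *)

Section plane.
Variable R : realType.

Lemma cauchy_schwarz2 (P Q E x y : R) : P ^+ 2 + Q ^+ 2 = E ^+ 2 -> 0 <= E ->
  `|P * x + Q * y| <= E * Num.sqrt (x ^+ 2 + y ^+ 2).
Proof.
move=> PQ E0; rewrite -[leLHS]ger0_norm// -[leRHS]ger0_norm; last first.
  by rewrite mulr_ge0// sqrtr_ge0.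
rewrite -ler_sqr ?nnegrE//.
rewrite !real_normK ?num_real// exprMn sqr_sqrtr ?addr_ge0 ?sqr_ge0// -PQ.
have : 0 <= (P * y - Q * x) ^+ 2 by rewrite sqr_ge0.
lra.
Qed.

Lemma unit2_dual (x y : R) : exists al be : R, al ^+ 2 + be ^+ 2 = 1 /\
  al * x + be * y = Num.sqrt (x ^+ 2 + y ^+ 2).
Proof.
set r := Num.sqrt _; have r2 : r ^+ 2 = x ^+ 2 + y ^+ 2.
  by rewrite sqr_sqrtr// addr_ge0 ?sqr_ge0.
have [r0|r0] := eqVneq r 0.
  exists 1, 0; rewrite expr1n expr0n /= addr0 mul0r mul1r addr0; split=> //.
  have : x ^+ 2 + y ^+ 2 = 0 by rewrite -r2 r0 expr0n.
  move=> /eqP; rewrite paddr_eq0 ?sqr_ge0// sqrf_eq0 => /andP[/eqP -> _].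
  by rewrite r0.
exists (x / r), (y / r); split.
  by rewrite !exprMn -mulrDl -r2 -exprMn divff// expr1n.
have -> : x / r * x + y / r * y = (x ^+ 2 + y ^+ 2) / r by ring.
by rewrite -r2 expr2 mulfK.
Qed.

End plane.

Section modal.
Variable R : realType.
Local Notation lambda := (@lebesgue_measure R).
Variables (N0 : nat) (A : 'M[R]_N0) (c T : R) (h : R -> R).
Variables (z d : 'I_N0 -> R -> R).
Hypothesis weak : forall n t (psi psi' : R -> R), 0 <= t <= T ->
  (forall x : R, is_derive x 1 psi (psi' x)) -> continuous psi' ->
  has_int `[0, t] (fun s => psi' s * z n s + psi s *
      (\sum_j A n j * z j s + c * z n (s - h s) + d n s))
    (psi t * z n t - psi 0 * z n 0).
Variables (x y : 'rV[R]_N0) (rho w : R).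
Hypothesis xA : x *m A = - rho *: x - w *: y.
Hypothesis yA : y *m A = w *: x - rho *: y.

Let xi s := \sum_n x 0 n * z n s.
Let eta s := \sum_n y 0 n * z n s.
Definition modal_norm (x y : 'rV[R]_N0) (z : 'I_N0 -> R -> R) s :=
  Num.sqrt ((\sum_n x 0 n * z n s) ^+ 2 + (\sum_n y 0 n * z n s) ^+ 2).

(** The pair x, y spans the real invariant plane of an eigenvalue, on which the
    flow is a rotation damped at the rate rho. Testing against the solution of
    the adjoint equation that ends at a given unit vector of this plane gives
    the variation of constants formula without complex exponentials. *)
Lemma modal_duhamel kappa M P : 0 <= kappa -> kappa < rho -> 0 <= M -> 0 <= P ->
  {ae lambda, forall s, 0 <= s <= T ->
     `|\sum_n x 0 n * d n s| + `|\sum_n y 0 n * d n s| <= P * expR (- kappa * s)} ->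
  (forall s, 0 <= s <= T -> modal_norm x y z (s - h s) <= M * expR (- kappa * s)) ->
  forall t, 0 <= t <= T ->
  expR (kappa * t) * modal_norm x y z t <=
    modal_norm x y z 0 + (`|c| * M + P) / (rho - kappa).
Proof.
move=> k0 kr M0 P0 dP zM t /andP[t0 tT].
have [al [be [ab1 abt]]] := unit2_dual (xi t) (eta t).
pose E (s : R) := expR (rho * (s - t)).
pose C (s : R) := cos (w * (s - t)).
pose G (s : R) := sin (w * (s - t)).
pose Pf s := E s * (al * C s - be * G s).
pose Qf s := E s * (al * G s + be * C s).
have lin (s m : R) : is_derive s 1 (fun s => m * (s - t)) m.
  have := is_deriveZ m (is_deriveB (is_derive_id s 1) (is_derive_cst t s 1)).
  by rewrite subr0 [X in is_derive _ _ _ X]mulr1.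
have dE (s : R) : is_derive s 1 E (rho * E s).
  rewrite mulrC; exact: (@is_derive1_comp R expR (fun s => rho * (s - t)) s _ _ (is_derive_expR _) (lin s rho)).
have dC (s : R) : is_derive s 1 C (- w * G s).
  have := (@is_derive1_comp R cos (fun s => w * (s - t)) s _ _ (is_derive_cos _) (lin s w)).
  by move=> H; apply: (is_derive_eq H); rewrite /G; ring.
have dG (s : R) : is_derive s 1 G (w * C s).
  have := (@is_derive1_comp R sin (fun s => w * (s - t)) s _ _ (is_derive_sin _) (lin s w)).
  by move=> H; apply: (is_derive_eq H); rewrite /C; ring.
have dPf (s : R) : is_derive s 1 Pf (rho * Pf s - w * Qf s).
  have := is_deriveM (dE s) (is_deriveB (is_deriveZ al (dC s)) (is_deriveZ be (dG s))).
  by move=> H; apply: (is_derive_eq H); rewrite !fctE /Pf /Qf /GRing.scale/=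
    -[al *: C s]/(al * C s) -[be *: G s]/(be * G s); ring.
have dQf (s : R) : is_derive s 1 Qf (rho * Qf s + w * Pf s).
  have := is_deriveM (dE s) (is_deriveD (is_deriveZ al (dG s)) (is_deriveZ be (dC s))).
  by move=> H; apply: (is_derive_eq H); rewrite !fctE /Pf /Qf /GRing.scale/=
    -[al *: G s]/(al * G s) -[be *: C s]/(be * C s); ring.
have cont (F f : R -> R) : (forall s : R, is_derive s 1 F (f s)) -> continuous F.
  by move=> dF s; apply/differentiable_continuous/derivable1_diffP; have [] := dF s.
have cPf := cont _ _ dPf; have cQf := cont _ _ dQf.
pose psi n s := Pf s * x 0 n + Qf s * y 0 n.
pose psi' n s := (rho * Pf s - w * Qf s) * x 0 n + (rho * Qf s + w * Pf s) * y 0 n.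
have dpsi n (s : R) : is_derive s 1 (psi n) (psi' n s).
  have := is_deriveD (is_deriveZ (x 0 n) (dPf s)) (is_deriveZ (y 0 n) (dQf s)).
  set H := (X in is_derive _ _ X _ -> _).
  rewrite (_ : H = psi n); last first.
    by apply/funext => r; rewrite /H /psi (mulrC (Pf r)) (mulrC (Qf r)).
  by move=> K; apply: (is_derive_eq K); rewrite /psi' /GRing.scale/=; ring.
have cpsi' n : continuous (psi' n).
  move=> s; apply: cvgD; (apply: cvgM; last exact: cvg_cst).
    by apply: cvgB; apply: cvgM; (try exact: cvg_cst); [exact: cPf|exact: cQf].
  by apply: cvgD; apply: cvgM; (try exact: cvg_cst); [exact: cQf|exact: cPf].
have mt := @mset_itv R `[0, t].
have ttT : 0 <= t <= T by rewrite t0.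
have W := has_int_sum (index_enum 'I_N0) mt (fun n => weak n ttT (dpsi n) (cpsi' n)).
have PQ s : Pf s ^+ 2 + Qf s ^+ 2 = E s ^+ 2.
  have := cos2Dsin2 (w * (s - t)); rewrite -/(C s) -/(G s) => CG.
  have -> : Pf s ^+ 2 + Qf s ^+ 2 = E s ^+ 2 * (al ^+ 2 + be ^+ 2) * (C s ^+ 2 + G s ^+ 2).
    by rewrite /Pf /Qf; ring.
  by rewrite CG ab1 !mulr1.
have E0 s : 0 <= E s by exact: expR_ge0.
have psiz s r : \sum_n psi n s * z n r = Pf s * xi r + Qf s * eta r.
  by rewrite /xi /eta !mulr_sumr -big_split; apply: eq_bigr => n _; rewrite /psi mulrDl !mulrA.
have val : \sum_n (psi n t * z n t - psi n 0 * z n 0) =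
    modal_norm x y z t - (Pf 0 * xi 0 + Qf 0 * eta 0).
  rewrite sumrB !psiz /Pf /Qf /E /C /G subrr !mulr0 expR0 cos0 sin0 !mulr0 !mulr1 !mul1r.
  by rewrite subr0 add0r abt.
have Pd s : Pf s * (\sum_n x 0 n * d n s) + Qf s * (\sum_n y 0 n * d n s) <=
    E s * (`|\sum_n x 0 n * d n s| + `|\sum_n y 0 n * d n s|).
  have leE r q : r ^+ 2 + q ^+ 2 = E s ^+ 2 -> forall v, r * v <= E s * `|v|.
    move=> rq v; apply: le_trans (ler_norm _) _; rewrite normrM ler_wpM2r//.
    rewrite -ler_sqr ?nnegrE// -normrX ger0_norm ?sqr_ge0// -rq.
    by rewrite lerDl sqr_ge0.
  rewrite mulrDr; apply: lerD; first exact: leE (PQ s) _.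
  by apply: (leE _ (Pf s)); rewrite addrC.
have sumE s : \sum_n (psi' n s * z n s + psi n s *
      (\sum_j A n j * z j s + c * z n (s - h s) + d n s)) =
    c * (Pf s * xi (s - h s) + Qf s * eta (s - h s)) +
    (Pf s * (\sum_n x 0 n * d n s) + Qf s * (\sum_n y 0 n * d n s)).
  have vAz (v : 'rV[R]_N0) : \sum_n v 0 n * (\sum_j A n j * z j s) = \sum_j (v *m A) 0 j * z j s.
    under eq_bigr do rewrite mulr_sumr.
    rewrite exchange_big/=; apply: eq_bigr => j _; rewrite mxE mulr_suml.
    by apply: eq_bigr => n _; rewrite mulrA.
  have xAz : \sum_n x 0 n * (\sum_j A n j * z j s) = - rho * xi s - w * eta s.
    rewrite vAz xA /xi /eta !mulr_sumr -sumrB; apply: eq_bigr => n _.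
    by rewrite !mxE; ring.
  have yAz : \sum_n y 0 n * (\sum_j A n j * z j s) = w * xi s - rho * eta s.
    rewrite vAz yA /xi /eta !mulr_sumr -sumrB; apply: eq_bigr => n _.
    by rewrite !mxE; ring.
  have -> : c * (Pf s * xi (s - h s) + Qf s * eta (s - h s)) +
     (Pf s * (\sum_n x 0 n * d n s) + Qf s * (\sum_n y 0 n * d n s)) =
     ((rho * Pf s - w * Qf s) * xi s + (rho * Qf s + w * Pf s) * eta s) +
     (Pf s * (- rho * xi s - w * eta s) + Qf s * (w * xi s - rho * eta s)) +
     c * (Pf s * xi (s - h s) + Qf s * eta (s - h s)) +
     (Pf s * (\sum_n x 0 n * d n s) + Qf s * (\sum_n y 0 n * d n s)) by ring.
  rewrite -xAz -yAz /xi /eta !mulr_sumr -!big_split/= mulr_sumr -!big_split/=.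
  by apply: eq_bigr => n _; rewrite /psi' /psi; ring.
have W2 := has_intZ (`|c| * M + P) mt (has_int_exp_conv t0 kr).
have H := le_has_int mt _ W W2; rewrite val in H.
have {}H : modal_norm x y z t - (Pf 0 * xi 0 + Qf 0 * eta 0) <=
   (`|c| * M + P) * ((expR (- kappa * t) - expR (- rho * t)) / (rho - kappa)).
  apply: H; apply: filterS dP => s dPs /=; rewrite in_itv/= => /andP[s0 st].
  have sT : 0 <= s <= T by rewrite s0 (le_trans st).
  rewrite sumE.
  have Es : expR (- rho * (t - s)) = E s by rewrite /E; congr expR; ring.
  rewrite Es mulrDl; apply: lerD.
    apply: le_trans (ler_norm _) _; rewrite normrM -[leRHS]mulrA ler_wpM2l//.
    apply: le_trans (cauchy_schwarz2 _ _ (PQ s) (E0 s)) _.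
    by rewrite [leRHS]mulrCA ler_wpM2l//; exact: zM.
  apply: le_trans (Pd s) _; rewrite [leRHS]mulrCA ler_wpM2l//.
  exact: dPs.
have H0 : Pf 0 * xi 0 + Qf 0 * eta 0 <= E 0 * modal_norm x y z 0.
  by apply: le_trans (ler_norm _) _; exact: cauchy_schwarz2.
have E01 : expR (kappa * t) * E 0 <= 1.
  rewrite /E -expRD expR_le1 sub0r.
  have : 0 <= (rho - kappa) * t by rewrite mulr_ge0// subr_ge0 ltW.
  lra.
have n0 : 0 <= modal_norm x y z 0 by exact: sqrtr_ge0.
have ek0 : 0 < expR (kappa * t) by exact: expR_gt0.
have MP0 : 0 <= `|c| * M + P by rewrite addr_ge0// mulr_ge0.
have h1 := ler_wpM2l MP0 (exp_conv_le t kr).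
have h2 := ler_wpM2r n0 E01.
have h3 := ler_wpM2l (ltW ek0) H.
have h4 := ler_wpM2l (ltW ek0) H0.
set V := expR (kappa * t) in h1 h2 h3 h4 *.
set D := (_ - _) / (rho - kappa) in h1 h3.
have -> : V * modal_norm x y z t = V * (modal_norm x y z t - (Pf 0 * xi 0 + Qf 0 * eta 0)) +
  V * (Pf 0 * xi 0 + Qf 0 * eta 0) by ring.
have h5 : V * ((`|c| * M + P) * D) = (`|c| * M + P) * (V * D) by ring.
rewrite mul1r in h2.
lra.
Qed.

End modal.

Section eigen_coordinates.
Variable R : realType.

(** The minimal polynomial divides a product of distinct linear factors. The rows
    of Q are left eigenvectors. *)
Lemma diag_simple_eigenvalues n (M : 'M[R]_n.+1) (mu : 'I_n.+1 -> R[i]) :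
  simple_eigenvalues M mu -> exists (Q : 'M[R[i]]_n.+1) (D : 'rV[R[i]]_n.+1),
    [/\ Q \in unitmx, Q *m mxC M = diag_mx D *m Q & forall j, exists i, D 0 j = mu i].
Proof.
move=> [mu_inj cM].
have [|Q Qu] := (@diagonalizableP _ n (mxC M)).2.
  exists (codom mu); first by apply/injectiveP.
  rewrite big_image/= (eq_bigl xpredT)//= -cM; exact: mxminpoly_dvd_char.
move=> /diagonalizable_forPex[D /(simmxP Qu) QD].
exists Q, D; split => // j.
have : eigenvalue (mxC M) (D 0 j).
  apply/eigenvalueP; exists (row j Q).
    by rewrite -row_mul QD row_mul row_diag_mx -scalemxAl -rowE.
  apply/negP => /eqP Qj0; have := mulmxV Qu; move=> /(congr1 (row j)).
  rewrite row_mul Qj0 mul0mx => /rowP/(_ j); rewrite !mxE eqxx => /esym/eqP.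
  by rewrite oner_eq0.
rewrite eigenvalue_root_char cM -(big_map mu xpredT (fun z => 'X - z%:P)).
by rewrite root_prod_XsubC => /mapP[i _ ->]; exists i.
Qed.

Lemma ReD (x y : R[i]) : complex.Re (x + y) = complex.Re x + complex.Re y.
Proof. by case: x y => ? ? [? ?]. Qed.

Lemma ImD (x y : R[i]) : complex.Im (x + y) = complex.Im x + complex.Im y.
Proof. by case: x y => ? ? [? ?]. Qed.

Lemma ReM (x y : R[i]) : complex.Re (x * y) = complex.Re x * complex.Re y - complex.Im x * complex.Im y.
Proof. by case: x y => ? ? [? ?]. Qed.

Lemma ImM (x y : R[i]) : complex.Im (x * y) = complex.Re x * complex.Im y + complex.Im x * complex.Re y.
Proof. by case: x y => ? ? [? ?]. Qed.

Lemma Re_sum (I : Type) (s : seq I) (F : I -> R[i]) :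
  complex.Re (\sum_(i <- s) F i) = \sum_(i <- s) complex.Re (F i).
Proof. by apply: (big_morph _ ReD). Qed.

Lemma Im_sum (I : Type) (s : seq I) (F : I -> R[i]) :
  complex.Im (\sum_(i <- s) F i) = \sum_(i <- s) complex.Im (F i).
Proof. by apply: (big_morph _ ImD). Qed.

(** Real and imaginary parts of the left eigenvectors: the moduli of the complex
    coordinates control the vector, since the eigenvectors form a basis. *)
Lemma real_eigen_coordinates n (M : 'M[R]_n.+1) (mu : 'I_n.+1 -> R[i]) :
  simple_eigenvalues M mu ->
  exists (x y : 'I_n.+1 -> 'rV[R]_n.+1) (m w : 'I_n.+1 -> R) (B : R), [/\ 0 <= B,
    forall j, exists i, m j = complex.Re (mu i),
    forall j, x j *m M = m j *: x j - w j *: y j,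
    forall j, y j *m M = w j *: x j + m j *: y j &
    forall (z : 'I_n.+1 -> R -> R) s k, `|z k s| <= B * \sum_j modal_norm (x j) (y j) z s].
Proof.
move=> /diag_simple_eigenvalues[Q [D [Qu QD Dmu]]].
pose x j : 'rV[R]_n.+1 := \row_k complex.Re (Q j k).
pose y j : 'rV[R]_n.+1 := \row_k complex.Im (Q j k).
pose nc (v : R[i]) := Num.sqrt (complex.Re v ^+ 2 + complex.Im v ^+ 2).
pose B := \sum_k \sum_j nc (invmx Q k j).
have nc0 v : 0 <= nc v by exact: sqrtr_ge0.
have QDE j k : \sum_l Q j l * real_complex R (M l k) = D 0 j * Q j k.
  have := congr1 (fun N : 'M[R[i]]_(n.+1) => N j k) QD; rewrite mul_diag_mx !mxE => <-.
  by apply: eq_bigr => l _; rewrite !mxE.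
exists x, y, (fun j => complex.Re (D 0 j)), (fun j => complex.Im (D 0 j)), B; split.
- by apply: sumr_ge0 => k _; apply: sumr_ge0.
- by move=> j; have [i ->] := Dmu j; exists i.
- move=> j; apply/rowP => k; rewrite !mxE -ReM -QDE Re_sum.
  by apply: eq_bigr => l _; rewrite !mxE ReM /= mulr0 subr0.
- move=> j; apply/rowP => k; rewrite !mxE addrC -ImM -QDE Im_sum.
  by apply: eq_bigr => l _; rewrite !mxE ImM /= mulr0 add0r.
move=> z s k.
pose wj j := \sum_l Q j l * real_complex R (z l s).
have wE j : modal_norm (x j) (y j) z s = nc (wj j).
  rewrite /modal_norm /nc /wj Re_sum Im_sum; congr (Num.sqrt (_ ^+ 2 + _ ^+ 2)).
    by apply: eq_bigr => l _; rewrite !mxE ReM /= mulr0 subr0.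
  by apply: eq_bigr => l _; rewrite !mxE ImM /= mulr0 add0r.
have zE : z k s = \sum_j complex.Re (invmx Q k j * wj j).
  rewrite -Re_sum.
  have : invmx Q *m (Q *m (\col_l real_complex R (z l s))) = \col_l real_complex R (z l s) by rewrite mulmxA mulVmx// mul1mx.
  move=> /colP/(_ k); rewrite !mxE => E.
  rewrite -[LHS]/(complex.Re (real_complex R (z k s))) -E; congr complex.Re.
  by apply: eq_bigr => j _; rewrite !mxE; congr (_ * _); apply: eq_bigr => l _; rewrite !mxE.
rewrite zE; apply: le_trans (ler_norm_sum _ _ _) _.
rewrite mulr_sumr; apply: ler_sum => j _; rewrite wE ReM.
have h := @cauchy_schwarz2 R (complex.Re (invmx Q k j)) (- complex.Im (invmx Q k j)) (nc (invmx Q k j))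
   (complex.Re (wj j)) (complex.Im (wj j)).
rewrite mulNr in h; apply: le_trans (h _ _) _ => //.
  by rewrite sqrrN sqr_sqrtr// addr_ge0// sqr_ge0.
rewrite ler_wpM2r//.
rewrite /B (bigD1 k)//= (bigD1 j)//= -addrA lerDl addr_ge0//.
  by apply: sumr_ge0.
by apply: sumr_ge0 => k' _; apply: sumr_ge0.
Qed.

End eigen_coordinates.

(** * The uncontrolled modes *)

Section tail.
Variable R : realType.
Local Notation lambda := (@lebesgue_measure R).
Variables (e : nat -> L2 R) (X p : R -> L2 R) (nu : nat -> R) (c T : R) (h : R -> R).
Variables (N0 : nat) (v : nat -> R -> R).
Hypothesis be : hilbert_basis e.
Let z n s := inner (X s) (e n).
Hypothesis weak : forall n t (psi psi' : R -> R), 0 <= t <= T ->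
  (forall x : R, is_derive x 1 psi (psi' x)) -> continuous psi' ->
  has_int `[0, t] (fun s => psi' s * z n s + psi s *
      (nu n * z n s + v n s + c * z n (s - h s) + inner (p s) (e n)))
    (psi t * z n t - psi 0 * z n 0).

Definition tail s := X s - \sum_(i < N0) inner (X s) (e i) *: e i.

Lemma inner_tail n s : inner (tail s) (e n) = if (N0 <= n)%N then z n s else 0.
Proof.
rewrite /tail innerBl; have [Nn|nN] := leqP N0 n; last first.
  by rewrite (inner_comb be (fun i => inner (X s) (e i)) (Ordinal nN)) subrr.
rewrite inner_suml big1 ?subr0// => i _; rewrite innerZl (inner_basis be).
by rewrite ltn_eqF ?mulr0// (leq_trans (ltn_ord i)).
Qed.

(** The sum is the inner product of f with a vector of norm at most
    exp (- sigma r) |x|. *)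
Lemma damped_sum_le sigma r N (x : 'I_N -> R) f : 0 <= r ->
  (forall n, (N0 <= n)%N -> nu n <= - sigma) ->
  `|\sum_(i < N | (N0 <= i)%N) x i * expR (nu i * r) * inner f (e i)| <=
    `|f| * (expR (- sigma * r) * Num.sqrt (\sum_(i < N) x i ^+ 2)).
Proof.
move=> r0 nus.
pose y (i : 'I_N) := if (N0 <= i)%N then x i * expR (nu i * r) else 0.
have -> : \sum_(i < N | (N0 <= i)%N) x i * expR (nu i * r) * inner f (e i) =
    inner f (\sum_(i < N) y i *: e i).
  rewrite inner_sumr big_mkcond; apply: eq_bigr => i _; rewrite innerZr /y.
  by case: ifP => _; rewrite ?mul0r.
apply: le_trans (norm_inner_le _ _) _; apply: ler_wpM2l => //.
rewrite (norm_comb be) -(ger0_norm (expR_ge0 (- sigma * r))) -sqrtr_sqr -sqrtrM ?sqr_ge0//.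
rewrite ler_wsqrtr// mulr_sumr; apply: ler_sum => i _; rewrite /y; case: ifP => Ni; last first.
  by rewrite expr0n /= mulr_ge0// sqr_ge0.
rewrite exprMn mulrC ler_wpM2r ?sqr_ge0// ler_pXn2r ?nnegrE ?expR_ge0// ler_expR.
by rewrite ler_wpM2r// nus.
Qed.

(** Pairing with a unit vector and integrating each damped mode separately: the
    control term is summable although the input coefficients are not, because
    each of them is divided by its decay rate. *)
Lemma tail_duhamel kappa sigma (g : nat -> R) G M P : 0 <= kappa -> kappa < sigma ->
  0 <= M -> 0 <= P -> 0 <= G ->
  (forall n, (N0 <= n)%N -> nu n <= - sigma) ->
  (forall n s, (N0 <= n)%N -> 0 <= s <= T -> `|v n s| <= g n * expR (- kappa * s)) ->
  (forall n, 0 <= g n) ->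
  (forall N (x : 'I_N -> R), \sum_(i < N | (N0 <= i)%N) `|x i| * (g i / (- nu i - kappa)) <=
     G * Num.sqrt (\sum_(i < N) x i ^+ 2)) ->
  {ae lambda, forall s, 0 <= s <= T -> `|p s| <= P * expR (- kappa * s)} ->
  (forall s, 0 <= s <= T -> `|tail (s - h s)| <= M * expR (- kappa * s)) ->
  forall t, 0 <= t <= T ->
  expR (kappa * t) * `|tail t| <= `|tail 0| + (G + (`|c| * M + P) / (sigma - kappa)).
Proof.
move=> k0 ks M0 P0 G0 nus vg g0 gG pP tM t /andP[t0 tT].
have ek0 : 0 < expR (kappa * t) by exact: expR_gt0.
set K := (X in _ <= X); have K0 : 0 <= K.
  apply: addr_ge0 => //; apply: addr_ge0 => //; apply: divr_ge0.
    by rewrite addr_ge0// mulr_ge0.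
  by rewrite subr_ge0 ltW.
rewrite mulrC -ler_pdivlMr//; apply: (dual_norm_le be); first by rewrite divr_ge0// ltW.
move=> N x; set nx := Num.sqrt _; have nx0 : 0 <= nx by exact: sqrtr_ge0.
have -> : \sum_(i < N) x i * inner (tail t) (e i) = \sum_(i < N | (N0 <= i)%N) x i * z i t.
  rewrite [RHS]big_mkcond; apply: eq_bigr => i _; rewrite inner_tail.
  by case: ifP => _; rewrite ?mulr0.
rewrite mulrAC ler_pdivlMr// mulrC.
have mt := @mset_itv R `[0, t].
pose y (i : 'I_N) := if (N0 <= i)%N then x i else 0.
pose psi (i : 'I_N) (s : R) := y i * expR (nu i * (t - s)).
pose psi' (i : 'I_N) (s : R) := - nu i * (y i * expR (nu i * (t - s))).
have dpsi i (s : R) : is_derive s 1 (psi i) (psi' i s).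
  have -> : psi i = (fun s => (y i * expR (nu i * t)) * expR (- nu i * s)).
    by apply/funext => r; rewrite /psi -mulrA -expRD; congr (_ * expR _); ring.
  apply: (is_derive_eq (is_deriveZ (y i * expR (nu i * t)) (is_derive_expRZ (- nu i) s))).
  rewrite /GRing.scale/= /psi' mulrCA -mulrA -expRD; congr (_ * (_ * expR _)); ring.
have cpsi i : continuous (psi i).
  by move=> s; apply/differentiable_continuous/derivable1_diffP; have [] := dpsi i s.
have cpsi' i : continuous (psi' i).
  by move=> s; apply: cvgM; [exact: cvg_cst|exact: cpsi].
have ttT : 0 <= t <= T by rewrite t0.
have W := has_int_sum (index_enum 'I_N) mt (fun i : 'I_N => weak i ttT (dpsi i) (cpsi' i)).
have conv (i : 'I_N) : has_int `[0, t]
    (fun s => `|y i| * g i * (expR (nu i * (t - s)) * expR (- kappa * s)))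
    (`|y i| * g i * ((expR (- kappa * t) - expR (nu i * t)) / (- nu i - kappa))).
  rewrite /y; case: ifP => Ni; last first.
    by rewrite normr0 !mul0r; apply: eq_has_int (has_int0 _) => s _; rewrite !mul0r.
  apply: has_intZ => //; rewrite -{1 2}(opprK (nu i)).
  by apply: has_int_exp_conv => //; have := nus _ Ni; lra.
have W2 := has_intD mt (has_int_sum (index_enum 'I_N) mt conv)
   (has_intZ ((`|c| * M + P) * nx) mt (has_int_exp_conv t0 ks)).
have H := le_has_int mt _ W W2.
have ysum (r : R) (F : nat -> R) : \sum_(i < N) y i * expR (nu i * r) * F i =
    \sum_(i < N | (N0 <= i)%N) x i * expR (nu i * r) * F i.
  by rewrite [RHS]big_mkcond; apply: eq_bigr => i _; rewrite /y; case: ifP => _; rewrite ?mul0r.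
have val : \sum_(i < N) (psi i t * z i t - psi i 0 * z i 0) =
    \sum_(i < N | (N0 <= i)%N) x i * z i t -
    \sum_(i < N | (N0 <= i)%N) x i * expR (nu i * t) * inner (tail 0) (e i).
  rewrite sumrB; congr (_ - _).
    rewrite [RHS]big_mkcond; apply: eq_bigr => i _.
    rewrite /psi subrr mulr0 expR0 mulr1 /y; by case: ifP => _; rewrite ?mul0r.
  rewrite [RHS]big_mkcond; apply: eq_bigr => i _; rewrite /psi subr0 /y inner_tail.
  by case: ifP => _; rewrite ?mul0r.
have bnd s : s \in `[0, t] -> `|p s| <= P * expR (- kappa * s) ->
  \sum_(i < N) (psi' i s * z i s + psi i s * (nu i * z i s + v i s + c * z i (s - h s) + inner (p s) (e i)))
  <= \sum_(i < N) `|y i| * g i * (expR (nu i * (t - s)) * expR (- kappa * s)) +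
   (`|c| * M + P) * nx * (expR (- sigma * (t - s)) * expR (- kappa * s)).
  rewrite in_itv/= => /andP[s0 st] ps.
  have sT : 0 <= s <= T by rewrite s0 (le_trans st).
  have ts : 0 <= t - s by rewrite subr_ge0.
  have -> : \sum_(i < N) (psi' i s * z i s + psi i s * (nu i * z i s + v i s + c * z i (s - h s) + inner (p s) (e i)))
    = \sum_(i < N) psi i s * v i s +
      (c * (\sum_(i < N | (N0 <= i)%N) x i * expR (nu i * (t - s)) * inner (tail (s - h s)) (e i)) +
       \sum_(i < N | (N0 <= i)%N) x i * expR (nu i * (t - s)) * inner (p s) (e i)).
    rewrite mulr_sumr !(big_mkcond (fun i : 'I_N => (N0 <= i)%N)) -!big_split/=; apply: eq_bigr => i _.
    rewrite /psi' /psi /y inner_tail; case: ifP => _; last by rewrite !mul0r mulr0 mul0r !addr0.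
    by ring.
  apply: lerD.
    apply: ler_sum => i _; rewrite /psi /y; case: ifP => Ni; last by rewrite normr0 !mul0r.
    apply: le_trans (ler_norm _) _; rewrite !normrM (ger0_norm (expR_ge0 _)).
    have -> : `|x i| * g i * (expR (nu i * (t - s)) * expR (- kappa * s)) =
      `|x i| * expR (nu i * (t - s)) * (g i * expR (- kappa * s)) by ring.
    by rewrite ler_wpM2l ?mulr_ge0 ?expR_ge0//; exact: vg.
  have -> : (`|c| * M + P) * nx * (expR (- sigma * (t - s)) * expR (- kappa * s)) =
     `|c| * (M * expR (- kappa * s) * (expR (- sigma * (t - s)) * nx)) +
     P * expR (- kappa * s) * (expR (- sigma * (t - s)) * nx) by ring.
  have en0 : 0 <= expR (- sigma * (t - s)) * nx by rewrite mulr_ge0// expR_ge0.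
  apply: lerD; apply: le_trans (ler_norm _) _.
    rewrite normrM ler_wpM2l//; apply: le_trans (damped_sum_le x _ ts nus) _.
    by rewrite ler_wpM2r// tM.
  apply: le_trans (damped_sum_le x _ ts nus) _; by rewrite ler_wpM2r.
have sub s : s \in `[0, t] -> 0 <= s <= T.
  by rewrite in_itv/= => /andP[-> /le_trans]; apply.
have {}H := H (filterS (fun s ps st => bnd s st (ps (sub s st))) pP).
have {}H := H (ae_lebesgue_filter R); rewrite val in H.
set U := \sum_(i < N) `|y i| * _ * _ in H.
set I0 := \sum_(i < N | _) x i * expR _ * _ in H.
set D := (expR (- kappa * t) - _) / _ in H.
have h1 : expR (kappa * t) * U <= G * nx.
  apply: le_trans (gG N x); rewrite /U mulr_sumr [leRHS]big_mkcond.
  apply: ler_sum => i _; rewrite /y; case: ifP => Ni; last by rewrite normr0 !mul0r mulr0.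
  have ki : kappa < - nu i by have := nus _ Ni; lra.
  rewrite mulrCA [leRHS]mulrA; apply: ler_wpM2l; first by rewrite mulr_ge0.
  by have := exp_conv_le t ki; rewrite opprK.
have h2 : expR (kappa * t) * I0 <= `|tail 0| * nx.
  apply: le_trans (ler_wpM2l (ltW ek0) (ler_norm _)) _.
  apply: le_trans (ler_wpM2l (ltW ek0) (damped_sum_le x (tail 0) t0 nus)) _.
  rewrite mulrCA ler_wpM2l// mulrA -expRD ler_piMl// expR_le1.
  have : 0 <= (sigma - kappa) * t by rewrite mulr_ge0// subr_ge0 ltW.
  lra.
have cMP : 0 <= (`|c| * M + P) * nx by rewrite mulr_ge0// addr_ge0// mulr_ge0.
have h3 := ler_wpM2l cMP (exp_conv_le t ks).
have h4 := ler_wpM2l (ltW ek0) H.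
rewrite /K; set V := expR (kappa * t) in h1 h2 h3 h4 *.
rewrite -/D -/V in h3.
have h5 : V * ((`|c| * M + P) * nx * D) = (`|c| * M + P) * nx * (V * D) by ring.
lra.
Qed.

End tail.

(** * Essential suprema and matrix norms *)

Section norms.
Variable R : realType.
Local Notation lambda := (@lebesgue_measure R).

Section ess_sup_on.
Variables (T : R) (g : R -> R).
Local Notation muT := (mrestr (@lebesgue_measure R) (measurable_itv `[0%R, T])).

Lemma ae_mrestr_itv (P : R -> Prop) :
  {ae muT, forall s, P s} <-> {ae lambda, forall s, s \in `[0, T] -> P s}.
Proof.
split=> [[N [mN N0 sN]]|[N [mN N0 sN]]].
  exists (N `&` `[0, T]); split; first by apply: measurableI => //; exact: measurable_itv.
  - exact: N0.
  - move=> s /= /not_implyP[sT nP]; split => //; exact: sN.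
exists (N `|` ~` `[0, T]); split.
- by apply: measurableU => //; apply: measurableC; exact: measurable_itv.
- rewrite /= /mrestr setIUl setICl setU0.
  apply/eqP; rewrite eq_le measure_ge0 andbT -N0; apply: le_measure; rewrite ?inE//.
  by apply: measurableI => //; exact: measurable_itv.
- move=> s /= nP; have [sT|sT] := pselect (s \in `[0, T]); last by right.
  by left; apply: sN => /= h; apply: nP; exact: h.
Qed.

Lemma ess_sup_on_ge0 : (0 <= ess_sup_on T g)%E.
Proof. exact: Lnorm_ge0. Qed.

Lemma ess_sup_on_ae : {ae lambda, forall s, s \in `[0, T] -> (`|g s|%:E <= ess_sup_on T g)%E}.
Proof.
rewrite /ess_sup_on unlock; case: ifPn => [_|].
  apply/ae_mrestr_itv; have := @ess_sup_ge _ _ _ muT (abse \o (EFin \o g)).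
  by apply: filterS.
rewrite -leNgt => muT0; exists `[0, T]%classic; split.
- exact: measurable_itv.
- by apply/eqP; rewrite eq_le measure_ge0 andbT; move: muT0; rewrite /= /mrestr setTI.
- by move=> s /= /not_implyP[].
Qed.

Lemma ess_sup_on_le (M : R) : 0 <= M ->
  {ae lambda, forall s, s \in `[0, T] -> `|g s| <= M} -> (ess_sup_on T g <= M%:E)%E.
Proof.
move=> M0 gM; rewrite /ess_sup_on unlock; case: ifPn => _; last by rewrite lee_fin.
apply/ess_supP; apply/ae_mrestr_itv; apply: filterS gM => s h /h.
by rewrite /= lee_fin.
Qed.

End ess_sup_on.

Lemma sup_norm_ge (V : normedModType R) (a b : R) (F : R -> V) : a <= b ->
  {within `[a, b], continuous F} ->
  forall t, t \in `[a, b] -> `|F t| <= sup [set `|F s| | s in `[a, b]].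
Proof.
move=> ab cF t tab.
have cn : {within `[a, b], continuous (fun s => `|F s|)}.
  by move=> x; apply: cvg_norm; exact: cF.
have [m mab mmax] := EVT_max ab cn.
apply: sup_upper_bound; last by exists t.
by split; [exists `|F t|, t|exists `|F m| => _ [s sab <-]; exact: mmax].
Qed.

Lemma enorm_ge0 n (x : 'cV[R]_n) : 0 <= enorm x. Proof. exact: sqrtr_ge0. Qed.

Lemma enormZ n (r : R) (x : 'cV[R]_n) : enorm (r *: x) = `|r| * enorm x.
Proof.
rewrite /enorm -sqrtr_sqr -sqrtrM ?sqr_ge0// mulr_sumr; congr Num.sqrt.
by apply: eq_bigr => i _; rewrite mxE exprMn.
Qed.

Lemma enorm_entry n (x : 'cV[R]_n) i : `|x i 0| <= enorm x.
Proof.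
rewrite /enorm -sqrtr_sqr ler_wsqrtr// (bigD1 i)//= lerDl.
by apply: sumr_ge0 => j _; rewrite sqr_ge0.
Qed.

Lemma enorm0 n : enorm (0 : 'cV[R]_n) = 0.
Proof. by rewrite /enorm big1 ?sqrtr0// => i _; rewrite mxE expr0n. Qed.

Lemma mxnorm2_le m n (M : 'M[R]_(m, n)) (x : 'cV[R]_n) :
  enorm (M *m x) <= mxnorm2 M * enorm x.
Proof.
pose U := [set enorm (M *m y) | y in [set y : 'cV[R]_n | enorm y <= 1]].
have hsU : has_sup U.
  split; first by exists (enorm (M *m 0)), 0 => //=; rewrite enorm0.
  pose B := \sum_i \sum_j `|M i j|.
  have B0 : 0 <= B by apply: sumr_ge0 => i _; apply: sumr_ge0.
  exists (Num.sqrt (\sum_(i < m) B ^+ 2)) => _ [y /= y1 <-].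
  rewrite /enorm ler_wsqrtr//; apply: ler_sum => i _.
  rewrite -ler_sqrt ?sqr_ge0// !sqrtr_sqr (ger0_norm B0) mxE.
  apply: le_trans (ler_norm_sum _ _ _) _.
  apply: (@le_trans _ _ (\sum_j `|M i j|)).
    by apply: ler_sum => j _; rewrite normrM ler_piMr// (le_trans (enorm_entry _ _)).
  by rewrite /B [leRHS](bigD1 i)//= lerDl; apply: sumr_ge0 => k _; apply: sumr_ge0.
have [x0|x0] := eqVneq (enorm x) 0.
  have -> : x = 0.
    apply/colP => i; rewrite mxE; apply/eqP; rewrite -normr_le0 -x0.
    exact: enorm_entry.
  by rewrite mulmx0 !enorm0 mulr0.
have xp : 0 < enorm x by rewrite lt_neqAle eq_sym x0 enorm_ge0.
rewrite -ler_pdivrMr// mulrC -(ger0_norm (ltW xp)) -normfV -enormZ scalemxAr.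
apply: sup_upper_bound => //; exists ((enorm x)^-1 *: x) => //=.
by rewrite enormZ normfV (ger0_norm (ltW xp)) mulVf.
Qed.

Lemma mxnorm2_ge0 m n (M : 'M[R]_(m, n)) : (0 < n)%N -> 0 <= mxnorm2 M.
Proof.
case: n M => // n M _.
have := mxnorm2_le M (delta_mx 0 0).
have -> : enorm (delta_mx 0 0 : 'cV[R]_n.+1) = 1.
  rewrite /enorm (bigD1 0)//= big1 => [|i i0]; last by rewrite mxE (negbTE i0) expr0n.
  by rewrite mxE eqxx addr0 expr1n sqrtr1.
by rewrite mulr1; apply: le_trans; exact: enorm_ge0.
Qed.

Lemma enorm_modes_le (e : nat -> L2 R) N0 (X : R -> L2 R) t : hilbert_basis e ->
  enorm (modes e N0 X t) <= `|X t|.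
Proof.
move=> be; set Y := modes e N0 X t.
have [Y0|Y0] := eqVneq (enorm Y) 0; first by rewrite Y0.
have Yp : 0 < enorm Y by rewrite lt_neqAle eq_sym Y0 enorm_ge0.
have := inner_le_norm (X t) (\sum_(i < N0) Y i 0 *: e i).
rewrite (norm_comb be) -/(enorm Y) inner_sumr.
have -> : \sum_(i < N0) inner (X t) (Y i 0 *: e i) = enorm Y * enorm Y.
  rewrite -expr2 sqr_sqrtr; last by apply: sumr_ge0 => i _; rewrite sqr_ge0.
  by apply: eq_bigr => i _; rewrite innerZr /Y mxE expr2.
by rewrite ler_pM2r.
Qed.

(** With suitable signs of the coefficients the sum is an inner product with f. *)
Lemma sum_abs_inner_le (e : nat -> L2 R) (P : pred nat) N (x : 'I_N -> R) f : hilbert_basis e ->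
  \sum_(i < N | P i) `|x i| * `|inner f (e i)| <= `|f| * Num.sqrt (\sum_(i < N) x i ^+ 2).
Proof.
move=> be.
pose y (i : 'I_N) := if P i then `|x i| * Num.sg (inner f (e i)) else 0.
have -> : \sum_(i < N | P i) `|x i| * `|inner f (e i)| = inner f (\sum_(i < N) y i *: e i).
  rewrite inner_sumr big_mkcond; apply: eq_bigr => i _; rewrite innerZr /y.
  by case: ifP => _; rewrite ?mul0r// -mulrA -normrEsg.
apply: le_trans (inner_le_norm _ _) _; rewrite (norm_comb be) ler_wpM2l// ler_wsqrtr//.
apply: ler_sum => i _; rewrite /y; case: ifP => _; last by rewrite expr0n sqr_ge0.
rewrite exprMn real_normK ?num_real// ler_piMr ?sqr_ge0// sqr_sg.
by case: (_ != _).
Qed.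

End norms.

(** * Decay of the closed loop *)

Lemma spectral_semigroup (R : realType) (a b c th1 th2 : R) (S : R -> L2 R -> L2 R)
    (lam : nat -> R) (e : nat -> L2 R) :
  C0_semigroup S -> generates S (domA0 th1 th2) (opA a b) ->
  spectral_data a b c th1 th2 lam e ->
  forall n t f, 0 <= t -> inner (S t f) (e n) = expR ((lam n - c) * t) * inner f (e n).
Proof.
move=> CS gS [_ _ _ eE be]; apply: (inner_semigroup be CS) => n t t0.
have [_ dom AE] := eE n.
apply: (C0_semigroup_eigenvector CS _ t0).
have [+ _] := gS (e n) ((lam n - c) *: e n); apply; split => //.
by rewrite scalerBl -AE /opAc addrK.
Qed.

(** For kappa <= g / 4 and exp (kappa hM) <= 5 / 4 the gain of the delayed term
    is at most (5 / 4) g / (2 g - g / 4) = 5 / 7. *)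
Lemma delay_gain (R : realType) (g T hm hM kappa A1 F : R) (N h : R -> R) :
  0 < g -> 0 < hm -> 0 <= T ->
  0 <= kappa -> kappa <= g / 4 -> expR (kappa * hM) <= 5 / 4 ->
  (forall t, 0 <= t -> hm <= h t <= hM) -> 0 <= A1 -> 0 <= F ->
  (forall s, 0 <= N s) -> {within `[0, T], continuous N} ->
  (forall s, - hM <= s <= 0 -> N s <= F) ->
  (forall M, 0 <= M ->
    (forall s, 0 <= s <= T -> N (s - h s) <= M * expR (- kappa * s)) ->
    forall t, 0 <= t <= T ->
      expR (kappa * t) * N t <= A1 + g * M / (2 * g - kappa)) ->
  forall t, 0 <= t <= T -> expR (kappa * t) * N t <= 7 / 2 * (A1 + F).
Proof.
move=> g0 hm0 T0 kappa0 kc kh hh A10 F0 N0 cN NF gain t tT.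
have q1 : 0 <= (5 / 7 : R) < 1 by lra.
suff : expR (kappa * t) * N t <= (A1 + F) / (1 - 5 / 7).
  by have -> : (A1 + F) / (1 - 5 / 7) = 7 / 2 * (A1 + F) by field.
apply: (small_gain T0 kappa0 q1 A10 F0 N0 cN NF) tT => M M0 NM s sT.
have M1 : 0 <= M * expR (kappa * hM) by rewrite mulr_ge0// expR_ge0.
apply: le_trans (gain _ M1 _ _ sT) _.
  by move=> r rT; apply: (delayed_le hm0 kappa0 M0 hh NM rT).
have dp : 0 < 2 * g - kappa by lra.
rewrite lerD2l ler_pdivrMr//.
have : g * (M * expR (kappa * hM)) <= g * (M * (5 / 4)).
  by rewrite ler_wpM2l ?(ltW g0)// ler_wpM2l.
have : kappa * M <= g / 4 * M by rewrite ler_wpM2r.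
by lra.
Qed.

Section closed_loop.
Variables (R : realType) (a b c th1 th2 : R) (k : nat).
Variables (S : R -> L2 R -> L2 R) (lam : nat -> R) (e : nat -> L2 R).
Variables (hm hM : R) (N0 : nat) (K : 'M[R]_(2, N0)).
Hypotheses (k2 : (2 <= k)%N) (CS : C0_semigroup S).
Hypothesis gS : generates S (domA0 th1 th2) (opA a b).
Hypothesis sd : spectral_data a b c th1 th2 lam e.
Hypothesis (hM0 : 0 <= hM).

Local Notation Lf m := (lifting th1 th2 k (delta_mx m 0)).
Local Notation B := (matB a b c th1 th2 k lam e).
Local Notation Acl := (matA lam N0 + B N0 *m K).

Definition input_coef (i : nat) (m : 'I_2) : R :=
  - lam i * inner (Lf m) (e i) + inner (opAc a b c (Lf m)) (e i).

Variables (h : R -> R) (Phi p X : R -> L2 R).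
Hypothesis clX : closed_loop_mild_solution a b c th1 th2 k S e K hM h Phi p X.
Let z i s := inner (X s) (e i).
Let u s := K *m modes e N0 X s.
Let v i s := input_coef i 0 * u s 0 0 + input_coef i 1 * u s 1 0.

Lemma closed_loop_mode i t (psi psi' : R -> R) : 0 <= t ->
  (forall x : R, is_derive x 1 psi (psi' x)) -> continuous psi' ->
  has_int `[0, t] (fun s => psi' s * z i s + psi s *
    ((lam i - c) * z i s + v i s + c * z i (s - h s) + inner (p s) (e i)))
    (psi t * z i t - psi 0 * z i 0).
Proof.
move=> t0 dpsi cpsi'; have [acu mX] := clX.
have := mode_weak k2 hM0 (spectral_semigroup CS gS sd i) acu mX t0 dpsi cpsi'.
apply: eq_has_int => s _; rewrite /v /input_coef /opAc !innerDl !innerZl.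
have shift (l x y : R) : - l * x + (y + c * x) = - (l - c) * x + y by ring.
by congr (_ + _ * (_ + (_ * _ + _ * _) + _ + _)); exact: shift.
Qed.

(** The lam i are eigenvalues of A_0 + c, whereas the undelayed part of the
    equation has the operator A_0: hence the shift by c. *)
Lemma closed_loop_matrix (i : 'I_N0) s :
  \sum_j (Acl - c%:M) i j * z j s = (lam i - c) * z i s + v i s.
Proof.
have -> : \sum_j (Acl - c%:M) i j * z j s = ((Acl - c%:M) *m modes e N0 X s) i 0.
  by rewrite mxE; apply: eq_bigr => j _; rewrite [modes _ _ _ _ _ _]mxE.
rewrite mulmxBl mulmxDl -mulmxA mul_scalar_mx -/(u s).
have BU : (B N0 *m u s) i 0 = v i s.
  rewrite mxE big_ord_recl big_ord1 /v.
  have -> : lift ord0 ord0 = 1 :> 'I_2 by apply/val_inj.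
  by congr (_ * _ + _ * _); rewrite mxE.
have regroup (l x y : R) : l * x + y - c * x = (l - c) * x + y by ring.
rewrite -regroup -BU /matA mul_diag_mx; move: (B N0 *m u s) => V; by rewrite !mxE.
Qed.


Section bounds.
Variables (T kappa F P : R).
Hypotheses (c0 : c != 0) (hm0 : 0 < hm) (T0 : 0 <= T).
Hypotheses (kappa0 : 0 <= kappa) (kc : kappa <= `|c| / 4).
Hypothesis kh : expR (kappa * hM) <= 5 / 4.
Hypothesis hh : forall t, 0 <= t -> hm <= h t <= hM.
Hypotheses (F0 : 0 <= F) (P0 : 0 <= P).
Hypothesis XF : forall s, - hM <= s <= 0 -> `|X s| <= F.
Hypothesis pP : {ae (@lebesgue_measure R), forall s, 0 <= s <= T ->
  `|p s| <= P * expR (- kappa * s)}.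

Lemma continuous_mild : {within `[0, T], continuous X}.
Proof.
have [_ [_ cX _]] := clX; apply: continuous_subspaceW cX => s /=.
by rewrite !in_itv/= andbT => /andP[].
Qed.

Definition comb_bound (x y : 'rV[R]_N0) :=
  `|\sum_(i < N0) x 0 i *: e i| + `|\sum_(i < N0) y 0 i *: e i|.

Lemma comb_bound_ge0 x y : 0 <= comb_bound x y.
Proof. by rewrite addr_ge0. Qed.

Lemma comb_inner_le (x y : 'rV[R]_N0) f :
  `|\sum_(i < N0) x 0 i * inner f (e i)| + `|\sum_(i < N0) y 0 i * inner f (e i)| <= comb_bound x y * `|f|.
Proof.
have E (w : 'rV[R]_N0) : \sum_(i < N0) w 0 i * inner f (e i) = inner f (\sum_(i < N0) w 0 i *: e i).
  by rewrite inner_sumr; apply: eq_bigr => i _; rewrite innerZr.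
by rewrite !E mulrC mulrDr lerD// norm_inner_le.
Qed.

Lemma modal_norm_le (x y : 'rV[R]_N0) s : modal_norm x y z s <= comb_bound x y * `|X s|.
Proof.
apply: le_trans (comb_inner_le x y (X s)); rewrite /modal_norm /z.
set A := \sum_n _; set D := \sum_n _.
rewrite -[leRHS]ger0_norm ?addr_ge0// -sqrtr_sqr ler_wsqrtr// sqrrD !real_normK ?num_real//.
by rewrite lerD2r lerDl mulrn_wge0// mulr_ge0.
Qed.

Lemma continuous_modal_norm (x y : 'rV[R]_N0) : {within `[0, T], continuous (modal_norm x y z)}.
Proof.
have cS (w : 'rV[R]_N0) : {within `[0, T], continuous (fun s => \sum_(n < N0) w 0 n * z n s)}.
  have -> : (fun s => \sum_(n < N0) w 0 n * z n s) =
      (fun s => inner (X s) (\sum_(n < N0) w 0 n *: e n)).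
    by apply/funext => s; rewrite inner_sumr; apply: eq_bigr => n _; rewrite innerZr.
  exact: within_continuous_inner continuous_mild.
move=> s; apply: continuous_comp; last exact: sqrt_continuous.
by apply: cvgD; apply: cvgM; exact: cS.
Qed.

Lemma modal_decay (x y : 'rV[R]_N0) m w t : 2 * `|c| <= c - m ->
  x *m Acl = m *: x - w *: y -> y *m Acl = w *: x + m *: y ->
  0 <= t <= T ->
  expR (kappa * t) * modal_norm x y z t <=
    comb_bound x y * (7 / 2 * (2 + (2 * `|c| - kappa)^-1) * (F + P)).
Proof.
move=> cm xA yA tT; set D := comb_bound x y.
have D0 : 0 <= D := comb_bound_ge0 x y.
have g0 : 0 < `|c| by rewrite normr_gt0.
have [gk r0] : 0 < 2 * `|c| - kappa /\ 0 <= (2 * `|c| - kappa)^-1.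
  have gap (g l : R) : 0 < g -> l <= g / 4 -> 0 < 2 * g - l by lra.
  by rewrite invr_ge0 ltW; have := gap _ _ g0 kc.
have krho : kappa < c - m by rewrite (lt_le_trans _ cm)// -subr_gt0.
set r := (2 * `|c| - kappa)^-1 in r0 *.
have A10 : 0 <= D * F + D * P * r by rewrite addr_ge0 ?mulr_ge0.
have xB : x *m (Acl - c%:M) = - (c - m) *: x - w *: y.
  by rewrite mulmxBr xA mul_mx_scalar scaleNr scalerBl; rewrite opprB addrAC.
have yB : y *m (Acl - c%:M) = w *: x - (c - m) *: y.
  by rewrite mulmxBr yA mul_mx_scalar scalerBl opprB -addrA.
have weak (n : 'I_N0) s (psi psi' : R -> R) : 0 <= s <= T ->
    (forall x : R, is_derive x 1 psi (psi' x)) -> continuous psi' ->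
    has_int `[0, s] (fun r => psi' r * z n r + psi r *
      (\sum_j (Acl - c%:M) n j * z j r + c * z n (r - h r) + inner (p r) (e n)))
    (psi s * z n s - psi 0 * z n 0).
  move=> /andP[s0 _] dpsi cpsi'; apply: eq_has_int (closed_loop_mode n s0 dpsi cpsi').
  by move=> q _; rewrite closed_loop_matrix.
have N0F s : - hM <= s <= 0 -> modal_norm x y z s <= D * F.
  by move=> sh; apply: le_trans (modal_norm_le x y s) _; rewrite ler_wpM2l// XF.
have pD : {ae (@lebesgue_measure R), forall s, 0 <= s <= T ->
    `|\sum_(n < N0) x 0 n * inner (p s) (e n)| + `|\sum_(n < N0) y 0 n * inner (p s) (e n)|
      <= D * P * expR (- kappa * s)}.
  apply: filterS pP => s H sT; apply: le_trans (comb_inner_le x y (p s)) _.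
  by rewrite -mulrA ler_wpM2l// H.
apply: le_trans (delay_gain (F := D * F) (A1 := D * F + D * P * r) g0 hm0 T0 kappa0 kc kh hh
  A10 _ _ (continuous_modal_norm (x := x) (y := y)) N0F _ tT) _.
- exact: mulr_ge0.
- by move=> s; exact: sqrtr_ge0.
- move=> M M0 NM s sT.
  apply: le_trans (modal_duhamel weak xB yB kappa0 krho M0 (mulr_ge0 D0 P0) pD NM sT) _.
  have HN : modal_norm x y z 0 <= D * F by rewrite N0F// lexx andbT oppr_le0.
  have : (`|c| * M + D * P) / (c - m - kappa) <= (`|c| * M + D * P) * r.
    rewrite ler_wpM2l ?addr_ge0 ?mulr_ge0// /r lef_pV2 ?posrE ?subr_gt0// ?lerD2r//.
    by rewrite -subr_gt0.
  move=> H; rewrite -[leRHS]addrA; apply: lerD => //; apply: le_trans H _; by rewrite -/r mulrDl addrC.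
have FP : 0 <= D * P * 2 + D * F * r by rewrite addr_ge0 ?mulr_ge0.
have E (d f q : R) : 0 <= d * q * 2 + d * f * r ->
  7 / 2 * (d * f + d * q * r + d * f) <= d * (7 / 2 * (2 + r) * (f + q)) by lra.
exact: E.
Qed.

Lemma tail_norm_le s : `|tail e X N0 s| <= (1 + N0%:R) * `|X s|.
Proof.
have [_ _ _ eE _] := sd.
rewrite /tail mulrDl mul1r; apply: le_trans (ler_normB _ _) _; rewrite lerD2l.
apply: le_trans (ler_norm_sum _ _ _) _.
apply: (@le_trans _ _ (\sum_(i < N0) `|X s|)); last first.
  by rewrite sumr_const card_ord mulr_natl.
apply: ler_sum => i _; have [e1 _ _] := eE i.
by rewrite normrZ e1 mulr1 (le_trans (norm_inner_le _ _))// e1 mulr1.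
Qed.

Lemma continuous_tail : {within `[0, T], continuous (fun s => `|tail e X N0 s|)}.
Proof.
move=> s; apply: cvg_norm; apply: cvgB; first exact: continuous_mild.
apply: cvg_big => [|i _]; first exact: add_continuous.
apply: cvgZr_tmp.
have := (@within_continuous_inner R _ X (e i) continuous_mild s); exact.
Qed.

Definition input_gain :=
  \sum_(m < 2) (2 * `|Lf m| + `|opAc a b c (Lf m)| / (2 * `|c|)).

Lemma input_gain_ge0 : 0 <= input_gain.
Proof. by apply: sumr_ge0 => m _; rewrite addr_ge0// ?mulr_ge0// ?divr_ge0// mulr_ge0. Qed.

Lemma lam_tail n : lam N0 < - (4 * `|c|) -> (N0 <= n)%N -> lam n < - (4 * `|c|).
Proof.
move=> lamN; rewrite leq_eqVlt => /orP[/eqP <-//|Nn].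
by have [lam_dec _ _ _ _] := sd; apply: lt_trans lamN; exact: lam_dec.
Qed.

(** The coefficients grow like the eigenvalues, which their division by the
    decay rates compensates: what is left are square summable coefficients of
    the lifting and of its image. *)
Lemma input_coef_damped n m : lam N0 < - (4 * `|c|) -> (N0 <= n)%N ->
  `|input_coef n m| / (- (lam n - c) - kappa) <=
    2 * `|inner (Lf m) (e n)| + `|inner (opAc a b c (Lf m)) (e n)| / (2 * `|c|).
Proof.
move=> lamN Nn; have ln := lam_tail lamN Nn.
have g0 : 0 < `|c| by rewrite normr_gt0.
have main (g l cc x y K' kk d : R) : 0 < g -> l < - (4 * g) -> - g <= cc -> kk <= g / 4 ->
    0 <= x -> 0 <= y -> K' <= - l * x + y -> d = - (l - cc) - kk ->
    K' / d <= 2 * x + y / (2 * g).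
  move=> gp ll cg kg x0 y0 Kxy dE.
  have d0 : 0 < d by rewrite dE; lra.
  rewrite ler_pdivrMr// mulrDl; apply: le_trans Kxy _; apply: lerD.
    have : - l * x <= (2 * d) * x by rewrite ler_wpM2r// dE; lra.
    by rewrite [2 * x * d]mulrAC.
  rewrite -mulrA ler_peMr// mulrC ler_pdivlMr ?mulr_gt0// mul1r dE; lra.
apply: (main `|c| (lam n) c _ _ _ kappa) => //.
  by rewrite lerNl -normrN ler_norm.
rewrite /input_coef (le_trans (ler_normD _ _))// lerD2r normrM normrN [`|lam n|]ltr0_norm//.
by rewrite (lt_le_trans ln)// oppr_le0 mulr_ge0.
Qed.

(** For the tail the control is an exogenous input, of size U. *)
Lemma tail_decay U t : lam N0 < - (4 * `|c|) -> 0 <= U ->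
  (forall m s, 0 <= s <= T -> `|u s m 0| <= U * expR (- kappa * s)) ->
  0 <= t <= T ->
  expR (kappa * t) * `|tail e X N0 t| <=
    7 / 2 * (2 * (1 + N0%:R) * F + U * input_gain + P / (2 * `|c| - kappa)).
Proof.
move=> lamN U0 uU tT.
have [_ _ _ _ be] := sd.
have g0 : 0 < `|c| by rewrite normr_gt0.
have gk : 0 < 2 * `|c| - kappa.
  have gap (g l : R) : 0 < g -> l <= g / 4 -> 0 < 2 * g - l by lra.
  exact: gap g0 kc.
have ks : kappa < 2 * `|c| by rewrite -subr_gt0.
have N1 : 0 <= 1 + N0%:R :> R by rewrite addr_ge0.
have G0 : 0 <= U * input_gain by rewrite mulr_ge0// input_gain_ge0.
pose g n := (`|input_coef n 0| + `|input_coef n 1|) * U.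
have g_ge0 n : 0 <= g n by rewrite mulr_ge0// addr_ge0.
have vg n s : (N0 <= n)%N -> 0 <= s <= T -> `|v n s| <= g n * expR (- kappa * s).
  move=> _ sT; rewrite /v /g -mulrA [leRHS]mulrDl (le_trans (ler_normD _ _))// !normrM.
  by rewrite lerD// ler_wpM2l// uU.
have nus n : (N0 <= n)%N -> lam n - c <= - (2 * `|c|).
  move=> Nn; have := lam_tail lamN Nn; have : - c <= `|c| by rewrite -normrN ler_norm.
  have A (l cc gg : R) : 0 < gg -> - cc <= gg -> l < - (4 * gg) -> l - cc <= - (2 * gg) by lra.
  exact: A.
have weak n s (psi psi' : R -> R) : 0 <= s <= T ->
    (forall x : R, is_derive x 1 psi (psi' x)) -> continuous psi' ->
    has_int `[0, s] (fun r => psi' r * z n r + psi r *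
      ((lam n - c) * z n r + v n r + c * z n (r - h r) + inner (p r) (e n)))
    (psi s * z n s - psi 0 * z n 0).
  by move=> /andP[s0 _] dpsi cpsi'; exact: closed_loop_mode.
have gG N (x : 'I_N -> R) : \sum_(i < N | (N0 <= i)%N) `|x i| * (g i / (- (lam i - c) - kappa))
    <= U * input_gain * Num.sqrt (\sum_(i < N) x i ^+ 2).
  set q := Num.sqrt _.
  apply: (@le_trans _ _ (U * \sum_(m < 2) \sum_(i < N | (N0 <= i)%N) `|x i| *
      (2 * `|inner (Lf m) (e i)| + `|inner (opAc a b c (Lf m)) (e i)| / (2 * `|c|)))).
    rewrite exchange_big mulr_sumr; apply: ler_sum => i Ni.
    rewrite -mulr_sumr [leRHS]mulrCA ler_wpM2l// /g mulrAC [leRHS]mulrC ler_wpM2r//.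
    rewrite big_ord_recl big_ord1 mulrDl lerD//; first exact: input_coef_damped.
    have -> : lift ord0 ord0 = 1 :> 'I_2 by apply/val_inj.
    exact: input_coef_damped.
  rewrite -mulrA ler_wpM2l// /input_gain mulr_suml; apply: ler_sum => m _.
  have E (i : 'I_N) : `|x i| * (2 * `|inner (Lf m) (e i)| + `|inner (opAc a b c (Lf m)) (e i)| / (2 * `|c|))
    = 2 * (`|x i| * `|inner (Lf m) (e i)|) +
      (2 * `|c|)^-1 * (`|x i| * `|inner (opAc a b c (Lf m)) (e i)|).
    by rewrite mulrDr mulrCA; congr (_ + _); rewrite mulrA mulrC.
  under eq_bigr do rewrite E.
  rewrite big_split -!mulr_sumr [leRHS]mulrDl /=; apply: lerD.
    by rewrite -mulrA ler_wpM2l// (sum_abs_inner_le _ _ _ be).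
  rewrite mulrAC [leRHS]mulrC ler_wpM2l ?invr_ge0 ?mulr_ge0//.
  exact: (sum_abs_inner_le _ _ _ be).
have NF s : - hM <= s <= 0 -> `|tail e X N0 s| <= (1 + N0%:R) * F.
  by move=> sh; apply: le_trans (tail_norm_le s) _; rewrite ler_wpM2l// XF.
have A10 : 0 <= (1 + N0%:R) * F + U * input_gain + P / (2 * `|c| - kappa).
  by rewrite !addr_ge0// ?mulr_ge0// ?invr_ge0// ltW.
apply: le_trans (delay_gain (N := fun s => `|tail e X N0 s|)
  (F := (1 + N0%:R) * F) g0 hm0 T0 kappa0 kc kh hh
  A10 (mulr_ge0 N1 F0) _ continuous_tail NF _ tT) _ => //.
- move=> M M0 NM s sT.
  apply: le_trans (tail_duhamel be weak kappa0 ks M0 P0 G0 nus vg g_ge0 gG pP NM sT) _.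
  have shuffle (x y q r w : R) : x <= y -> x + (q + (r + w)) <= y + q + w + r by lra.
  by rewrite [(_ + P) / _]mulrDl; apply: shuffle; rewrite NF// lexx andbT oppr_le0.
have E (f q s : R) : 7 / 2 * (f + q + s + f) <= 7 / 2 * (2 * f + q + s) by lra.
by rewrite -[2 * _ * F]mulrA.
Qed.

End bounds.

End closed_loop.

(** * Exponential stability *)

(** The feedback only involves the controlled modes, so their decay comes first;
    it bounds the control, and through it the tail. *)
Lemma closed_loop_decay (R : realType) (a b c th1 th2 : R) (k : nat)
    (S : R -> L2 R -> L2 R) (lam : nat -> R) (e : nat -> L2 R) (hm hM kappa : R)
    (n : nat) (K : 'M[R]_(2, n.+1)) (mu : 'I_n.+1 -> R[i]) :
  (2 <= k)%N -> C0_semigroup S -> generates S (domA0 th1 th2) (opA a b) ->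
  spectral_data a b c th1 th2 lam e -> c != 0 -> 0 < hm -> 0 <= hM ->
  lam n.+1 < - (4 * `|c|) ->
  simple_eigenvalues (matA lam n.+1 + matB a b c th1 th2 k lam e n.+1 *m K) mu ->
  (forall i, complex.Re (mu i) < - (3 * `|c|)) ->
  0 <= kappa -> kappa <= `|c| / 4 -> expR (kappa * hM) <= 5 / 4 ->
  exists2 C, 0 <= C & forall (h : R -> R) (Phi p X : R -> L2 R) (T F P : R),
    closed_loop_mild_solution a b c th1 th2 k S e K hM h Phi p X ->
    0 <= T -> (forall t, 0 <= t -> hm <= h t <= hM) -> 0 <= F -> 0 <= P ->
    (forall s, - hM <= s <= 0 -> `|X s| <= F) ->
    {ae (@lebesgue_measure R), forall s, 0 <= s <= T ->
      `|p s| <= P * expR (- kappa * s)} ->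
    expR (kappa * T) * `|X T| <= C * (F + P).
Proof.
move=> k2 CS gS sd c0 hm0 hM0 lamN simple muc kappa0 kc kh.
have g0 : 0 < `|c| by rewrite normr_gt0.
have gk : 0 < 2 * `|c| - kappa by lra.
have [x [y [m [w [B [B0 mE xA yA zB]]]]]] := real_eigen_coordinates simple.
have cm j : 2 * `|c| <= c - m j.
  have [i ->] := mE j; have := muc i; have : - c <= `|c| by rewrite -normrN ler_norm.
  by move: (complex.Re _) => r; lra.
set r := (2 * `|c| - kappa)^-1.
have r0 : 0 <= r by rewrite invr_ge0 ltW.
pose CY := B * \sum_j (comb_bound e (x j) (y j) * (7 / 2 * (2 + r))).
have CY0 : 0 <= CY.
  by rewrite mulr_ge0// sumr_ge0// => j _; rewrite mulr_ge0 ?comb_bound_ge0//; lra.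
pose KK := \sum_m \sum_j `|K m j|.
have KK0 : 0 <= KK by apply: sumr_ge0 => i _; apply: sumr_ge0.
pose N1 : R := 1 + n.+1%:R.
have N10 : 0 <= N1 by rewrite addr_ge0.
have G0 := input_gain_ge0 a b c th1 th2 k.
pose CZ := 7 / 2 * (2 * N1 + KK * CY * input_gain a b c th1 th2 k + r).
have CZ0 : 0 <= CZ by rewrite mulr_ge0 ?divr_ge0 ?addr_ge0 ?(mulr_ge0 (mulr_ge0 KK0 CY0)) ?mulr_ge0.
exists (CZ + n.+1%:R * CY).
  by rewrite addr_ge0// mulr_ge0.
move=> h Phi p X T F P clX T0 hh F0 P0 XF pP.
have FP0 : 0 <= F + P by rewrite addr_ge0.
have modeT (i : 'I_n.+1) s : 0 <= s <= T ->
    `|inner (X s) (e i)| <= CY * (F + P) * expR (- kappa * s).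
  move=> sT; apply: le_trans (zB (fun i s => inner (X s) (e i)) s i) _.
  rewrite /CY -!mulrA ler_wpM2l// mulr_suml; apply: ler_sum => j _.
  have := modal_decay k2 CS gS sd hM0 clX c0 hm0 T0 kappa0 kc kh hh F0 P0 XF pP
    (cm j) (xA j) (yA j) sT.
  by rewrite mulrC -ler_pdivlMr ?expR_gt0// mulNr expRN -!mulrA.
have uT i s : 0 <= s <= T ->
    `|(K *m modes e n.+1 X s) i 0| <= KK * CY * (F + P) * expR (- kappa * s).
  move=> sT; rewrite mxE; apply: le_trans (ler_norm_sum _ _ _) _.
  apply: (@le_trans _ _ (\sum_j `|K i j| * (CY * (F + P) * expR (- kappa * s)))).
    by apply: ler_sum => j _; rewrite normrM ler_wpM2l// mxE modeT.
  rewrite -mulr_suml; have -> : KK * CY * (F + P) * expR (- kappa * s) =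
      KK * (CY * (F + P) * expR (- kappa * s)) by rewrite !mulrA.
  apply: ler_wpM2r; first exact: mulr_ge0 (mulr_ge0 CY0 FP0) (expR_ge0 _).
  by rewrite /KK [leRHS](bigD1 i)//= lerDl sumr_ge0// => j _; apply: sumr_ge0.
have TT : 0 <= T <= T by rewrite T0 lexx.
have U0 : 0 <= KK * CY * (F + P) := mulr_ge0 (mulr_ge0 KK0 CY0) FP0.
have tailT := tail_decay k2 CS gS sd hM0 clX c0 hm0 T0 kappa0 kc kh hh F0 P0 XF pP
  lamN U0 uT TT.
have XT : `|X T| <= `|tail e X n.+1 T| + \sum_(i < n.+1) `|inner (X T) (e i)|.
  rewrite -{1}[X T](subrK (\sum_(i < n.+1) inner (X T) (e i) *: e i)).
  rewrite (le_trans (ler_normD _ _))// lerD2l (le_trans (ler_norm_sum _ _ _))//.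
  apply: ler_sum => i _; have [_ _ _ eE _] := sd; have [e1 _ _] := eE i.
  by rewrite normrZ e1 mulr1.
have sumT : \sum_(i < n.+1) `|inner (X T) (e i)| <=
    n.+1%:R * (CY * (F + P) * expR (- kappa * T)).
  apply: (@le_trans _ _ (\sum_(i < n.+1) (CY * (F + P) * expR (- kappa * T)))).
    by apply: ler_sum => i _; exact: modeT.
  by rewrite sumr_const card_ord mulr_natl.
apply: le_trans (ler_wpM2l (expR_ge0 _) XT) _; rewrite mulrDr mulrDl; apply: lerD.
  apply: le_trans tailT _; rewrite /CZ -/r -/N1 -/(input_gain _ _ _ _ _ _).
  have E (f q u s N r' : R) : 0 <= N * q -> 0 <= r' * f ->
    7 / 2 * (2 * N * f + u * (f + q) * s + q * r') <= 7 / 2 * (2 * N + u * s + r') * (f + q) by lra.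
  by apply: E; rewrite mulr_ge0.
apply: le_trans (ler_wpM2l (expR_ge0 _) sumT) _.
rewrite mulrCA -[leRHS]mulrA ler_wpM2l// mulrCA -expRD mulNr subrr expR0 mulr1//.
Qed.

Theorem theorem3 (R : realType) (a b c th1 th2 : R) (k : nat)
    (S : R -> L2 R -> L2 R) (lam : nat -> R) (e : nat -> L2 R)
    (hm hM : R) (N0 : nat) (K : 'M[R]_(2, N0)) (mu : 'I_N0 -> R[i]) :
  0 < a -> c != 0 ->
  0 <= th1 < 2 * pi -> 0 <= th2 < 2 * pi ->
  (2 <= k)%N ->
  cos th1 + k%:R * sin th1 != 0 -> cos th2 + k%:R * sin th2 != 0 ->
  C0_semigroup S -> generates S (domA0 th1 th2) (opA a b) ->
  spectral_data a b c th1 th2 lam e ->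
  0 < hm -> hm < hM ->
  (1 <= N0)%N ->
  lam N0 < - (2 * Num.sqrt 5 * `|c|) ->
  let Acl := matA lam N0 + matB a b c th1 th2 k lam e N0 *m K in
  hurwitz Acl -> simple_eigenvalues Acl mu ->
  (forall n, complex.Re (mu n) < - (3 * `|c|)) ->
  exists kappa C0 C1 : R, [/\ 0 < kappa, 0 < C0, 0 < C1 &
    forall (Phi p : R -> L2 R) (h : R -> R) (X : R -> L2 R),
      {within `[- hM, 0], continuous Phi} ->
      Linfty_loc p ->
      {within `[0, +oo[, continuous h} ->
      (forall t, 0 <= t -> hm <= h t <= hM) ->
      closed_loop_mild_solution a b c th1 th2 k S e K hM h Phi p X ->
      let supPhi := sup [set `|Phi tau| | tau in `[- hM, 0]] in
      let supp t := ess_sup_on t (fun tau => expR (- kappa * (t - tau)) * `|p tau|) in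
      let u t := K *m modes e N0 X t in
      (forall t, 0 <= t ->
        (`|X t|%:E <= (C0 * expR (- kappa * t) * supPhi)%:E + C1%:E * supp t)%E) /\
      (forall t, 0 <= t ->
        ((enorm (u t))%:E <= (C0 * mxnorm2 K * expR (- kappa * t) * supPhi)%:E
                             + (C1 * mxnorm2 K)%:E * supp t)%E)].
Proof.
move=> a0 c0 _ _ k2 _ _ CS gS sd hm0 hmM N1 lamN.
case: N0 K mu N1 lamN => // n K mu _ lamN Acl _ simple muc.
have hM0 : 0 < hM := lt_trans hm0 hmM.
have g0 : 0 < `|c| by rewrite normr_gt0.
have lamN4 : lam n.+1 < - (4 * `|c|).
  apply: lt_le_trans lamN _; rewrite lerN2 ler_wpM2r//.
  have : 2 <= Num.sqrt 5 :> R.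
    by rewrite -[leLHS]gtr0_norm// -sqrtr_sqr ler_wsqrtr// -natrX ler_nat.
  by lra.
have [kappa [kappa0 kc kh]] : exists kappa : R,
    [/\ 0 < kappa, kappa <= `|c| / 4 & expR (kappa * hM) <= 5 / 4].
  have p54 : 0 < (5 / 4 : R) by lra.
  exists (Num.min (`|c| / 4) (ln (5 / 4) / hM)); split.
  - by rewrite lt_min !divr_gt0//= ln_gt0//; lra.
  - by rewrite ge_min lexx.
  - by rewrite -[leRHS](lnK p54) ler_expR -ler_pdivlMr// ge_min lexx orbT.
have [C Cge0 Cdecay] := closed_loop_decay (K := K) (mu := mu) (k := k) k2 CS gS sd c0
  hm0 (ltW hM0) lamN4 simple muc (ltW kappa0) kc kh.
exists kappa, (C + 1), (C + 1); split=> //; [by lra|by lra|].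
move=> Phi p h X cPhi [_ pb] _ hh clX supPhi supp u.
have hM0' : - hM <= 0 by rewrite oppr_le0 ltW.
have PhiF := sup_norm_ge hM0' cPhi.
have F0 : 0 <= supPhi.
  by apply: le_trans (normr_ge0 (Phi 0)) (PhiF 0 _); rewrite in_itv/= hM0' lexx.
have XF s : - hM <= s <= 0 -> `|X s| <= supPhi.
  move=> sh; have [_ [XPhi _ _]] := clX.
  by rewrite XPhi ?in_itv//; apply: PhiF; rewrite in_itv.
(* On [0, t] the weighted supremum r means |p s| <= r exp (kappa t) exp (- kappa s);
   the factor exp (kappa t) is undone by the decay of X at the time t. *)
have main t : 0 <= t -> exists2 r, 0 <= r & supp t = r%:E /\
    `|X t| <= (C + 1) * expR (- kappa * t) * supPhi + (C + 1) * r.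
  move=> t0; set q := fun tau => expR (- kappa * (t - tau)) * `|p tau|.
  have [M pM] := pb t t0.
  have sM : (supp t <= `|M|%:E)%E.
    apply: ess_sup_on_le => //; apply: filterS pM => s H st.
    rewrite normrM normr_id ger0_norm ?expR_ge0//.
    apply: le_trans (le_trans (H st) (ler_norm _)).
    rewrite ler_piMl// -expR0 ler_expR mulNr oppr_le0 mulr_ge0 ?(ltW kappa0)//.
    by rewrite subr_ge0; move: st; rewrite in_itv/= => /andP[].
  have s0 : (0 <= supp t)%E := ess_sup_on_ge0 _ _.
  have sfin : supp t \is a fin_num.
    by rewrite ge0_fin_numE// (le_lt_trans sM)// ltry.
  exists (fine (supp t)); first by rewrite fine_ge0.
  rewrite fineK//; split=> //; set r := fine (supp t).
  have r0 : 0 <= r by rewrite fine_ge0.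
  have P0 : 0 <= r * expR (kappa * t) by rewrite mulr_ge0// expR_ge0.
  have pP : {ae (@lebesgue_measure R), forall s, 0 <= s <= t ->
      `|p s| <= r * expR (kappa * t) * expR (- kappa * s)}.
    apply: filterS (ess_sup_on_ae t q) => s H st.
    have := H st; rewrite -/(supp t) -(fineK sfin) lee_fin -/r.
    rewrite /q normrM normr_id ger0_norm ?expR_ge0// => H1.
    rewrite -mulrA -expRD mulNr -mulrBr -ler_pdivrMr ?expR_gt0// -expRN -mulNr mulrC.
    exact: H1.
  have := Cdecay h Phi p X t supPhi _ clX t0 hh F0 P0 XF pP.
  rewrite mulrC -ler_pdivlMr ?expR_gt0// -expRN -mulNr => /le_trans; apply.
  rewrite mulrAC -mulrA mulrDr mulrCA -expRD mulNr addNr expR0 mulr1.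
  rewrite mulrDr; apply: lerD.
    by rewrite mulrA ler_wpM2r// ler_wpM2r ?expR_ge0// lerDl.
  by rewrite ler_wpM2r// lerDl.
split=> t t0; have [r r0 [-> Xt]] := main t t0.
  by rewrite -EFinM -EFinD lee_fin.
rewrite -EFinM -EFinD lee_fin; apply: le_trans (mxnorm2_le _ _) _.
have [_ _ _ _ be] := sd.
have K0 := mxnorm2_ge0 K isT.
apply: le_trans (ler_wpM2l K0 (le_trans (enorm_modes_le _ _ _ be) Xt)) _.
by rewrite le_eqVlt; apply/orP; left; apply/eqP; ring.
Qed.
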